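(* Let $c$ be a Coxeter element of $\widetilde S_n$. For any choice of real numbers $q_{\mathrm{out}}+q_{\mathrm{inn}}=1$, the interval $[1,c]_{T\cup F}$ (with $F$ the corresponding set of factored translations) is isomorphic as a labeled poset to the interval $[1,c]_{T\cup L}$ in $S_{\mathbb Z}\bmod n$. Consequently the interval group constructed from $[1,c]_{T\cup F}$ is isomorphic to the interval group constructed from $[1,c]_{T\cup L}$.
   Context: Fix $n\ge2$. $S_{\mathbb Z}\bmod n$: bijections $\pi$ of $\mathbb Z$ with $\pi(i+n)=\pi(i)+n$; $\widetilde S_n$: those with $\sum_{i=1}^n\pi(i)=\binom{n+1}2$, a Coxeter group with simple reflections $s_i=(i\ \ i+1)_n$ ($1\le i\le n$, indices mod $n$), where $(a_1\cdots a_k)_n=\prod_\ell(a_1+\ell n\ \cdots\ a_k+\ell n)$. $T=\{(i\ \ j)_n:i\not\equiv j\bmod n\}$; loops $\ell_i$ send $i+kn\mapsto i+(k+1)n$ and fix integers $\not\equiv i$; $L=\{\ell_i^{\pm1}\}$. $[1,c]_{T\cup L}$ is the interval from $1$ to $c$ in $S_{\mathbb Z}\bmod n$ for $u\le w$ iff $\ell_{T\cup L}(w)=\ell_{T\cup L}(u)+\ell_{T\cup L}(u^{-1}w)$, covers $u\lessdot w$ labeled $u^{-1}w$. Outer points: $i$ with $s_{i-1}$ preceding $s_i$ in $c$; inner points: the others ($s_0=s_n$). Geometry. In $\mathbb R^{n+1}$, $\delta=\mathbf e_{n+1}-\mathbf e_1$, $\mathbf e_{i+n}=\mathbf e_i+\delta$;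 $\alpha_i=\mathbf e_{i+1}-\mathbf e_i$ span $V$; $K$ is the standard inner product on span$(\mathbf e_1,..,\mathbf e_n)$ with $K(\mathbf e_{n+1},x)=K(\mathbf e_1,x)$, $a_{ij}=K(\alpha_i,\alpha_j)$. $\widetilde S_n$ acts on $V$ via $\mathbf e_i\mapsto\mathbf e_{\pi(i)}$ and on $V^*$ by $(\pi x)(v)=x(\pi^{-1}v)$. $\rho_i$: dual basis of $V^*$ to the $\alpha_i$; $\sigma_i=\rho_i-\rho_{i-1}$ (indices mod $n$). $E=\{x:\langle x,\delta\rangle=1\}$, $E_0=\{\langle x,\delta\rangle=0\}$. $\omega_c(\alpha_i,\alpha_j)=a_{ij}$ if $s_i$ follows $s_j$ in $c$, $0$ if $i=j$, $-a_{ij}$ otherwise. $U_0=\mathbb R\omega_c(\delta,\cdot)$, $U_{\mathrm{out}}=\{\sum_{i\text{ outer}}c_i\sigma_i:\sum c_i=0\}$, $U_{\mathrm{inn}}=\{\sum_{i\text{ inner}}c_i\sigma_i:\sum c_i=0\}$, and $E_0=U_0\oplus U_{\mathrm{out}}\oplus U_{\mathrm{inn}}$. Factored translations: for each element of $[1,c]_T$ (absolute order interval in $\widetilde S_n$) acting on $E$ as a translation by $\lambda=\lambda_0+\lambda_{\mathrm{out}}+\lambda_{\mathrm{inn}}$, its factored translations are the translations of $E$ by $\lambda_{\mathrm{out}}+q_{\mathrm{out}}\lambda_0$ and by $\lambda_{\mathrm{inn}}+q_{\mathrm{inn}}\lambda_0$, viewed as linear maps $x\mapsto x+\langle x,\delta\rangle\mu$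 of $V^*$; $F$ is the set of all of them. In the group generated by $T\cup F$ each element of $T\cup F\cup F^{-1}$ has length $1$; $[1,c]_{T\cup F}$ is the resulting interval, covers labeled $u^{-1}w$. The interval group of a labeled interval is the group presented by the labels appearing in it, with relations equating the label products along any two unrefinable chains with common endpoints.
   Formalization: Excluded: if there is exactly one inner point, weights with s·q_out=1 for some s in {1,-1,2,-2} such that the number of outer points divides s−1; likewise with outer and inner exchanged. There the claim fails (e.g. n=2, q_out=0: c itself is a factored translation). *)

(* Defs.v *)
From HB Require Import structures.
From mathcomp Require Import all_boot all_order all_algebra.
From mathcomp Require Import all_classical reals.
From mathcomp Require Import zify.

Set Implicit Arguments.
Unset Strict Implicit.
Unset Printing Implicit Defensive.

Import Order.TTheory GRing.Theory Num.Theory.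
Local Open Scope classical_set_scope.

Record selfbij (X : Type) := SelfBij {
  sbfun :> X -> X;
  sbinv : X -> X;
  sbfunK : cancel sbfun sbinv;
  sbinvK : cancel sbinv sbfun }.

Section SelfBijGroup.
Variable X : Type.
Implicit Types f g h : selfbij X.

Lemma selfbijP f g : sbfun f =1 sbfun g -> f = g.
Proof.
case: f g => [f f' fK f'K] [g g' gK g'K] /= /funext efg.
move: efg gK g'K => <- {g} gK g'K.
have e : f' = g' by apply/funext => x; rewrite -{1}[x]g'K fK.
move: e gK g'K => <- gK g'K.
by rewrite (Prop_irrelevance fK gK) (Prop_irrelevance f'K g'K).
Qed.

HB.instance Definition _ := gen_eqMixin (selfbij X).
HB.instance Definition _ := gen_choiceMixin (selfbij X).

Definition sb_one : selfbij X := @SelfBij X id id (fun=> erefl) (fun=> erefl).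
Definition sb_inv f : selfbij X := SelfBij (@sbinvK _ f) (@sbfunK _ f).
(* products act from right to left: [(f * g) x = f (g x)] *)
Definition sb_mul f g : selfbij X :=
  SelfBij (can_comp (@sbfunK _ f) (@sbfunK _ g))
          (can_comp (@sbinvK _ g) (@sbinvK _ f)).

Lemma sb_mulA : associative sb_mul. Proof. by move=> f g h; apply: selfbijP. Qed.
Lemma sb_mul1 : left_id sb_one sb_mul. Proof. by move=> f; apply: selfbijP. Qed.
Lemma sb_mulr1 : right_id sb_one sb_mul. Proof. by move=> f; apply: selfbijP. Qed.
Lemma sb_mulV : left_inverse sb_one sb_inv sb_mul.
Proof. by move=> f; apply: selfbijP => x /=; exact: sbfunK. Qed.
Lemma sb_mulrV : right_inverse sb_one sb_inv sb_mul.
Proof. by move=> f; apply: selfbijP => x /=; exact: sbinvK. Qed.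

HB.instance Definition _ :=
  isGroup.Build (selfbij X) sb_mulA sb_mul1 sb_mulr1 sb_mulV sb_mulrV.
End SelfBijGroup.

Section Intervals.
Local Open Scope group_scope.
Variables (G : groupType) (S : set G).
Implicit Types u v w c : G.

Definition is_word (k : nat) u :=
  exists s : seq G,
    [/\ size s = k, (forall x, x \in s -> S x) & \prod_(x <- s) x = u].

(* [S] is meant to be closed under inverses; an element outside the subgroup
   generated by [S] has no length, and so is not comparable to anything *)
Definition has_length u (k : nat) :=
  is_word k u /\ forall j, is_word j u -> (k <= j)%N.

Definition word_le u w := exists j k,
  [/\ has_length u j, has_length (u^-1 * w) k & has_length w (j + k)].

Definition interval c : set G := [set u | word_le 1 u /\ word_le u c].

Definition cover c u w :=
  [/\ interval c u, interval c w, word_le u w, u != w &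
      forall v, interval c v -> word_le u v -> word_le v w -> v = u \/ v = w].

Definition labels c : set G := [set a | exists u w, cover c u w /\ a = u^-1 * w].

(* [chain c u w s]: [s] is the sequence of labels along some unrefinable chain
   from [u] to [w] in the interval [1,c] *)
Inductive chain c : G -> G -> seq (labels c) -> Prop :=
| chain_nil u : interval c u -> chain u u [::]
| chain_cons u v w (a : labels c) s :
    cover c u v -> val a = u^-1 * v -> chain v w s -> chain u w (a :: s).

Definition chain_rel c (s1 s2 : seq (labels c)) :=
  exists u w, chain u w s1 /\ chain u w s2.
End Intervals.

Definition labeled_poset_iso (G1 G2 : groupType) (S1 : set G1) (c1 : G1)
    (S2 : set G2) (c2 : G2) : Prop :=
  exists (f : G1 -> G2) (g : G1 -> G2),
  [/\ set_bij (interval S1 c1) (interval S2 c2) f,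
      set_bij (labels S1 c1) (labels S2 c2) g,
      forall u w, interval S1 c1 u -> interval S1 c1 w ->
        (word_le S1 u w <-> word_le S2 (f u) (f w)) &
      forall u w, cover S1 c1 u w ->
        ((f u)^-1 * f w = g (u^-1 * w))%g].

Section Presentation.
Variables (X : choiceType) (rel : seq X -> seq X -> Prop).

(* [(x, true)] stands for the generator [x], [(x, false)] for its inverse *)
Local Notation word := (seq (X * bool)).

Definition posword (s : seq X) : word := [seq (x, true) | x <- s].
Definition invword (w : word) : word := rev [seq (p.1, ~~ p.2) | p <- w].

Inductive pres_cong : word -> word -> Prop :=
| pc_refl w : pres_cong w w
| pc_sym w1 w2 : pres_cong w1 w2 -> pres_cong w2 w1
| pc_trans w1 w2 w3 : pres_cong w1 w2 -> pres_cong w2 w3 -> pres_cong w1 w3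
| pc_cat w1 w1' w2 w2' :
    pres_cong w1 w1' -> pres_cong w2 w2' -> pres_cong (w1 ++ w2) (w1' ++ w2')
| pc_cancel x b : pres_cong [:: (x, b); (x, ~~ b)] [::]
| pc_rel s1 s2 : rel s1 s2 -> pres_cong (posword s1) (posword s2).

Definition pres_eq (w1 w2 : word) : bool := `[< pres_cong w1 w2 >].

Lemma pres_eq_refl : reflexive pres_eq.
Proof. by move=> w; apply/asboolP; exact: pc_refl. Qed.
Lemma pres_eq_sym : symmetric pres_eq.
Proof. by move=> w1 w2; apply/asboolP/asboolP; exact: pc_sym. Qed.
Lemma pres_eq_trans : transitive pres_eq.
Proof.
by move=> w2 w1 w3 /asboolP h1 /asboolP h2; apply/asboolP; exact: pc_trans h1 h2.
Qed.
Canonical pres_equiv := EquivRel pres_eq pres_eq_refl pres_eq_sym pres_eq_trans.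

Definition presented : Type := {eq_quot pres_equiv}%qT.
HB.instance Definition _ := Choice.on presented.

Definition pres_class (w : word) : presented := (\pi_({eq_quot pres_equiv}) w)%qT.
Definition pres_repr (a : presented) : word := repr (a : {eq_quot pres_equiv}%qT).

Lemma pres_classK a : pres_class (pres_repr a) = a.
Proof. exact: reprK. Qed.
Lemma pres_classP w1 w2 : pres_class w1 = pres_class w2 <-> pres_cong w1 w2.
Proof.
split; first by move=> /eqmodP/asboolP.
by move=> h; apply/eqmodP/asboolP.
Qed.
Lemma pres_reprK w : pres_cong (pres_repr (pres_class w)) w.
Proof. by apply/pres_classP; rewrite pres_classK. Qed.

Lemma invword_cat w1 w2 : invword (w1 ++ w2) = invword w2 ++ invword w1.
Proof. by rewrite /invword map_cat rev_cat. Qed.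
Lemma invwordK : involutive invword.
Proof.
move=> w; rewrite /invword map_rev revK -map_comp -[RHS]map_id.
by apply: eq_map => -[x b] /=; rewrite negbK.
Qed.
Lemma pres_cong_invr w : pres_cong (w ++ invword w) [::].
Proof.
elim: w => [|[x b] w IH]; first exact: pc_refl.
have -> : ((x, b) :: w) ++ invword ((x, b) :: w)
        = [:: (x, b)] ++ (w ++ invword w) ++ [:: (x, ~~ b)].
  by rewrite /invword map_cons rev_cons -cats1 !catA.
apply: (pc_trans _ (pc_cancel x b)).
exact: pc_cat (pc_refl [:: (x, b)]) (pc_cat IH (pc_refl [:: (x, ~~ b)])).
Qed.
Lemma pres_cong_invl w : pres_cong (invword w ++ w) [::].
Proof. by rewrite -{2}[w]invwordK; exact: pres_cong_invr. Qed.

Definition pres_mul a b := pres_class (pres_repr a ++ pres_repr b).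
Definition pres_one := pres_class [::].
Definition pres_inv a := pres_class (invword (pres_repr a)).

Lemma pres_mulA : associative pres_mul.
Proof.
move=> a b c; apply/pres_classP.
apply: (pc_trans (pc_cat (pc_refl _) (pres_reprK _))); rewrite catA.
by apply: pc_sym; apply: pc_cat (pres_reprK _) (pc_refl _).
Qed.
Lemma pres_mul1 : left_id pres_one pres_mul.
Proof.
move=> a; rewrite -[RHS]pres_classK; apply/pres_classP.
exact: (pc_cat (pres_reprK [::]) (pc_refl _)).
Qed.
Lemma pres_mulr1 : right_id pres_one pres_mul.
Proof.
move=> a; rewrite -[RHS]pres_classK; apply/pres_classP.
by have := pc_cat (pc_refl (pres_repr a)) (pres_reprK [::]); rewrite cats0.
Qed.
Lemma pres_mulV : left_inverse pres_one pres_inv pres_mul.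
Proof.
move=> a; apply/pres_classP.
apply: pc_trans (pres_cong_invl (pres_repr a)).
exact: pc_cat (pres_reprK _) (pc_refl _).
Qed.
Lemma pres_mulrV : right_inverse pres_one pres_inv pres_mul.
Proof.
move=> a; apply/pres_classP.
apply: pc_trans (pres_cong_invr (pres_repr a)).
exact: pc_cat (pc_refl _) (pres_reprK _).
Qed.

HB.instance Definition _ :=
  isGroup.Build presented pres_mulA pres_mul1 pres_mulr1 pres_mulV pres_mulrV.
End Presentation.

Definition interval_group (G : groupType) (S : set G) (c : G) : groupType :=
  presented (@chain_rel G S c).

Definition group_iso (G1 G2 : groupType) : Prop :=
  exists f : G1 -> G2, bijective f /\ (forall x y, f (x * y) = f x * f y)%g.

Section PeriodicPermutations.
Local Open Scope ring_scope.
Variable n : nat.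

Definition periodic : {pred selfbij int} :=
  fun p => `[< forall i : int, p (i + n%:Z) = p i + n%:Z >].

Lemma periodic_group_closed : group_closed periodic.
Proof.
split=> [|f g /asboolP pf /asboolP pg]; first by apply/asboolP.
apply/asboolP => i /=; rewrite -pf; congr (f _).
by apply: (can_inj (sbfunK g)); rewrite pg !(sbinvK g).
Qed.

Record perZ := PerZ { pZval :> selfbij int; _ : pZval \in periodic }.
HB.instance Definition _ := [isSub for pZval].
HB.instance Definition _ := [Choice of perZ by <:].
HB.instance Definition _ :=
  SubChoice_isSubGroup.Build _ _ perZ periodic_group_closed.

Lemma perZD (p : perZ) i : p (i + n%:Z) = p i + n%:Z.
Proof. by move: (valP p) => /asboolP. Qed.

(* The transposition $(i\ j)_n$ when i and j are distinct modulo n;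
   by convention the identity otherwise. *)
Definition refl_fun (i j k : int) : int :=
  if (i == j %[mod n])%Z then k
  else if (k == i %[mod n])%Z then k + (j - i)
  else if (k == j %[mod n])%Z then k + (i - j)
  else k.

Lemma refl_funK i j : involutive (refl_fun i j).
Proof.
move=> k; rewrite /refl_fun.
have [//|nij] := boolP (i == j %[mod n])%Z.
have [/eqP ki|nki] := boolP (k == i %[mod n])%Z.
  have -> : ((k + (j - i))%R %% n = j %% n)%Z.
    by rewrite -modzDml ki modzDml addrC subrK.
  rewrite [(j %% n)%Z == (i %% n)%Z]eq_sym (negPf nij) eqxx.
  by rewrite -addrA -(opprB i j) addNr addr0.
have [/eqP kj|nkj] := boolP (k == j %[mod n])%Z; last first.
  by rewrite (negPf nki) (negPf nkj).
have -> : ((k + (i - j))%R %% n = i %% n)%Z.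
  by rewrite -modzDml kj modzDml addrC subrK.
by rewrite eqxx -addrA -(opprB j i) addNr addr0.
Qed.

Lemma refl_funD i j k : refl_fun i j (k + n%:Z) = refl_fun i j k + n%:Z.
Proof.
rewrite /refl_fun -modzDmr modzz addr0; case: ifP => // _.
by case: ifP => _; [|case: ifP => _ //]; rewrite addrAC.
Qed.

Definition refl (i j : int) : perZ :=
  PerZ (asboolT (refl_funD i j
    : forall k, SelfBij (refl_funK i j) (refl_funK i j) (k + n%:Z) = _)).

Definition loop_fun (i d k : int) : int :=
  if (k == i %[mod n])%Z then k + d * n%:Z else k.

Lemma loop_funK i d : cancel (loop_fun i d) (loop_fun i (- d)).
Proof.
move=> k; rewrite /loop_fun.
have [ki|/negPf nki] := boolP (k == i %[mod n])%Z; last by rewrite nki.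
by rewrite -modzDmr modzMl addr0 ki mulNr addrK.
Qed.
Lemma loop_funNK i d : cancel (loop_fun i (- d)) (loop_fun i d).
Proof. by rewrite -{2}(opprK d); exact: loop_funK. Qed.
Lemma loop_funD i d k : loop_fun i d (k + n%:Z) = loop_fun i d k + n%:Z.
Proof. by rewrite /loop_fun -modzDmr modzz addr0; case: ifP => // _; rewrite addrAC. Qed.

Definition loop (i : int) : perZ :=
  PerZ (asboolT (loop_funD i 1
    : forall k, SelfBij (loop_funK i 1) (loop_funNK i 1) (k + n%:Z) = _)).

Definition reflections : set perZ :=
  [set t | exists i j : int, (i != j %[mod n])%Z /\ t = refl i j].
Definition loops : set perZ :=
  [set l | exists i : int, l = loop i \/ l = (loop i)^-1%g].

(* Indices modulo n are elements of ['I_n]; [ord0] is the index n. *)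
Definition simple_refl (i : 'I_n) : perZ := refl i%:Z (i%:Z + 1).

(* A word [w] using each simple reflection once; it represents the Coxeter
   element [coxeter w]. The definitions below that depend on the order in which
   neighbouring simple reflections occur only depend on [coxeter w]. *)
Definition coxeter_word (w : seq 'I_n) : bool := perm_eq w (enum 'I_n).
Definition coxeter (w : seq 'I_n) : perZ := (\prod_(i <- w) simple_refl i)%g.
Definition precedes (w : seq 'I_n) (i j : 'I_n) : bool :=
  (index i w < index j w)%N.
Definition outer (w : seq 'I_n) : {set 'I_n} :=
  [set i : 'I_n | precedes w (ord_pred i) i]%SET.
Definition inner (w : seq 'I_n) : {set 'I_n} := (~: outer w)%SET.
End PeriodicPermutations.

Section Geometry.
Local Open Scope ring_scope.
Variables (R : realType) (n : nat).
Local Notation amb := 'rV[R]_n.+1.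

Definition dvec : amb := delta_mx 0 ord_max - delta_mx 0 ord0.

(* the standard basis vector $e_k$ is [delta_mx 0 (k - 1)] for k = 1, ..., n+1 *)
Definition evec (k : int) : amb :=
  delta_mx 0 (inord `|((k - 1)%R %% n)%Z|%N) + ((k - 1)%R %/ n)%Z%:~R *: dvec.

Definition alpha (i : 'I_n) : amb := evec (i%:Z + 1) - evec i%:Z.
Definition alphas : n.-tuple amb := [tuple alpha i | i < n].

(* the inner product making $e_1, ..., e_n$ orthonormal, extended by
   $K(e_{n+1}, x) = K(e_1, x)$ *)
Definition Kform (u v : amb) : R :=
  \sum_(a < n.+1) \sum_(b < n.+1 | a == b %[mod n]) u 0 a * v 0 b.
Definition cartan (i j : 'I_n) : R := Kform (alpha i) (alpha j).

Definition Vsp : {vspace amb} := <<alphas>>%VS.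
Definition Vdual := 'Hom(subvs_of Vsp, R^o).

Definition inV (v : amb) : subvs_of Vsp := vsproj Vsp v.

(* $\langle x, \delta\rangle$ *)
Definition deltaval (x : Vdual) : R := x (inV dvec).

Definition rho (i : 'I_n) : Vdual :=
  (linfun (coord alphas i : amb -> R^o) \o linfun vsval)%VF.
Definition sigma (i : 'I_n) : Vdual := rho i - rho (ord_pred i).

(* the matrix of $e_i \mapsto e_{p(i)}$, acting on row vectors *)
Definition act_mx (p : perZ n) : 'M[R]_n.+1 :=
  \matrix_(j < n.+1) evec (p (j%:Z + 1)).
Definition actV (p : perZ n) : 'End(subvs_of Vsp) :=
  (linfun (vsproj Vsp) \o linfun (mulmxr (act_mx p)) \o linfun vsval)%VF.
Definition actVdual (p : perZ n) (x : Vdual) : Vdual := (x \o actV p^-1%g)%VF.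

Lemma evecD (k : int) (q : int) : (0 < n)%N ->
  evec (k + q * n%:Z) = evec k + q%:~R *: dvec.
Proof.
move=> n0; rewrite /evec.
have -> : k + q * n%:Z - 1 = q * n%:Z + (k - 1) by rewrite [k + _]addrC addrA.
rewrite modzMDl divzMDl ?eqz_nat ?lt0n_neq0 //.
by rewrite -addrA; congr (_ + _); rewrite rmorphD scalerDl addrC.
Qed.

Lemma evec_ord (j : 'I_n.+1) : (0 < n)%N -> evec (j%:Z + 1) = delta_mx 0 j.
Proof.
move=> n0; rewrite /evec addrK modz_nat divz_nat /=.
have [jn|] := ltnP j n.
  by rewrite modn_small // divn_small // scale0r addr0 inord_val.
rewrite leq_eqVlt ltnNge -ltnS ltn_ord orbF => /eqP jn.
rewrite -jn modnn divnn n0 scale1r /dvec addrC.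
have -> : inord 0 = ord0 :> 'I_n.+1 by apply: val_inj; rewrite /= inordK.
by rewrite subrK; congr (delta_mx 0 _); apply: val_inj.
Qed.

Lemma perZDq (p : perZ n) (k q : int) : p (k + q * n%:Z) = p k + q * n%:Z.
Proof.
elim: q k => [k|q IH k|q IH k]; first by rewrite !mul0r !addr0.
  by rewrite -addn1 PoszD !mulrDl !mul1r !addrA perZD IH.
rewrite -addn1 PoszD opprD mulrDl mulN1r !addrA -IH.
by apply: (addIr n%:Z); rewrite subrK -perZD subrK.
Qed.

Lemma act_mx_evec (p : perZ n) k : (0 < n)%N -> evec k *m act_mx p = evec (p k).
Proof.
move=> n0.
have act_ord (j : 'I_n.+1) : delta_mx 0 j *m act_mx p = evec (p (j%:Z + 1)).
  by rewrite -rowE rowK.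
have act_d : dvec *m act_mx p = dvec.
  rewrite mulmxBl !act_ord /= add0r [n%:Z + 1]addrC -[n%:Z]mul1r perZDq.
  by rewrite evecD // scale1r addrC addrA addNr add0r.
have n0' : n%:Z != 0 by rewrite eqz_nat lt0n_neq0.
rewrite {1}/evec mulmxDl act_ord -scalemxAl act_d -evecD // -perZDq.
congr (evec (p _)); rewrite inordK; last first.
  by rewrite ltnS -lez_nat gez0_abs ?modz_ge0 // ltW // ltz_pmod // ltz_nat.
rewrite gez0_abs ?modz_ge0 // addrAC addrC [X in _ + X]addrC -divz_eq.
by rewrite addrC subrK.
Qed.

Lemma evecB_V a b : (0 < n)%N -> evec a - evec b \in Vsp.
Proof.
move=> n0; have n0' : n%:Z != 0 by rewrite eqz_nat lt0n_neq0.
have step k : evec (k + 1) - evec k \in Vsp.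
  have lt_r : (`|(k %% n)%Z| < n)%N.
    by rewrite -ltz_nat gez0_abs ?modz_ge0 // ltz_pmod // ltz_nat.
  suff -> : evec (k + 1) - evec k = alpha (Ordinal lt_r).
    by apply: memv_span; apply/tnthP; exists (Ordinal lt_r); rewrite tnth_mktuple.
  rewrite /alpha /= gez0_abs ?modz_ge0 //.
  have e1 : k + 1 = (k %% n)%Z + 1 + (k %/ n)%Z * n%:Z.
    by rewrite {1}(divz_eq k n) -addrA addrC.
  have e2 : k = (k %% n)%Z + (k %/ n)%Z * n%:Z by rewrite addrC -divz_eq.
  have -> : evec k = evec (k %% n)%Z + (k %/ n)%Z%:~R *: dvec.
    by rewrite {1}e2 evecD.
  rewrite e1 evecD //.
  by rewrite opprD addrACA subrr addr0.
suff base k : evec k - evec 0 \in Vsp.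
  by rewrite -(subrKA (evec 0)) memvD // -opprB memvN.
elim: k => [|k IH|k IH]; first by rewrite subrr mem0v.
  have -> : Posz k.+1 = k%:Z + 1 by lia.
  by rewrite -(subrKA (evec k)); apply: memvD.
rewrite -(subrKA (evec (- k%:Z))); apply: memvD => //; rewrite -opprB memvN.
have -> : - k%:Z = - k.+1%:Z + 1 by lia.
exact: step.
Qed.

Lemma Vsp_n0 v : v \in Vsp -> n = 0%N -> v = 0.
Proof.
move=> + n0; rewrite /Vsp (_ : (alphas : seq amb) = [::]); last first.
  by apply: size0nil; rewrite size_tuple.
by rewrite span_nil memv0 => /eqP.
Qed.

Lemma act_mx_V p v : v \in Vsp -> v *m act_mx p \in Vsp.
Proof.
move=> vV; have [n0|n0] := posnP n; first by rewrite (Vsp_n0 vV n0) mul0mx mem0v.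
rewrite (coord_span vV) mulmx_suml memv_suml // => i _.
rewrite -scalemxAl memvZ // -tnth_nth tnth_mktuple mulmxBl.
by rewrite !act_mx_evec // evecB_V.
Qed.

Lemma actVE p v : vsval (actV p v) = vsval v *m act_mx p.
Proof. by rewrite !comp_lfunE !lfunE /= vsprojK ?act_mx_V ?subvsP. Qed.

Lemma actVM p q : (actV p \o actV q)%VF = actV (p * q)%g.
Proof.
apply/lfunP => v; rewrite comp_lfunE; apply: val_inj; rewrite /= !actVE.
have [n0|n0] := posnP n; first by rewrite (Vsp_n0 (subvsP v) n0) !mul0mx.
rewrite -mulmxA; congr (_ *m _); apply/row_matrixP => j.
by rewrite row_mul !rowK act_mx_evec.
Qed.

Lemma actV1 : actV 1%g = \1%VF.
Proof.
apply/lfunP => v; rewrite id_lfunE; apply: val_inj; rewrite /= actVE.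
have [n0|n0] := posnP n; first by rewrite (Vsp_n0 (subvsP v) n0) !mul0mx.
suff -> : act_mx 1%g = 1%:M by rewrite mulmx1.
by apply/row_matrixP => j; rewrite rowK row1 evec_ord.
Qed.

Lemma actVdualM p q x : actVdual p (actVdual q x) = actVdual (p * q)%g x.
Proof. by rewrite /actVdual -comp_lfunA actVM -invgM. Qed.

Lemma actVdual1 x : actVdual 1%g x = x.
Proof. by rewrite /actVdual invg1 actV1 comp_lfun1r. Qed.

Lemma actVdualK p : cancel (actVdual p) (actVdual p^-1%g).
Proof. by move=> x; rewrite actVdualM mulVg actVdual1. Qed.

Lemma actVdualVK p : cancel (actVdual p^-1%g) (actVdual p).
Proof. by move=> x; rewrite actVdualM mulgV actVdual1. Qed.

Definition geom (p : perZ n) : selfbij Vdual :=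
  SelfBij (actVdualK p) (actVdualVK p).

Section Factored.
Variable w : seq 'I_n.

Definition omega_coef (i j : 'I_n) : R :=
  if i == j then 0 else if precedes w j i then cartan i j else - cartan i j.

(* $\omega_c(u, \cdot)$ *)
Definition omega (u : subvs_of Vsp) : Vdual :=
  \sum_i \sum_j (rho i u * omega_coef i j) *: rho j.

Definition U0 : set Vdual := [set x | exists a : R, x = a *: omega (inV dvec)].

Definition Usigma (A : {set 'I_n}) : set Vdual :=
  [set x | exists2 a : 'I_n -> R,
     \sum_(i in A) a i = 0 & x = \sum_(i in A) a i *: sigma i].
Definition Uout := Usigma (outer w).
Definition Uinn := Usigma (inner w).

Definition is_translation (g : Vdual -> Vdual) (mu : Vdual) :=
  forall x, g x = x + deltaval x *: mu.

(* p = 1 only contributes the identity map, which does not affect lengths *)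
Definition factored_translations (qout qinn : R) : set (selfbij Vdual) :=
  [set g | exists p l0 lout linn,
     [/\ interval (@reflections n) (coxeter w) p,
         U0 l0 /\ Uout lout /\ Uinn linn,
         forall x, deltaval x = 1 -> actVdual p x = x + (l0 + lout + linn) &
         is_translation g (lout + qout *: l0) \/
         is_translation g (linn + qinn *: l0)]].
End Factored.
End Geometry.

Section GeneratingSets.
Local Open Scope ring_scope.
Variables (R : realType) (n : nat).

Definition TL : set (perZ n) := @reflections n `|` @loops n.

Definition TF (w : seq 'I_n) (qout qinn : R) : set (selfbij (Vdual R n)) :=
  @geom R n @` @reflections n `|`
  factored_translations w qout qinn `|`
  [set g | factored_translations w qout qinn g^-1%g].
End GeneratingSets.

(* The weights for which factoring translations is degenerate; this can only
   happen if one of the two boundary circles of the annulus carries a single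
   point ([b = 1]). If there are [a] points on the other circle, then, for a
   weight [q] on that circle, a product of s factored translations attached to it
   (s = 1, 2, or -1, -2 for their inverses) can be a nontrivial translation of
   $[1,c]_T$ exactly when [s q = 1] and [a] divides [s - 1]. The element c then
   becomes shorter, or gets additional reduced words, in the group generated by
   T and F. For instance, for n = 2, qout = 0 and qinn = 1, the Coxeter element
   is itself a factored translation, so has length 1. *)
Definition exceptional (R : realType) (a b : nat) (q : R) : Prop :=
  b = 1%N /\
  exists2 s : int, s \in ([:: 1; -1; 2; -2]%R : seq int) &
    (a%:Z %| (s - 1)%R)%Z /\ (s%:~R * q = 1)%R.

(* Main.v *)
(* The whole labeled poset [1,c] is determined by the set of reduced words of c.
   So it suffices to match, letter by letter, the reduced words of c over T U L
   with those over T U F.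

   The matching fixes the reflections and sends the loop at the point i to the
   translation of E by sigma_i - m, where m is the barycenter of the sigma_k in
   which the outer points share the weight qinn and the inner points share the
   weight qout; for i outer this is exactly a factored translation, and for i inner
   so is its inverse. The matching is not multiplicative, since reflections move m;
   but if all letters of a word preserve the set of outer points, then they commute
   with the translation by m, and the contributions of m cancel when the numbers of
   loops and inverse loops agree.

   The reduced words of c are found by counting orbits. The permutation of Z/n
   induced by c has only two orbits, the outer and the inner points, while r
   reflections leave at least n - r classes of points connected; so a word of
   length at most n contains at least n - 2 reflections, hence by parity n or n - 2.
   In the second case every letter preserves the outer points, and comparing total
   displacements on the outer and on the inner points shows that the other two
   letters are an outer loop and an inverse inner loop, the exceptions on the
   T U F side being excluded by integrality. *)
From HB Require Import structures.
From mathcomp Require Import all_boot all_order all_algebra all_fingroup.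
From mathcomp Require Import all_classical reals.
From mathcomp Require Import zify ring lra.
Require Import Defs.

Set Implicit Arguments.
Unset Strict Implicit.
Unset Printing Implicit Defensive.

Import Order.TTheory GRing.Theory Num.Theory.
Local Open Scope classical_set_scope.

(** * Intervals and reduced words *)

(** The weights of m come from the geometry. The form omega_c(delta, .) is the sum of the outer
    sigma_k minus that of the inner ones, and all sigma_k add up to 0. Splitting sigma_i - sigma_j
    (i outer, j inner) along U_0, U_out, U_inn and sharing out the U_0-part by qout and qinn gives
    sigma_i - m and m - sigma_j. As m has total weight qout + qinn = 1, the coefficients of these
    translations sum to 0, which removes the ambiguity left by the relation among the sigma_k.

    The obstacle is that the matching is not always injective on T U L. A word over T U F with
    product c lifts letter by letter, but the product u of the lift may agree with c only up to a
    translation by a multiple of m. When the lift has n - 2 reflections, let x and y be the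
    displacements of u on the outer and inner points, divided by n. Then |x| + |y| <= 2, and outside
    the exceptional weights there remain x = 1, y = -1, where u = c, and x = y = 1 or x = y = -1
    with two points of weight 1/2 on one circle. In the last two cases the word must be lifted
    differently: a loop at one of these points and the inverse loop at the other have the same
    image. *)

Section ReducedWords.
Local Open Scope group_scope.
Variables (G : groupType) (S : set G).
Implicit Types (u v w c : G) (s x y z : seq G).

Definition word_over s := forall a, a \in s -> S a.

Definition reduced c s :=
  [/\ word_over s, \prod_(a <- s) a = c &
      forall s', word_over s' -> \prod_(a <- s') a = c -> (size s <= size s')%N].

Lemma word_over_cat x y : word_over (x ++ y) <-> word_over x /\ word_over y.
Proof.
split=> [h|[hx hy] a]; last by rewrite mem_cat => /orP[/hx|/hy].
by split=> a ha; apply: h; rewrite mem_cat ha ?orbT.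
Qed.

Lemma reduced_infix c x y z : reduced c (x ++ y ++ z) ->
  reduced (\prod_(a <- y) a) y.
Proof.
move=> [/word_over_cat[hx /word_over_cat[hy hz]] e m]; split=> // y' hy' ey'.
have := m (x ++ y' ++ z); rewrite !size_cat leq_add2l leq_add2r; apply.
  by apply/word_over_cat; split=> //; apply/word_over_cat.
by rewrite -e !big_cat /= ey'.
Qed.

Lemma reduced_catl c x y : reduced c (x ++ y) -> reduced (\prod_(a <- x) a) x.
Proof. exact: (@reduced_infix c [::]). Qed.

Lemma reduced_catr c x y : reduced c (x ++ y) -> reduced (\prod_(a <- y) a) y.
Proof. by move=> h; apply: (@reduced_infix c x y [::]); rewrite cats0. Qed.

Lemma reduced_replace c x y y' z : reduced c (x ++ y ++ z) ->
  word_over y' -> \prod_(a <- y') a = \prod_(a <- y) a -> size y' = size y ->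
  reduced c (x ++ y' ++ z).
Proof.
move=> [/word_over_cat[hx /word_over_cat[hy hz]] e m] hy' ey' sy'; split.
- by apply/word_over_cat; split=> //; apply/word_over_cat.
- by rewrite -e !big_cat /= ey'.
- by move=> s' hs' /m; rewrite !size_cat sy'; exact.
Qed.

Lemma reduced_nil : reduced 1 [::].
Proof. by split=> //; rewrite big_nil. Qed.

Lemma reduced_has_length c s : reduced c s -> has_length S c (size s).
Proof.
move=> [h e m]; split; first by exists s.
by move=> j [s' [<- h' e']]; exact: m.
Qed.

Lemma has_length_reduced u k : has_length S u k ->
  exists2 s, reduced u s & size s = k.
Proof.
move=> [[s [<- h e]] m]; exists s => //; split=> // s' h' e'.
by apply: m; exists s'.
Qed.

Lemma has_length_uniq u j k : has_length S u j -> has_length S u k -> j = k.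
Proof.
move=> [wj mj] [wk mk]; apply/eqP.
by rewrite eqn_leq mj ?mk.
Qed.

Lemma word_leP u w c z : reduced c z -> c = u^-1 * w -> forall x,
  reduced u x -> reduced w (x ++ z) -> word_le S u w.
Proof.
move=> hz ec x hx hxz; exists (size x), (size z); split.
- exact: reduced_has_length.
- by rewrite -ec; exact: reduced_has_length.
- by rewrite -size_cat; exact: reduced_has_length.
Qed.

Lemma word_le_reduced u w : word_le S u w ->
  exists x y, [/\ reduced u x, reduced w (x ++ y) & \prod_(a <- y) a = u^-1 * w].
Proof.
move=> [j [k [/has_length_reduced[x hx sx] /has_length_reduced[y hy sy] hw]]].
exists x, y; have [hx1 hx2 _] := hx; have [hy1 hy2 _] := hy; split=> //; split.
- by apply/word_over_cat.
- by rewrite big_cat /= hx2 hy2 mulVKg.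
- move=> s' h' e'; have [_ m] := hw.
  by rewrite size_cat sx sy; apply: m; exists s'.
Qed.

Lemma reduced_cat c u x x' y : reduced c (x ++ y) -> \prod_(a <- x) a = u ->
  reduced u x' -> reduced c (x' ++ y).
Proof.
move=> h e h'; have := h; rewrite -[x ++ y]/([::] ++ (x ++ y)) => h0.
apply: (reduced_replace h0); rewrite ?e; case: h' => // h1 h2 m //.
have [h3 h4 m'] := reduced_catl h.
by apply/eqP; rewrite eqn_leq m // m' // h2.
Qed.

(** Lengths add along [word_le], so a reduced word of [u] followed by one of [u^-1 * c] is a reduced
    word of [c]. The order can then be handled through prefixes. *)
Lemma interval_reduced c u : interval S c u <->
  exists x y, reduced c (x ++ y) /\ \prod_(a <- x) a = u.
Proof.
split=> [[_ /word_le_reduced[x [y [hx hxy e]]]]|[x [y [h e]]]].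
  by exists x, y; split=> //; case: hx.
have hx := reduced_catl h; rewrite e in hx; have [_ ec _] := h; split.
  apply: (word_leP hx _ reduced_nil) => //.
  by rewrite invg1 mul1g.
apply: (word_leP (reduced_catr h) _ hx) => //.
by rewrite -ec big_cat /= e mulKg.
Qed.

Lemma interval_word_le c u w : interval S c w ->
  word_le S u w <-> exists x y z,
   [/\ reduced c (x ++ y ++ z), \prod_(a <- x) a = u & \prod_(a <- x ++ y) a = w].
Proof.
move=> /interval_reduced[x0 [z [h e]]]; split.
  move=> /word_le_reduced[x [y [hx hxy e']]]; exists x, y, z; split.
  - by rewrite catA; apply: reduced_cat h e hxy.
  - by case: hx.
  - by case: hxy.
move=> [x [y [z' [h' e1 e2]]]].
have hxy : reduced w (x ++ y).
  by rewrite -e2; apply: (@reduced_catl c _ z'); rewrite -catA.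
have hx : reduced u x by rewrite -e1; exact: reduced_catl hxy.
apply: (word_leP (reduced_catr hxy) _ hx) => //.
by rewrite -e2 -e1 big_cat /= mulKg.
Qed.

Lemma reduced_neq1 c x a z : reduced c (x ++ a :: z) -> a != 1.
Proof.
move=> h; have [_ _ m] := @reduced_infix c x [:: a] z h.
apply: contraT => /negPn/eqP a1; have := m [::]; rewrite big_nil big_seq1 a1.
by apply.
Qed.

(** When [u < w], the first letter [a] after a prefix for [u] gives an element [u * a] of the
    interval between the two, so maximality forces [w = u * a]. *)
Lemma coverP c u w : cover S c u w <->
  exists x a z, [/\ reduced c (x ++ a :: z), \prod_(b <- x) b = u & w = u * a].
Proof.
split.
  move=> [iu iw le_uw neq_uw max].
  have [x [[|a y] [z [h e1 e2]]]] := (interval_word_le u iw).1 le_uw.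
    by case/eqP: neq_uw; rewrite -e1 -e2 cats0.
  have iv : interval S c (u * a).
    apply/interval_reduced; exists (x ++ [:: a]), (y ++ z).
    by rewrite -catA big_cat /= big_seq1 e1.
  case: (max (u * a)) => //.
  - apply/(interval_word_le _ iv); exists x, [:: a], (y ++ z).
    by rewrite big_cat /= big_seq1 e1.
  - apply/(interval_word_le _ iw); exists (x ++ [:: a]), y, z.
    by rewrite -!catA !big_cat /= !big_seq1 e1 mulgA -e2 big_cat /= big_cons e1 mulgA.
  - move=> /(congr1 (fun g => u^-1 * g)); rewrite mulKg mulVg => a1.
    by case/eqP: (reduced_neq1 h).
  - move=> uaw; exists x, a, z; split=> //; rewrite -cat1s catA.
    have h' : reduced c ((x ++ [:: a]) ++ (y ++ z)) by rewrite -!catA.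
    have e3 : \prod_(b <- x ++ [:: a]) b = w by rewrite big_cat /= big_seq1 e1.
    have := reduced_catl h'; rewrite e3; apply: (@reduced_cat c w (x ++ a :: y)) => //.
    by rewrite -catA.
move=> [x [a [z [h e1 e2]]]].
have h' : reduced c ((x ++ [:: a]) ++ z) by rewrite -catA.
have e3 : \prod_(b <- x ++ [:: a]) b = w by rewrite big_cat /= big_seq1 e1.
have iu : interval S c u by apply/interval_reduced; exists x, (a :: z).
have iw : interval S c w by apply/interval_reduced; exists (x ++ [:: a]), z.
have hw := reduced_catl h'; rewrite e3 in hw.
have lw := reduced_has_length hw.
have lu := reduced_has_length (reduced_catl h); rewrite e1 in lu.
split=> //.
- by apply/(interval_word_le _ iw); exists x, [:: a], z.
- apply: contra_eq_neq e2 => ->; rewrite -{1}[w]mulg1 (can_eq (mulKg w)) eq_sym.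
  exact: reduced_neq1 h.
move=> v iv [j [k [luj luk lv]]] [j' [k' [lvj lvk lw']]].
have jx := has_length_uniq luj lu; have jj := has_length_uniq lvj lv.
(* The lengths gained from [u] to [v] and from [v] to [w] add up to 1, so one of them is 0. *)
have := has_length_uniq lw' lw; rewrite jj jx size_cat -addnA => /addnI.
have l0 g : has_length S g 0 -> g = 1.
  by move=> [[s [/size0nil -> _ <-]] _]; rewrite big_nil.
case: k luk {jj lv} => [|[|k]]; rewrite ?add0n ?addSn //=.
  by move=> /l0 /(congr1 (mulg u)); rewrite mulVKg mulg1 => -> _; left.
move=> _ k0; right; have {}k0 : k' = 0%N by lia.
move: lvk; rewrite k0 => /l0 /(congr1 (mulg v)).
by rewrite mulVKg mulg1.
Qed.

Lemma labelsP c a : labels S c a <-> exists x z, reduced c (x ++ a :: z).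
Proof.
split=> [[u [w [/coverP[x [b [z [h _ ->]]]] ->]]]|[x [z h]]].
  by rewrite mulKg; exists x, z.
exists (\prod_(b <- x) b), (\prod_(b <- x) b * a); split; last by rewrite mulKg.
by apply/coverP; exists x, a, z.
Qed.
End ReducedWords.

(** * Labeled poset isomorphisms from a matching of reduced words *)

Section MatchingReducedWords.
Local Open Scope group_scope.
Variables (G1 G2 : groupType) (S1 : set G1) (S2 : set G2) (c1 : G1) (c2 : G2).
Variable e : G2 -> G1.
Hypothesis e_reduced : forall s, reduced S2 c2 s -> reduced S1 c1 (map e s).
Hypothesis reduced_e : forall s1, reduced S1 c1 s1 ->
  exists2 s, reduced S2 c2 s & s1 = map e s.
Hypothesis e_inj : {in labels S2 c2 &, injective e}.

Lemma letter_labels s a : reduced S2 c2 s -> a \in s -> a \in labels S2 c2.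
Proof.
by move=> + /splitPr h; case: h => x z h; apply/mem_set/labelsP; exists x, z.
Qed.

Lemma map_e_inj s s' : {subset s <= labels S2 c2} ->
  {subset s' <= labels S2 c2} -> map e s = map e s' -> s = s'.
Proof.
elim: s s' => [|a s IH] [|a' s'] //= h h' [/e_inj ea es].
rewrite (ea (h a (mem_head _ _)) (h' a' (mem_head _ _))); congr (_ :: _).
apply: IH => // b bs.
  by apply: h; rewrite inE bs orbT.
by apply: h'; rewrite inE bs orbT.
Qed.

Lemma reduced_e_cat x1 y1 : reduced S1 c1 (x1 ++ y1) ->
  exists x y, [/\ reduced S2 c2 (x ++ y), x1 = map e x & y1 = map e y].
Proof.
move=> /reduced_e[s h es]; exists (take (size x1) s), (drop (size x1) s).
rewrite cat_take_drop; split=> //.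
  by rewrite map_take -es take_size_cat.
by rewrite map_drop -es drop_size_cat.
Qed.

(** The map [e] need not be multiplicative, so products are compared inside words of the whole
    element. Prefixes with equal product can be exchanged in front of the same tail; the image stays
    a reduced word, and the common tail cancels. Conversely, the exchanged image word lifts, and
    injectivity on labels identifies the lift. *)
Lemma prefix_prod_eq x y x' y' :
  reduced S2 c2 (x ++ y) -> reduced S2 c2 (x' ++ y') ->
  \prod_(a <- x) a = \prod_(a <- x') a <->
  \prod_(a <- map e x) a = \prod_(a <- map e x') a.
Proof.
move=> h h'; split=> exx.
  have h2 : reduced S2 c2 (x' ++ y).
    by apply: reduced_cat h exx _; exact: reduced_catl h'.
  have [_ e1 _] := e_reduced h; have [_ e2 _] := e_reduced h2.
  by move: e1; rewrite -e2 !map_cat !big_cat /= => /mulIg.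
have h1 := e_reduced h; have h1' := e_reduced h'; rewrite !map_cat in h1 h1'.
have := reduced_cat h1 exx (reduced_catl h1').
move=> /reduced_e_cat[x2 [y2 [h2 ex ey]]].
have ey2 : y2 = y.
  apply: map_e_inj => // a ha; first by apply: (letter_labels h2); rewrite mem_cat ha orbT.
  by apply: (letter_labels h); rewrite mem_cat ha orbT.
have ex2 : x2 = x'.
  apply: map_e_inj => // a ha; first by apply: (letter_labels h2); rewrite mem_cat ha.
  by apply: (letter_labels h'); rewrite mem_cat ha.
have [_ e1 _] := h; have [_ e2 _] := h2.
by move: e1; rewrite -e2 ex2 ey2 !big_cat /= => /mulIg.
Qed.

(** The poset map, in the direction opposite to [e]. It does not depend on the prefix, by
    [prefix_prod_eq]; the default value 1 is taken only outside the interval. *)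
Definition lift_elt (u : G1) : G2 := xget 1 [set v | exists x y,
  [/\ reduced S2 c2 (x ++ y), \prod_(a <- map e x) a = u & \prod_(a <- x) a = v]].

Definition lift_label (a : G1) : G2 := xget 1 [set b | labels S2 c2 b /\ e b = a].

Lemma lift_eltE x y : reduced S2 c2 (x ++ y) ->
  lift_elt (\prod_(a <- map e x) a) = \prod_(a <- x) a.
Proof.
move=> h; rewrite /lift_elt; case: xgetP => [v _ [x' [y' [h' e1 <-]]]|].
  exact/(prefix_prod_eq h' h).
by move=> /(_ (\prod_(a <- x) a)) []; exists x, y.
Qed.

Lemma lift_labelE b : labels S2 c2 b -> lift_label (e b) = b.
Proof.
move=> hb; rewrite /lift_label; case: xgetP => [b' _ [hb' /e_inj]|].
  by apply; apply/mem_set.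
by move=> /(_ b) [].
Qed.

Lemma labels_e b : labels S2 c2 b -> labels S1 c1 (e b).
Proof.
move=> /labelsP[x [z /e_reduced]]; rewrite map_cat => h.
by apply/labelsP; exists (map e x), (map e z).
Qed.

Lemma e_labels a : labels S1 c1 a -> exists2 b, labels S2 c2 b & a = e b.
Proof.
move=> /labelsP[x1 [z1 /reduced_e_cat[x [[|b z] [h _]]]]] // [-> _].
by exists b => //; apply/labelsP; exists x, z.
Qed.

Lemma interval_e u : interval S1 c1 u ->
  exists x y, reduced S2 c2 (x ++ y) /\ u = \prod_(a <- map e x) a.
Proof.
by move=> /interval_reduced[x1 [y1 [/reduced_e_cat[x [y [h -> _]]] <-]]]; exists x, y.
Qed.

Lemma reduced_words_iso : labeled_poset_iso S1 c1 S2 c2.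
Proof.
exists lift_elt, lift_label; split.
- split=> [u /interval_e[x [y [h ->]]]|u w|v].
  + by rewrite (lift_eltE h); apply/interval_reduced; exists x, y.
  + move=> /set_mem/interval_e[x [y [h ->]]] /set_mem/interval_e[x' [y' [h' ->]]].
    by rewrite (lift_eltE h) (lift_eltE h') => /(prefix_prod_eq h h').
  + move=> /interval_reduced[x [y [h <-]]].
    exists (\prod_(a <- map e x) a); last exact: lift_eltE h.
    apply/interval_reduced; exists (map e x), (map e y); split=> //.
    by rewrite -map_cat; exact: e_reduced.
- split=> [a /e_labels[b hb ->]|a a'|b hb].
  + by rewrite lift_labelE.
  + move=> /set_mem/e_labels[b hb ->] /set_mem/e_labels[b' hb' ->].
    by rewrite !lift_labelE // => ->.
  + by exists (e b); [exact: labels_e|rewrite lift_labelE].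
- move=> u w iu iw; split.
    move=> /(interval_word_le _ iw)[x1 [y1 [z1 [h1 <- <-]]]].
    have [x [y [z [h -> ->]]]] : exists x y z,
        [/\ reduced S2 c2 (x ++ y ++ z), x1 = map e x & y1 = map e y].
      have [x [yz [h ex eyz]]] := reduced_e_cat h1.
      exists x, (take (size y1) yz), (drop (size y1) yz).
      by rewrite cat_take_drop map_take -eyz take_size_cat.
    have h' : reduced S2 c2 ((x ++ y) ++ z) by rewrite -catA.
    rewrite -map_cat (lift_eltE h) (lift_eltE h').
    have iv : interval S2 c2 (\prod_(a <- x ++ y) a).
      by apply/interval_reduced; exists (x ++ y), z.
    by apply/(interval_word_le _ iv); exists x, y, z.
  move: iu iw => /interval_e[x [y [h ->]]] /interval_e[x' [y' [h' ew]]].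
  rewrite ew (lift_eltE h) (lift_eltE h').
  have iv : interval S2 c2 (\prod_(a <- x') a).
    by apply/interval_reduced; exists x', y'.
  move=> /(interval_word_le _ iv)[x2 [y2 [z2 [h2 ex2]]]].
  have h2' : reduced S2 c2 ((x2 ++ y2) ++ z2) by rewrite -catA.
  move=> /(prefix_prod_eq h2' h') exy; move: ex2 => /(prefix_prod_eq h2 h) ex.
  have iu : interval S1 c1 (\prod_(a <- map e x') a).
    apply/interval_reduced; exists (map e x'), (map e y'); split=> //.
    by rewrite -map_cat; exact: e_reduced.
  rewrite -ex -exy in iu *; apply/(interval_word_le _ iu).
  exists (map e x2), (map e y2), (map e z2); rewrite -!map_cat; split=> //.
  exact: e_reduced.
- move=> u w /coverP[x1 [a1 [z1 [h1 <- ->]]]].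
  have [x [[|a z] [h -> E]]] := reduced_e_cat h1; first by [].
  case: E => -> _.
  have la : labels S2 c2 a by apply/labelsP; exists x, z.
  rewrite mulKg (lift_labelE la) (lift_eltE h).
  have -> : \prod_(b <- map e x) b * e a = \prod_(b <- map e (x ++ [:: a])) b.
    by rewrite map_cat big_cat /= big_seq1.
  rewrite (@lift_eltE _ z) -?catA // big_cat /= big_seq1.
  by rewrite mulKg.
Qed.
End MatchingReducedWords.

(** * Presentations with matching relations *)

Section PresentationIso.
Variables (X1 X2 : choiceType).
Variables (rel1 : seq X1 -> seq X1 -> Prop) (rel2 : seq X2 -> seq X2 -> Prop).
Implicit Types (h : X1 -> X2).

Definition map_word h (w : seq (X1 * bool)) : seq (X2 * bool) :=
  [seq (h p.1, p.2) | p <- w].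

Lemma map_word_cong h :
  (forall s t, rel1 s t -> rel2 (map h s) (map h t)) ->
  forall w1 w2, pres_cong rel1 w1 w2 ->
    pres_cong rel2 (map_word h w1) (map_word h w2).
Proof.
move=> hr w1 w2; elim=> {w1 w2}.
- by move=> w; exact: pc_refl.
- by move=> w1 w2 _; exact: pc_sym.
- by move=> w1 w2 w3 _ + _; exact: pc_trans.
- by move=> w1 w1' w2 w2' _ h1 _ h2; rewrite /map_word !map_cat; exact: pc_cat.
- by move=> x b; exact: pc_cancel.
- move=> s1 s2 /hr/pc_rel.
  by rewrite /posword -!map_comp /map_word -!map_comp.
Qed.

End PresentationIso.

Lemma presented_iso (X1 X2 : choiceType) (rel1 : seq X1 -> seq X1 -> Prop)
    (rel2 : seq X2 -> seq X2 -> Prop) (h : X1 -> X2) (h' : X2 -> X1) :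
  cancel h h' -> cancel h' h ->
  (forall s t, rel1 s t <-> rel2 (map h s) (map h t)) ->
  group_iso (presented rel1) (presented rel2).
Proof.
move=> hK h'K hr.
have hr1 s t : rel1 s t -> rel2 (map h s) (map h t) by move/hr.
have hr2 s t : rel2 s t -> rel1 (map h' s) (map h' t).
  by move=> r; apply/hr; rewrite -!map_comp !(eq_map h'K) !map_id.
have mK : cancel (map_word h) (map_word h').
  by move=> w; rewrite /map_word -map_comp -[RHS]map_id; apply: eq_map => -[x b] /=; rewrite hK.
have m'K : cancel (map_word h') (map_word h).
  by move=> w; rewrite /map_word -map_comp -[RHS]map_id; apply: eq_map => -[x b] /=; rewrite h'K.
pose F (a : presented rel1) := pres_class rel2 (map_word h (pres_repr a)).
pose F' (a : presented rel2) := pres_class rel1 (map_word h' (pres_repr a)).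
exists F; split.
  exists F' => a.
    rewrite /F' /F -[RHS]pres_classK -[X in _ = pres_class _ X]mK; apply/pres_classP.
    by apply: (map_word_cong hr2); exact: pres_reprK.
  rewrite /F' /F -[RHS]pres_classK -[X in _ = pres_class _ X]m'K; apply/pres_classP.
  by apply: (map_word_cong hr1); exact: pres_reprK.
move=> a b; apply/pres_classP.
apply: (@pc_trans _ _ _ (map_word h (pres_repr a ++ pres_repr b))).
  by apply: (map_word_cong hr1); exact: pres_reprK.
by rewrite /map_word map_cat; apply: pc_cat; apply: pc_sym; exact: pres_reprK.
Qed.

(** * Interval groups of isomorphic labeled posets *)

Section IntervalGroupIso.
Local Open Scope group_scope.
Variables (G1 G2 : groupType) (S1 : set G1) (S2 : set G2) (c1 : G1) (c2 : G2).
Variables (f g : G1 -> G2).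
Hypothesis f_bij : set_bij (interval S1 c1) (interval S2 c2) f.
Hypothesis g_bij : set_bij (labels S1 c1) (labels S2 c2) g.
Hypothesis f_le : forall u w, interval S1 c1 u -> interval S1 c1 w ->
  (word_le S1 u w <-> word_le S2 (f u) (f w)).
Hypothesis fg : forall u w, cover S1 c1 u w -> (f u)^-1 * f w = g (u^-1 * w).

Let f_fun u : interval S1 c1 u -> interval S2 c2 (f u).
Proof. by case: f_bij => h _ _; exact: h. Qed.
Let f_inj u v : interval S1 c1 u -> interval S1 c1 v -> f u = f v -> u = v.
Proof. by case: f_bij => _ h _ iu iv; apply: h; exact/mem_set. Qed.
Let f_surj v : interval S2 c2 v -> exists2 u, interval S1 c1 u & f u = v.
Proof. by case: f_bij => _ _ h /h[u]; exists u. Qed.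

Lemma iso_cover u w : interval S1 c1 u -> interval S1 c1 w ->
  cover S1 c1 u w <-> cover S2 c2 (f u) (f w).
Proof.
move=> iu iw; split=> -[_ _ le neq max]; split=> //; try exact: f_fun.
- exact/f_le.
- by apply: contraNneq neq => /(f_inj iu iw) ->.
- move=> v' /f_surj[v iv <-] /(f_le iu iv) l1 /(f_le iv iw) l2.
  by case: (max v iv l1 l2) => ->; [left|right].
- exact/f_le.
- by apply: contraNneq neq => ->.
- move=> v iv /(f_le iu iv) l1 /(f_le iv iw) l2.
  by case: (max _ (f_fun iv) l1 l2) => /f_inj ->; [left|done|done|right|done|done].
Qed.

Definition iso_label (a : labels S1 c1) : labels S2 c2 :=
  SigSub (mem_set (let: And3 h _ _ := g_bij in h _ (set_mem (valP a)))).

Lemma iso_label_bij : bijective iso_label.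
Proof.
rewrite -setTT_bijective; split=> // [a b _ _ /(congr1 val) /= e|b _].
  by apply: val_inj; case: g_bij => _ + _; apply=> //; exact: valP.
have [_ _ /(_ _ (set_mem (valP b)))[a ha e]] := g_bij.
by exists (SigSub (mem_set ha)) => //; exact: val_inj.
Qed.

Lemma chain_interval (G : groupType) (S : set G) c u w (s : seq (labels S c)) :
  chain u w s -> interval S c u /\ interval S c w.
Proof.
elim=> [v iv|u' v w' a s' cv _ _ [_ iw]]; first by split.
by split=> //; case: cv.
Qed.

(** Surjectivity of [f] lifts the intermediate elements of a chain, and injectivity of [g] on labels
    recovers the labels. *)
Lemma iso_chain u w s : interval S1 c1 u -> interval S1 c1 w ->
  chain u w s <-> chain (f u) (f w) (map iso_label s).
Proof.
move=> iu iw; split=> [h|].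
  elim: h {iu iw} => {u w s} [u iu|u v w a s cv ea /chain_interval[iv iw] IH].
    exact: chain_nil (f_fun iu).
  have iu : interval S1 c1 u by case: cv.
  apply: chain_cons IH; first exact/iso_cover.
  by rewrite /= ea -fg.
elim: s u iu => [|a s IH] u iu /= h.
  inversion h; subst; have <- : u = w by apply: f_inj.
  exact: chain_nil.
inversion h as [|? v' ? ? ? cv ea ch]; subst.
have [_ iv' _ _ _] := cv; have [v iv ev] := f_surj iv'; subst v'.
have cuv : cover S1 c1 u v by apply/iso_cover.
apply: chain_cons (IH _ iv ch) => //.
move: ea; rewrite (fg cuv) /=; case: g_bij => _ gi _ /gi -> //; first exact: valP.
by apply/mem_set; exists u, v.
Qed.

Lemma iso_chain_rel s t :
  chain_rel s t <-> chain_rel (map iso_label s) (map iso_label t).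
Proof.
split=> [[u [w [hs ht]]]|[u' [w' [hs ht]]]].
  have [iu iw] := chain_interval hs.
  by exists (f u), (f w); split; apply/iso_chain.
have [/f_surj[u iu eu] /f_surj[w iw ew]] := chain_interval hs; subst u' w'.
by exists u, w; split; apply/iso_chain.
Qed.

Lemma interval_group_iso : group_iso (interval_group S1 c1) (interval_group S2 c2).
Proof.
have [l' lK l'K] := iso_label_bij.
exact: (presented_iso lK l'K iso_chain_rel).
Qed.
End IntervalGroupIso.

Lemma labeled_poset_iso_group_iso (G1 G2 : groupType) (S1 : set G1) (c1 : G1)
    (S2 : set G2) (c2 : G2) : labeled_poset_iso S1 c1 S2 c2 ->
  group_iso (interval_group S1 c1) (interval_group S2 c2).
Proof. by move=> [f [g [fb gb fl fc]]]; exact: interval_group_iso fb gb fl fc. Qed.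

(** * Periodic permutations and displacements *)

Section Residues.
Local Open Scope ring_scope.
Variable n : nat.
Hypothesis n_gt1 : (1 < n)%N.
Implicit Types (k l q : int) (i j : 'I_n) (A : {set 'I_n}) (u v t : perZ n).

Lemma residue_subproof k : (`|(k %% n)%Z| < n)%N.
Proof. lia. Qed.
Definition residue k : 'I_n := Ordinal (residue_subproof k).

Lemma residue_eq k l : (residue k == residue l) = (k == l %[mod n])%Z.
Proof. by rewrite -val_eqE /=; apply/eqP/eqP; lia. Qed.

Lemma residueE k : (residue k)%:Z = (k %% n)%Z.
Proof. by rewrite /= gez0_abs // modz_ge0; lia. Qed.

Lemma residue_ord i : residue i%:Z = i.
Proof. by apply: val_inj => /=; rewrite modz_small //; have := ltn_ord i; lia. Qed.

Lemma residueP k l : reflect (exists q, k = l + q * n%:Z) (residue k == residue l).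
Proof.
rewrite residue_eq; apply: (iffP eqP) => [h|[q ->]]; last by rewrite addrC modzMDl.
exists ((k %/ n)%Z - (l %/ n)%Z).
by rewrite {1}(divz_eq k n) {1}(divz_eq l n) h; ring.
Qed.

Lemma residueDn k q : residue (k + q * n%:Z) = residue k.
Proof. by apply/eqP/residueP; exists q. Qed.

Lemma periodic_residue (T : Type) (F : int -> T) :
  (forall k q, F (k + q * n%:Z) = F k) -> forall k, F (residue k)%:Z = F k.
Proof.
move=> pF k; have /residueP[q ->] : residue (residue k)%:Z == residue k.
  by rewrite residue_ord.
exact: pF.
Qed.

Lemma residue_perZ u k l : (residue (u k) == residue (u l)) = (residue k == residue l).
Proof.
apply/residueP/residueP => -[q h]; exists q; last by rewrite h perZDq.
by apply: (can_inj (sbfunK u)); rewrite h perZDq.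
Qed.

Lemma residue_perm_subproof u : injective (fun i => residue (u i%:Z)).
Proof. by move=> i j /eqP; rewrite residue_perZ !residue_ord => /eqP. Qed.
Definition residue_perm u : {perm 'I_n} := perm (@residue_perm_subproof u).

Lemma residue_permE u k : residue_perm u (residue k) = residue (u k).
Proof. by rewrite permE; apply/eqP; rewrite residue_perZ residue_ord. Qed.

(** The factors swap because products in [{perm 'I_n}] act from left to right, those of [selfbij]
    from right to left. *)
Lemma residue_permM u v : residue_perm (u * v)%g = (residue_perm v * residue_perm u)%g.
Proof.
by apply/permP => i; rewrite permM -[i]residue_ord !residue_permE.
Qed.

Lemma residue_perm1 : residue_perm 1%g = 1%g.
Proof. by apply/permP => i; rewrite perm1 -[i]residue_ord residue_permE. Qed.

Lemma residue_permV u : residue_perm u^-1%g = (residue_perm u)^-1%g.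
Proof.
by apply/eqP; rewrite eq_sym eq_invg_mul -residue_permM mulVg residue_perm1.
Qed.

Lemma perZP u v : (forall k, u k = v k) -> u = v.
Proof. by move=> h; apply: val_inj; exact: selfbijP. Qed.

Lemma perZ_ordP u v : (forall i, u i%:Z = v i%:Z) -> u = v.
Proof.
move=> h; apply: perZP => k.
have [q ->] : exists q, k = (residue k)%:Z + q * n%:Z.
  by apply/residueP; rewrite residue_ord.
by rewrite !perZDq h.
Qed.

Lemma displacement_residue u k : u (residue k)%:Z - (residue k)%:Z = u k - k.
Proof.
apply: (@periodic_residue _ (fun k => u k - k)) => l q.
by rewrite perZDq; ring.
Qed.

(** The summand is periodic in [i], so any other representatives of the classes in [A] would give
    the same sum. *)
Definition displacement A u : int := \sum_(i in A) (u i%:Z - i%:Z).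

Definition respects A u := forall i, (residue_perm u i \in A) = (i \in A).

Lemma respects1 A u : residue_perm u = 1%g -> respects A u.
Proof. by move=> h i; rewrite h perm1. Qed.

Lemma respectsM A u v : respects A u -> respects A v -> respects A (u * v)%g.
Proof. by move=> hu hv i; rewrite residue_permM permM hu hv. Qed.

Lemma respectsT u : respects [set: 'I_n]%SET u.
Proof. by move=> i; rewrite !inE. Qed.

Lemma respectsC A u : respects A u -> respects (~: A)%SET u.
Proof. by move=> h i; rewrite !inE h. Qed.

Lemma respects_prod A (s : seq (perZ n)) : (forall t, t \in s -> respects A t) ->
  respects A (\prod_(t <- s) t)%g.
Proof.
elim: s => [|t s IH] h; first by rewrite big_nil; apply: respects1 residue_perm1.
rewrite big_cons; apply: respectsM; first exact/h/mem_head.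
by apply: IH => t' t's; apply: h; rewrite inE t's orbT.
Qed.

Lemma displacement1 A : displacement A 1%g = 0.
Proof. by rewrite /displacement big1 // => i _; rewrite subrr. Qed.

(** As [v] permutes the classes in [A], the displacement of [u] can be summed over their images
    under [v]. *)
Lemma displacementM A u v : respects A v ->
  displacement A (u * v)%g = displacement A u + displacement A v.
Proof.
move=> hv; rewrite /displacement.
under eq_bigr => i _ do rewrite -(subrK (v i%:Z) ((u * v)%g i%:Z)) -addrA.
rewrite big_split /=; congr (_ + _).
rewrite [RHS](reindex_inj (@perm_inj _ (residue_perm v))).
apply: eq_big => [i|i _]; first by rewrite hv.
by rewrite -[in RHS](residue_ord i) residue_permE displacement_residue.
Qed.

Lemma displacement_prod A (s : seq (perZ n)) :
  (forall t, t \in s -> respects A t) ->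
  displacement A (\prod_(t <- s) t)%g = \sum_(t <- s) displacement A t.
Proof.
elim: s => [|t s IH] h; first by rewrite !big_nil displacement1.
have h' t' : t' \in s -> respects A t' by move=> t's; apply: h; rewrite inE t's orbT.
by rewrite !big_cons displacementM ?IH //; exact: respects_prod.
Qed.

Lemma displacementV A u : respects A u ->
  displacement A u^-1%g = - displacement A u.
Proof.
by move=> h; apply/eqP; rewrite -addr_eq0 -displacementM // mulVg displacement1.
Qed.

Lemma displacementC A u :
  displacement [set: 'I_n]%SET u = displacement A u + displacement (~: A)%SET u.
Proof.
rewrite /displacement [LHS](bigID (mem A)) /=.
by congr (_ + _); apply: eq_bigl => i; rewrite !inE.
Qed.

Lemma reflE k l x : (residue k != residue l) ->
  refl n k l x = if residue x == residue k then x + (l - k)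
                 else if residue x == residue l then x + (k - l) else x.
Proof. by rewrite /refl /= /refl_fun !residue_eq => /negPf ->. Qed.

Lemma residue_perm_refl k l : residue_perm (refl n k l) = tperm (residue k) (residue l).
Proof.
apply/permP => i; rewrite -[i]residue_ord residue_permE.
have [e|ne] := boolP (residue k == residue l).
  have -> : refl n k l i%:Z = i%:Z by rewrite /= /refl_fun -residue_eq e.
  by rewrite (eqP e) tperm1 perm1.
rewrite reflE // !residue_ord.
case: tpermP => [->|->|/eqP/negPf-> /eqP/negPf-> //]; last by rewrite residue_ord.
  rewrite eqxx; apply/eqP; have /residueP[q ->] : residue (residue k)%:Z == residue k by rewrite residue_ord.
  by apply/residueP; exists q; ring.
rewrite [residue l == _]eq_sym (negPf ne) eqxx.
apply/eqP; have /residueP[q ->] : residue (residue l)%:Z == residue l by rewrite residue_ord.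
by apply/residueP; exists q; ring.
Qed.

Lemma displacement_refl A k l : residue k != residue l ->
  displacement A (refl n k l) = (residue k \in A)%:Z * (l - k) + (residue l \in A)%:Z * (k - l).
Proof.
move=> ne; rewrite /displacement.
have E i : refl n k l i%:Z - i%:Z = (i == residue k)%:Z * (l - k) + (i == residue l)%:Z * (k - l).
  rewrite reflE // residue_ord; have [->|ik] := eqVneq i (residue k).
    by rewrite (negPf ne) mul0r mul1r; lia.
  by case: eqVneq => _; rewrite mul0r ?mul0r ?mul1r; lia.
under eq_bigr do rewrite E.
rewrite big_split /= -!mulr_suml.
congr (_ * _ + _ * _).
  by have [h|h] := boolP (residue k \in A);
    [rewrite (bigD1 (residue k)) //= eqxx big1 // => i /andP[_ /negPf ->]
    |rewrite big1 // => i iA; case: eqP => // ik; rewrite -ik iA in h].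
by have [h|h] := boolP (residue l \in A);
    [rewrite (bigD1 (residue l)) //= eqxx big1 // => i /andP[_ /negPf ->]
    |rewrite big1 // => i iA; case: eqP => // ik; rewrite -ik iA in h].
Qed.

Lemma respects_refl A k l : residue k != residue l ->
  respects A (refl n k l) -> displacement A (refl n k l) = 0.
Proof.
move=> ne h; rewrite displacement_refl //.
by have := h (residue k); rewrite residue_perm_refl tpermL => ->; ring.
Qed.

Lemma loopE k x : loop n k x = x + (residue x == residue k)%:Z * n%:Z.
Proof. by rewrite /= /loop_fun residue_eq; case: ifP => _; rewrite ?mul1r ?mulN1r ?mul0r ?oppr0 ?addr0. Qed.

Lemma loopVE k x : (loop n k)^-1%g x = x - (residue x == residue k)%:Z * n%:Z.
Proof.
have -> : (loop n k)^-1%g x = loop_fun n k (- 1) x by [].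
by rewrite /= /loop_fun residue_eq; case: ifP => _; rewrite ?mul1r ?mulN1r ?mul0r ?oppr0 ?addr0.
Qed.

Lemma residue_perm_loop k : residue_perm (loop n k) = 1%g.
Proof.
apply/permP => i; rewrite -[i]residue_ord residue_permE perm1 loopE.
by rewrite residueDn.
Qed.

Lemma residue_perm_loopV k : residue_perm (loop n k)^-1%g = 1%g.
Proof. by rewrite residue_permV residue_perm_loop invg1. Qed.

Lemma loop_residue k : loop n (residue k)%:Z = loop n k.
Proof. by apply: perZP => x; rewrite !loopE residue_ord. Qed.

Lemma displacement_loop A k :
  displacement A (loop n k) = (residue k \in A)%:Z * n%:Z.
Proof.
rewrite /displacement; under eq_bigr => i _ do rewrite loopE residue_ord addrC addKr.
rewrite -mulr_suml; congr (_ * _).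
by have [h|h] := boolP (residue k \in A);
    [rewrite (bigD1 (residue k)) //= eqxx big1 // => i /andP[_ /negPf ->]
    |rewrite big1 // => i iA; case: eqP => // ik; rewrite -ik iA in h].
Qed.

Lemma displacement_loopV A k :
  displacement A (loop n k)^-1%g = - ((residue k \in A)%:Z * n%:Z).
Proof.
rewrite displacementV ?displacement_loop //; exact/respects1/residue_perm_loop.
Qed.

Lemma refl_conj u k l : (u * refl n k l * u^-1)%g = refl n (u k) (u l).
Proof.
apply: perZP => x.
have eux : forall y, residue (u^-1%g x) == residue y = (residue x == residue (u y)).
  by move=> y; rewrite -(residue_perZ u) -[u (u^-1%g x)]/((u * u^-1)%g x) mulgV.
have ux y : x = u y -> (u * refl n k l * u^-1)%g x = u (refl n k l y).
  by move=> ->; rewrite /= sbfunK.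
have [e|ne] := boolP (residue k == residue l).
  have r0 a b y : residue a == residue b -> refl n a b y = y.
    by rewrite residue_eq /= /refl_fun => ->.
  by rewrite (ux (u^-1%g x)) ?r0 ?residue_perZ //= ?sbinvK.
rewrite reflE ?residue_perZ // (ux (u^-1%g x)) /= ?sbinvK // -/(refl_fun n k l _).
rewrite -[refl_fun _ _ _ _]/(refl n k l (u^-1%g x)) reflE // !eux.
case: ifP => [/residueP[q e]|_].
  have -> : u^-1%g x = k + q * n%:Z.
    by apply: (can_inj (sbfunK u)); rewrite perZDq -e /= sbinvK.
  by rewrite -addrA addrC -addrA subrK addrC perZDq e; ring.
case: ifP => [/residueP[q e]|_]; last by rewrite /= sbinvK.
have -> : u^-1%g x = l + q * n%:Z.
  by apply: (can_inj (sbfunK u)); rewrite perZDq -e /= sbinvK.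
by rewrite -addrA addrC -addrA subrK addrC perZDq e; ring.
Qed.
Lemma residue_pred k : ord_pred (residue k) = residue (k - 1).
Proof.
apply/eqP; rewrite -(residue_ord (ord_pred _)).
rewrite residue_eq /=; set r := `|_|%N.
have -> : (k - 1 = (k %/ n)%Z * n + (r%:Z - 1))%R.
  by rewrite {1}(divz_eq k n) /r gez0_abs ?modz_ge0; lia.
rewrite modzMDl; apply/eqP.
have -> : ((r + n).-1 %% n)%N = ((r%:Z - 1 + 1 * n%:Z) %% n)%Z :> int.
  by rewrite -modz_nat; congr (_ %% _)%Z; lia.
by rewrite modz_mod addrC modzMDl.
Qed.

Lemma residueS k : residue k != residue (k + 1).
Proof.
apply/negP => /residueP[q h].
by have [|[|]] : q <= -1 \/ q = 0 \/ 1 <= q by [lia]; nia.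
Qed.

End Residues.

(** * Coxeter elements *)

Section Trajectory.
Local Open Scope ring_scope.
Variables (n : nat) (I : int -> nat).
Hypothesis I_lt : forall l, (I l < n)%N.
Hypothesis I_neq : forall l, I l != I (l - 1).

(** [I l] is the time of the edge joining [l] and [l + 1]; at time [d] the endpoints of each edge of
    that time are exchanged. *)
Definition step (d : nat) (j : int) : int :=
  if I j == d then j + 1 else if I (j - 1) == d then j - 1 else j.

(** Products act from right to left, so the times run down from [n - 1]. *)
Fixpoint trajectory (m : nat) (k : int) : int :=
  if m is m'.+1 then step (n - m) (trajectory m' k) else k.

(* Starting at a local ascent of the times, the point is pushed to the right by
   consecutive edges of decreasing times, until the next local ascent. *)
Lemma trajectory_invariant (k : int) m : (I (k - 1) < I k)%N -> (m <= n)%N ->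
  let j := trajectory m k in
  [/\ k <= j, forall l, k < l -> l < j -> (I l < I (l - 1))%N,
      forall l, k <= l -> l < j -> (n - m <= I l)%N &
      j = k /\ (I k < n - m)%N \/ k < j /\ ((I (j - 1) < I j)%N \/ (I j < n - m)%N)].
Proof.
move=> hk; elim: m => [|m IH] mn /=.
  by rewrite subn0; split=> // [l|l|]; [lia|lia|left; split].
have /IH {IH} := ltnW mn; move: (trajectory m k) => j /= [kj btw late alt].
have ed : (n - m)%N = (n - m.+1).+1 by lia.
rewrite /step; set d := (n - m.+1)%N; rewrite -/d in ed; rewrite ed in late alt.
case: eqP => [Ij|/eqP nIj].
  have hj : j = k \/ k < j /\ (I j < I (j - 1))%N.
    case: alt => [[-> _]|[kj' [asc|]]]; [by left| |].
      by have : (d < I (j - 1))%N by [apply: late; lia]; lia.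
    by right; split=> //; have : (d < I (j - 1))%N by [apply: late; lia]; lia.
  split; first by lia.
  - move=> l kl lj; have [->|lj'] := eqVneq l j; last by apply: btw; lia.
    by case: hj => [jk|[]//]; lia.
  - move=> l kl lj; have [->|lj'] := eqVneq l j; first by rewrite Ij.
    by have : (d < I l)%N by [apply: late; lia]; lia.
  - right; split; first by lia.
    have -> : j + 1 - 1 = j by lia.
    have := I_neq (j + 1); have -> : j + 1 - 1 = j by lia.
    by rewrite Ij; lia.
(* A step to the left cannot happen: either the edge below [j] has a time later than [d], or
   [j = k], and the edge above [k], being later than the one below, would already have moved the
   point. *)
case: eqP => [Ij|/eqP nIj'].
  case: alt => [[jk]|[kj' _]]; first by rewrite jk in Ij; lia.
  by have : (d < I (j - 1))%N by [apply: late; lia]; lia.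
split=> // [l kl lj|]; first by have := late l kl lj; lia.
case: alt => [[jk]|[kj' alt]]; first by left; split=> //; rewrite jk in nIj; lia.
by right; split=> //; case: alt; [left|right; lia].
Qed.

Lemma trajectory_next (k : int) : (I (k - 1) < I k)%N ->
  let j := trajectory n k in
  [/\ k < j, (I (j - 1) < I j)%N & forall l, k < l -> l < j -> (I l < I (l - 1))%N].
Proof.
move=> hk; have [_ btw _] := trajectory_invariant hk (leqnn n).
by rewrite subnn => -[[_ //]|[kj [|//]]]; split.
Qed.
End Trajectory.

(** Negation carries the edge from [l] to [l + 1] to the edge from [- l - 1] to [- l]. Local
    descents of the times become local ascents, so inner points are reduced to the case of outer
    points. *)
Lemma trajectoryN n (I : int -> nat) m k (I_neq : forall l, (I l != I (l - 1))%R) :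
  (trajectory n I m (- k) = - trajectory n (fun l => I (- l - 1)) m k)%R.
Proof.
elim: m k => //= m IH k; rewrite IH; move: (trajectory _ _ _ _) => j.
rewrite /step; have -> : (- (j - 1) - 1 = - j)%R by lia.
have := I_neq (- j)%R.
move=> ne; case: eqP => e1; case: eqP => e2; try lia.
by rewrite e1 e2 eqxx in ne.
Qed.

Section CoxeterElement.
Local Open Scope ring_scope.
Variable n : nat.
Hypothesis n_gt1 : (1 < n)%N.
Variable w : seq 'I_n.
Hypothesis w_coxeter : coxeter_word w.
Local Notation residue := (residue n_gt1).
Local Notation c := (coxeter w).
Implicit Types (k l : int).

Lemma coxeter_word_size : size w = n.
Proof. by rewrite (perm_size w_coxeter) size_enum_ord. Qed.

Lemma coxeter_word_uniq : uniq w.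
Proof. by rewrite (perm_uniq w_coxeter) enum_uniq. Qed.

Lemma mem_coxeter_word i : i \in w.
Proof. by rewrite (perm_mem w_coxeter) mem_enum. Qed.

Definition time k := index (residue k) w.

Lemma time_lt k : (time k < n)%N.
Proof. by rewrite -[X in (_ < X)%N]coxeter_word_size index_mem mem_coxeter_word. Qed.

Lemma time_eq k l : (time k == time l) = (residue k == residue l).
Proof.
rewrite /time; apply/eqP/eqP => [/(congr1 (nth (residue 0) w))|-> //].
by rewrite !nth_index // mem_coxeter_word.
Qed.

Lemma time_neq k : time k != time (k - 1).
Proof.
by rewrite time_eq eq_sym -{2}(subrK 1 k) residueS.
Qed.

Lemma outerE k : (residue k \in outer w) = (time (k - 1) < time k)%N.
Proof. by rewrite inE /precedes residue_pred. Qed.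

Lemma simple_reflE (i : 'I_n) k : simple_refl i k = step time (index i w) k.
Proof.
have ne : residue i%:Z != residue (i%:Z + 1).
  by rewrite -time_eq eq_sym -{2}(addrK 1 i%:Z) time_neq.
rewrite /simple_refl (reflE _ ne) /step /time.
have idx j : (index j w == index i w) = (j == i).
  apply/eqP/eqP => [/(congr1 (nth (residue 0) w))|-> //].
  by rewrite !nth_index // mem_coxeter_word.
rewrite !idx (residue_ord n_gt1).
case: eqP => _; first by lia.
have -> : (residue k == residue (i%:Z + 1)) = (residue (k - 1) == i).
  rewrite -{2}(residue_ord n_gt1 i); apply/residueP/residueP => -[q h]; exists q; lia.
by case: ifP => _; lia.
Qed.

Lemma coxeter_drop m k : (m <= n)%N ->
  (\prod_(i <- drop (n - m) w) simple_refl i)%g k = trajectory n time m k.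
Proof.
elim: m => [|m IH] mn; first by rewrite drop_oversize ?big_nil // coxeter_word_size subn0.
have lt : (n - m.+1 < size w)%N by rewrite coxeter_word_size; lia.
rewrite (drop_nth (residue 0) lt) big_cons.
have -> : (n - m.+1).+1 = (n - m)%N by lia.
rewrite /= -IH 1?ltnW //.
rewrite -[LHS]/(simple_refl _ ((\prod_(i <- drop (n - m) w) simple_refl i)%g k)).
by rewrite simple_reflE index_uniq // coxeter_word_uniq.
Qed.

Lemma coxeterE k : c k = trajectory n time n k.
Proof. by rewrite -coxeter_drop // subnn drop0. Qed.

Lemma coxeter_outer k : residue k \in outer w ->
  [/\ k < c k, residue (c k) \in outer w &
      forall l, k < l -> l < c k -> residue l \notin outer w].
Proof.
rewrite outerE => /(trajectory_next time_lt time_neq)[h1 h2 h3].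
rewrite coxeterE outerE; split=> // l kl lj.
by rewrite outerE -leqNgt ltnW // h3.
Qed.

Lemma coxeter_inner k : residue k \notin outer w ->
  [/\ c k < k, residue (c k) \notin outer w &
      forall l, c k < l -> l < k -> residue l \in outer w].
Proof.
have inn l : (residue l \notin outer w) = (time l < time (l - 1))%N.
  by rewrite outerE; have := time_neq l; lia.
rewrite inn => hk.
have neqN l : time (- l - 1) != time (- (l - 1) - 1).
  have := time_neq (- l); rewrite eq_sym.
  by have -> : - (l - 1) - 1 = - l by lia.
have hk' : (time (- (- k - 1) - 1) < time (- - k - 1))%N.
  by move: hk; rewrite opprK; have -> : - (- k - 1) - 1 = k by lia.
have := trajectory_next (I := fun l => time (- l - 1)) (fun l => time_lt _) neqN hk'.
have -> : c k = - trajectory n (fun l => time (- l - 1)) n (- k).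
  by rewrite coxeterE -{1}[k]opprK (trajectoryN _ _ _ time_neq).
move: (trajectory _ _ _ _) => j /= [].
have -> : - (j - 1) - 1 = - j by lia.
rewrite inn => kj hj btw; split=> //; first by lia.
move=> l jl lk; rewrite outerE.
have := btw (- l); have -> : - (- l - 1) - 1 = l by lia.
by rewrite opprK; apply; lia.
Qed.

Lemma coxeter_respects : respects n_gt1 (outer w) c.
Proof.
move=> i; rewrite -(residue_ord n_gt1 i) residue_permE.
by have [/coxeter_outer[_ ->]//|/coxeter_inner[_ /negPf->]//] :=
  boolP (residue i%:Z \in outer w).
Qed.

(** Modulo [n], each of the two kinds of points is a single orbit: [c] moves an outer point to the
    next outer point on the right, and an inner point to the next inner point on the left. *)
Lemma coxeter_invariant (T : Type) (f : 'I_n -> T) :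
  (forall i, f (residue_perm n_gt1 c i) = f i) ->
  forall i j, (i \in outer w) = (j \in outer w) -> f i = f j.
Proof.
move=> fc i j; rewrite -(residue_ord n_gt1 i) -(residue_ord n_gt1 j).
have {}fc k : f (residue (c k)) = f (residue k) by rewrite -residue_permE.
have up m : forall k l, l - k <= m%:Z -> k <= l -> residue k \in outer w ->
    residue l \in outer w -> f (residue k) = f (residue l).
  elim: m => [|m IH] k l km kl hk hl; first by have -> : k = l by lia.
  have [->//|kl'] := eqVneq k l.
  have [h1 h2 h3] := coxeter_outer hk; rewrite -fc; apply: IH => //; first by lia.
  by rewrite leNgt; apply/negP => lt; move: hl; apply/negP/h3 => //; lia.
have down m : forall k l, k - l <= m%:Z -> l <= k -> residue k \notin outer w ->
    residue l \notin outer w -> f (residue k) = f (residue l).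
  elim: m => [|m IH] k l km kl hk hl; first by have -> : k = l by lia.
  have [->//|kl'] := eqVneq k l.
  have [h1 h2 h3] := coxeter_inner hk; rewrite -fc; apply: IH => //; first by lia.
  by rewrite leNgt; apply/negP => lt; move/negP: hl; apply; apply: h3 => //; lia.
have [hi /esym hj|hi /esym/negbT hj] := boolP (residue i%:Z \in outer w).
  (* One period is added to [j] so that it lies to the right of [i] and is reached by going up. *)
  rewrite -(residueDn n_gt1 j 1) in hj *; have := ltn_ord i.
  by move=> ?; apply: (up (absz (j%:Z + 1 * n%:Z - i%:Z)%R)) => //; lia.
rewrite -(residueDn n_gt1 j (-1)) in hj *; have := ltn_ord j.
by move=> ?; apply: (down (absz (i%:Z - (j%:Z + -1 * n%:Z))%R)) => //; lia.
Qed.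

End CoxeterElement.

(** * Displacements of a Coxeter element *)

Section CoxeterDisplacement.
Local Open Scope ring_scope.
Variable n : nat.
Hypothesis n_gt1 : (1 < n)%N.
Local Notation residue := (residue n_gt1).
Local Notation respects := (respects n_gt1).
Local Notation residue_perm := (residue_perm n_gt1).

(** Each [u i] is divided by [n]: the remainders are the elements of [A] in another order, so they
    cancel against the [i]. *)
Lemma displacement_dvd (A : {set 'I_n}) (u : perZ n) : respects A u ->
  exists q : int, displacement A u = q * n%:Z.
Proof.
move=> hA; pose q (i : 'I_n) := ((u i%:Z) %/ n)%Z.
exists (\sum_(i in A) q i); rewrite mulr_suml /displacement.
have E (i : 'I_n) : u i%:Z - i%:Z = q i * n%:Z + ((residue_perm u i)%:Z - i%:Z).
  by rewrite -[in RHS](residue_ord n_gt1 i) residue_permE residueE residue_ord /q addrA -divz_eq.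
under eq_bigr do rewrite E.
rewrite big_split /= sumrB.
rewrite [X in _ + (_ - X)](reindex_inj (@perm_inj _ (residue_perm u))) /=.
by rewrite [X in _ + (_ - X)](eq_bigl (mem A)) ?subrr ?addr0 // => i; rewrite hA.
Qed.

Lemma sum_abs_displacementM (u v : perZ n) :
  \sum_(i < n) `|(u * v)%g i%:Z - i%:Z| <=
    \sum_(i < n) `|u i%:Z - i%:Z| + \sum_(i < n) `|v i%:Z - i%:Z| :> int.
Proof.
rewrite [X in _ <= X + _](reindex_inj (@perm_inj _ (residue_perm v))) -big_split /=.
apply: ler_sum => i _; rewrite -[in X in _ <= X + _](residue_ord n_gt1 i).
rewrite residue_permE displacement_residue.
have -> : (u * v)%g i%:Z - i%:Z = (u (v i%:Z) - v i%:Z) + (v i%:Z - i%:Z) by rewrite subrKA.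
exact: ler_normD.
Qed.

Lemma sum_abs_displacement_simple (i : 'I_n) :
  \sum_(j < n) `|simple_refl i j%:Z - j%:Z| = 2 :> int.
Proof.
have ne := residueS n_gt1 i%:Z.
rewrite (bigD1 (residue i%:Z)) // (bigD1 (residue (i%:Z + 1))) 1?eq_sym // big1.
  by rewrite !displacement_residue !(reflE _ ne) !eqxx [residue (_ + 1) == _]eq_sym (negPf ne) /=; lia.
move=> j /andP[/negPf j1 /negPf j2].
by rewrite (reflE _ ne) !residue_ord // in j1 j2 *; rewrite j1 j2 subrr.
Qed.

Variable w : seq 'I_n.
Hypothesis w_coxeter : coxeter_word w.
Local Notation c := (coxeter w).
Local Notation out := (outer w).
Local Notation inn := (inner w).

Lemma coxeterE_map : c = (\prod_(t <- map (@simple_refl n) w) t)%g.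
Proof. by rewrite big_map. Qed.

Lemma odd_coxeter : odd_perm (residue_perm c) = odd n.
Proof.
rewrite -[in RHS](coxeter_word_size w_coxeter) /coxeter.
elim: w => [|i s IH]; first by rewrite big_nil residue_perm1 odd_perm1.
rewrite big_cons residue_permM odd_permM IH /= residue_perm_refl odd_tperm.
by rewrite residueS addbT.
Qed.

Lemma displacement_coxeterT : displacement [set: 'I_n]%SET c = 0.
Proof.
rewrite coxeterE_map (displacement_prod (n_gt1 := n_gt1)) => [|t _]; last exact: respectsT.
rewrite big_map big1 // => i _; apply: (respects_refl (n_gt1 := n_gt1)); last exact: respectsT.
exact: residueS.
Qed.

Lemma sum_abs_displacement_coxeter : \sum_(i < n) `|c i%:Z - i%:Z| <= 2 * n%:Z :> int.
Proof.
rewrite -[in X in _ <= X](coxeter_word_size w_coxeter) /coxeter.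
elim: w => [|i s IH]; first by rewrite big_nil big1 // => i _; rewrite subrr.
rewrite big_cons; apply: le_trans (sum_abs_displacementM _ _) _.
by move: IH; rewrite sum_abs_displacement_simple /=; lia.
Qed.

(** Outer points move up and inner points down, so the total absolute displacement is the difference
    of the two displacements. Their sum is 0, and [n] simple reflections move the points by at most
    [2 * n] in all. Hence the outer displacement [q * n] has [q <= 1], while [q > 0] because every
    point moves. *)
Lemma displacement_outer_coxeter : displacement out c = n%:Z.
Proof.
have eT := displacementC out c; rewrite displacement_coxeterT in eT.
have outP i : i \in out -> `|c i%:Z - i%:Z| = c i%:Z - i%:Z /\ 1 <= c i%:Z - i%:Z.
  by rewrite -[in X in X -> _](residue_ord n_gt1 i) => /(coxeter_outer w_coxeter)[]; lia.
have innP i : i \in inn -> `|c i%:Z - i%:Z| = - (c i%:Z - i%:Z) /\ 1 <= - (c i%:Z - i%:Z).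
  by rewrite -[in X in X -> _](residue_ord n_gt1 i) inE => /(coxeter_inner w_coxeter)[]; lia.
have := sum_abs_displacement_coxeter.
rewrite (bigID (mem out)) /= (eq_bigr (fun i : 'I_n => c i%:Z - i%:Z)); last by move=> i /outP[].
rewrite -/(displacement out c) (eq_bigl (fun i => i \in inn)); last by move=> i; rewrite !inE.
rewrite (eq_bigr (fun i : 'I_n => - (c i%:Z - i%:Z))); last by move=> i /innP[].
rewrite sumrN -/(displacement inn c).
have D1 : #|out|%:Z <= displacement out c.
  rewrite -natz -sumr_const.
  by apply: ler_sum => i /outP[].
have D2 : #|inn|%:Z <= - displacement inn c.
  rewrite -natz -sumr_const /displacement -sumrN.
  by apply: ler_sum => i /innP[].
have := cardsC out; rewrite card_ord -/inn => card.
have [q hq] := displacement_dvd (coxeter_respects n_gt1 w_coxeter).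
move: eT D1 D2; rewrite -/inn hq => eT D1 D2 le.
have [|[->|]] : q <= 0 \/ q = 1 \/ 2 <= q by [lia]; [nia|lia|nia].
Qed.

Lemma displacement_inner_coxeter : displacement inn c = - n%:Z.
Proof.
have := displacementC out c.
by rewrite displacement_coxeterT displacement_outer_coxeter /inner; lia.
Qed.

Lemma outer_gt0 : (0 < #|out|)%N.
Proof.
rewrite lt0n cards_eq0; apply/eqP => e; have := displacement_outer_coxeter.
by rewrite e /displacement big_set0; lia.
Qed.

Lemma inner_gt0 : (0 < #|inn|)%N.
Proof.
rewrite lt0n cards_eq0; apply/eqP => e; have := displacement_inner_coxeter.
by rewrite e /displacement big_set0; lia.
Qed.
End CoxeterDisplacement.

(** * Words in reflections and loops *)

Section LoopWords.
Local Open Scope ring_scope.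
Variable n : nat.
Hypothesis n_gt1 : (1 < n)%N.
Local Notation residue := (residue n_gt1).
Local Notation respects := (respects n_gt1).
Local Notation residue_perm := (residue_perm n_gt1).
Implicit Types (t u p : perZ n) (s : seq (perZ n)).

Lemma reflectionP t : reflections t ->
  exists k l, residue k != residue l /\ t = refl n k l.
Proof. by move=> [k [l [ne ->]]]; exists k, l; rewrite residue_eq. Qed.

Lemma reflection_refl k l : residue k != residue l -> reflections (refl n k l).
Proof. by move=> ne; exists k, l; rewrite -residue_eq. Qed.

Lemma residue_perm_reflection t : reflections t -> residue_perm t != 1%g.
Proof.
move=> /reflectionP[k [l [ne ->]]]; rewrite residue_perm_refl; apply/eqP => e.
by have := tpermL (residue k) (residue l); rewrite e perm1 => /eqP; apply/negP.
Qed.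

Lemma TL_reflection t : TL t -> residue_perm t != 1%g -> reflections t.
Proof. by move=> [//|[k [->|->]]]; rewrite ?residue_perm_loop ?residue_perm_loopV eqxx. Qed.

Lemma TL_loop t : TL t -> residue_perm t = 1%g ->
  exists k, t = loop n k \/ t = (loop n k)^-1%g.
Proof. by move=> [/residue_perm_reflection/eqP//|]. Qed.

(** [f] names classes preserved by all letters. Loops preserve every class, and a reflection merges
    at most two classes, so the image of [f] loses at most one element. *)
Lemma TL_classes s : word_over (@TL n) s -> exists f : 'I_n -> 'I_n,
  (forall t, t \in s -> forall i, f (residue_perm t i) = f i) /\
  (n <= #|f @: [set: 'I_n]%SET| + count (fun t => residue_perm t != 1%g) s)%N.
Proof.
elim: s => [_|t s IH hs].
  by exists id; split=> //=; rewrite addn0 imset_id cardsT card_ord.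
have [|f [fs nf]] := IH; first by move=> t' t's; apply: hs; rewrite inE t's orbT.
have [t1|nt1] := eqVneq (residue_perm t) 1%g.
  exists f; split=> [t'|/=]; last by rewrite t1 eqxx.
  by rewrite inE => /predU1P[-> i|/fs //]; rewrite t1 perm1.
have [k [l [ne et]]] := reflectionP (TL_reflection (hs t (mem_head _ _)) nt1).
set a := residue k in ne; set b := residue l in ne.
(* The class of [a] is merged into that of [b]. *)
pose g i := if f i == f a then f b else f i.
exists g; split=> [t'|/=].
  rewrite inE => /predU1P[-> i|/fs e i]; last by rewrite /g e.
  rewrite et residue_perm_refl -/a -/b /g.
  case: tpermP => [->|->|//]; rewrite eqxx; first by case: eqP => [->|].
  by case: eqP.
rewrite nt1 add1n addnS -addSn; apply: leq_trans nf _; rewrite leq_add2r.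
have sub : f @: [set: 'I_n]%SET \subset (f a |: g @: [set: 'I_n]%SET)%SET.
  apply/fintype.subsetP => _ /imsetP[i _ ->]; rewrite !inE.
  have [//|fia] := eqVneq; apply/imsetP; exists i => //.
  by rewrite /g (negPf fia).
apply: leq_trans (subset_leq_card sub) _.
by rewrite cardsU1; case: (_ \notin _).
Qed.

Lemma odd_TL_word s : word_over (@TL n) s ->
  odd_perm (residue_perm (\prod_(t <- s) t)%g) =
  odd (count (fun t => residue_perm t != 1%g) s).
Proof.
elim: s => [_|t s IH hs]; first by rewrite big_nil residue_perm1 odd_perm1.
have {}IH := IH (fun t' t's => hs t' (mem_behead (s := t :: s) t's)).
rewrite big_cons residue_permM odd_permM IH /= oddD addbC; congr (_ (+) _).
have [->|nt1] := eqVneq (residue_perm t) 1%g; first by rewrite odd_perm1.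
have [k [l [ne ->]]] := reflectionP (TL_reflection (hs t (mem_head _ _)) nt1).
by rewrite residue_perm_refl odd_tperm ne.
Qed.

Lemma reflection_fix t x : reflections t ->
  residue_perm t (residue x) = residue x -> t x = x.
Proof.
move=> /reflectionP[k [l [ne ->]]]; rewrite residue_perm_refl reflE //.
case: tpermP => [-> e|-> e|/eqP/negPf-> /eqP/negPf->//]; by rewrite e eqxx in ne.
Qed.

Lemma displacement_reflection A t : reflections t -> respects A t ->
  displacement A t = 0.
Proof. by move=> /reflectionP[k [l [ne ->]]]; exact: respects_refl. Qed.

Variable w : seq 'I_n.
Hypothesis w_coxeter : coxeter_word w.
Local Notation c := (coxeter w).
Local Notation out := (outer w).
Local Notation inn := (inner w).

(** Only the permutation modulo [n] is prescribed, so this also applies to lifts of words over T U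
    F, whose product is at first known only modulo [n]. The map [f] of [TL_classes] is constant on
    outer and on inner points. If the two values agree, then [r >= n - 1], and parity gives [r = n];
    if not, then [r >= n - 2], and all letters preserve the two fibres. *)
Lemma TL_word_structure s : word_over (@TL n) s -> (size s <= n)%N ->
  residue_perm (\prod_(t <- s) t)%g = residue_perm c ->
  let r := count (fun t => residue_perm t != 1%g) s in
  r = n \/ (r.+2 = n)%N /\ forall t, t \in s -> respects out t.
Proof.
move=> hs sn ec r; have rn : (r <= n)%N := leq_trans (count_size _ _) sn.
have := odd_TL_word hs; rewrite ec odd_coxeter // -/r => odd_r.
have [f [fs nf]] := TL_classes hs; rewrite -/r in nf.
have fc i : f (residue_perm c i) = f i.
  rewrite -ec; elim: s fs {hs sn ec r rn odd_r nf} i => [|t s IH] fs i.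
    by rewrite big_nil residue_perm1 perm1.
  rewrite big_cons residue_permM permM fs ?mem_head // IH // => t' t's.
  by apply: fs; rewrite inE t's orbT.
have fconst := coxeter_invariant w_coxeter fc.
have /card_gt0P[a ha] := outer_gt0 n_gt1 w_coxeter.
have /card_gt0P[b hb] := inner_gt0 n_gt1 w_coxeter.
rewrite inE in hb.
have fE i : f i = if i \in out then f a else f b.
  by case: ifP => hi; apply: fconst; rewrite hi ?ha ?(negPf hb).
have sub : f @: [set: 'I_n]%SET \subset [set f a; f b]%SET.
  by apply/fintype.subsetP => _ /imsetP[i _ ->]; rewrite fE !inE; case: ifP; rewrite eqxx ?orbT.
have := subset_leq_card sub; rewrite cards2.
have [e|ne] := eqVneq (f a) (f b).
  move=> /= le1; left; have : (n <= 1 + r)%N by apply: leq_trans nf _; rewrite leq_add2r.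
  by move: odd_r; lia.
move=> /= le2; have : (n <= 2 + r)%N by apply: leq_trans nf _; rewrite leq_add2r.
have [->|nr] := eqVneq r n; first by left.
move=> nr2; right; split; first by move: odd_r; lia.
move=> t t's i; have := fs t t's i; rewrite (fE i) (fE (residue_perm t i)).
by do 2![case: ifP] => // _ _ e; rewrite e eqxx in ne.
Qed.

Lemma inner_outer i : (i \in inn) = (i \notin out).
Proof. by rewrite [LHS]inE. Qed.

Lemma TL_displacement t : TL t -> respects out t ->
  [\/ reflections t /\ (displacement out t = 0 /\ displacement inn t = 0),
      exists k, t = loop n k /\
       ((residue k \in out /\ displacement out t = n%:Z /\ displacement inn t = 0) \/
        (residue k \in inn /\ displacement out t = 0 /\ displacement inn t = n%:Z)) |
      exists k, t = (loop n k)^-1%g /\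
       ((residue k \in out /\ displacement out t = - n%:Z /\ displacement inn t = 0) \/
        (residue k \in inn /\ displacement out t = 0 /\ displacement inn t = - n%:Z))].
Proof.
move=> ht rt; have [t1|nt1] := eqVneq (residue_perm t) 1%g; last first.
  have tr := TL_reflection ht nt1; constructor 1; split=> //; split.
    exact: displacement_reflection.
  by apply: displacement_reflection => //; exact: respectsC.
have [k [->|->]] := TL_loop ht t1; [constructor 2|constructor 3]; exists k; split=> //.
  rewrite !(displacement_loop n_gt1) inner_outer.
  by case: (residue k \in out); rewrite /= mul1r mul0r; [left|right].
rewrite !(displacement_loopV n_gt1) inner_outer.
by case: (residue k \in out); rewrite /= mul1r mul0r oppr0; [left|right].
Qed.

Lemma sum_displacement_le s : word_over (@TL n) s ->
  (forall t, t \in s -> respects out t) ->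
  \sum_(t <- s) (`|displacement out t| + `|displacement inn t|) <=
    n%:Z * (size s - count (fun t => residue_perm t != 1%g) s)%:Z.
Proof.
elim: s => [|t s IH] hs rs; first by rewrite big_nil mulr0.
have {}IH := IH (fun t' t's => hs t' (mem_behead (s := t :: s) t's))
                (fun t' t's => rs t' (mem_behead (s := t :: s) t's)).
rewrite big_cons /=; have := count_size (fun t => residue_perm t != 1%g) s.
move: (\sum_(_ <- _) _) (count _ _) (size s) IH => S r m IH rm.
have e1 : (m.+1 - (1 + r) = m - r)%N by lia.
have e0 : (m.+1 - (0 + r) = (m - r).+1)%N by lia.
case: (TL_displacement (hs t (mem_head _ _)) (rs t (mem_head _ _))).
- by move=> [/residue_perm_reflection-> [-> ->]]; rewrite e1; lia.
- move=> [k [et d]]; have -> : residue_perm t = 1%g by rewrite et residue_perm_loop.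
  by rewrite eqxx e0; case: d => -[_ [-> ->]]; nia.
- move=> [k [et d]]; have -> : residue_perm t = 1%g by rewrite et residue_perm_loopV.
  by rewrite eqxx e0; case: d => -[_ [-> ->]]; nia.
Qed.

(** A condition satisfied by all letters of words of length at most [n] for [c]: loops are positive
    at outer points and negative at inner points. *)
Definition noncrossing_label t :=
  reflections t \/ (exists2 i, i \in out & t = loop n i%:Z) \/
  (exists2 i, i \in inn & t = (loop n i%:Z)^-1%g).

Lemma TL_word_coxeter s : word_over (@TL n) s -> (size s <= n)%N ->
  (\prod_(t <- s) t)%g = c ->
  size s = n /\ ((forall t, t \in s -> reflections t) \/
   [/\ forall t, t \in s -> respects out t,
       (count (fun t => residue_perm t != 1%g) s).+2 = n &
       forall t, t \in s -> noncrossing_label t]).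
Proof.
move=> hs sn ec; have := TL_word_structure hs sn (congr1 residue_perm ec).
set r := count _ s => /= -[rn|[rn rs]].
  have es : size s = n by apply/eqP; rewrite eqn_leq sn -[X in (X <= _)%N]rn count_size.
  split=> //; left => t t's; apply: TL_reflection; first exact: hs.
  have /allP -> // : all (fun t => residue_perm t != 1%g) s.
  by rewrite all_count -/r rn es.
have rs' t : t \in s -> respects inn t by move=> /rs/respectsC.
have le := sum_displacement_le hs rs.
have dout : \sum_(t <- s) displacement out t = n%:Z.
  by rewrite -(displacement_prod rs) ec displacement_outer_coxeter.
have dinn : \sum_(t <- s) displacement inn t = - n%:Z.
  by rewrite -(displacement_prod rs') ec displacement_inner_coxeter.
(* Each summand is nonnegative, while at most two loops have to realize the displacements [n] and
   [- n]. So no letter moves outer points down or inner points up. *)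
have n0 : \sum_(t <- s) ((`|displacement out t| - displacement out t) +
                          (`|displacement inn t| + displacement inn t)) <= 0.
  rewrite (eq_bigr (fun t => (`|displacement out t| + `|displacement inn t|) -
     (displacement out t - displacement inn t))); last by move=> t _; lia.
  rewrite sumrB sumrB dout dinn; rewrite -/r in le.
  have sr : (size s - r <= 2)%N by lia.
  by rewrite subr_le0; apply: le_trans le _; nia.
have nn t : 0 <= (`|displacement out t| - displacement out t) +
                 (`|displacement inn t| + displacement inn t) by lia.
have sgn t : t \in s -> 0 <= displacement out t /\ displacement inn t <= 0.
  move=> /(big_rem t) e; move: n0; rewrite e /= => n0.
  have : (`|displacement out t| - displacement out t) +
         (`|displacement inn t| + displacement inn t) <= 0.
    by apply: le_trans n0; rewrite lerDl; apply: sumr_ge0.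
  by lia.
split.
  apply/eqP; rewrite eqn_leq sn /=.
  (* The same totals require at least two loops, so the size is at least [r + 2]. *)
  have : n%:Z * 2 <= n%:Z * (size s - r)%:Z.
    apply: le_trans le; apply: (@le_trans _ _ (\sum_(t <- s)
      (displacement out t - displacement inn t))); last by apply: ler_sum => t _; lia.
    by rewrite sumrB dout dinn; lia.
  by nia.
right; split=> // t t's.
case: (TL_displacement (hs t t's) (rs t t's)) (sgn t t's).
- by move=> [? _]; left.
- move=> [k [-> [[kout _]|[_ [-> ->]]]]]; last by lia.
  by right; left; exists (residue k); rewrite ?loop_residue.
- move=> [k [-> [[_ [-> ->]]|[kinn _]]]]; first by lia.
  by right; right; exists (residue k); rewrite ?loop_residue.
Qed.
End LoopWords.

(** * The dual space *)

Section Functionals.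
Local Open Scope ring_scope.
Variables (R : realType) (n : nat).
Hypothesis n_gt1 : (1 < n)%N.
Local Notation residue := (residue n_gt1).
Local Notation Vdual := (Vdual R n).
Local Notation evec := (@evec R n).
Local Notation dvec := (dvec R n).
Implicit Types (f : int -> R) (x y : Vdual) (a b : int).

Let n_gt0 : (0 < n)%N. Proof. exact: ltnW. Qed.

Definition coord_sum (f : int -> R) (v : 'rV[R]_n.+1) : R^o :=
  \sum_(j < n.+1) v 0 j * f (j%:Z + 1).

Lemma coord_sum_is_linear f : linear (coord_sum f).
Proof.
move=> k u v; rewrite /coord_sum scaler_sumr -big_split /=; apply: eq_bigr => j _.
by rewrite !mxE mulrDl -mulrA.
Qed.
HB.instance Definition _ f :=
  GRing.isLinear.Build R 'rV[R]_n.+1 R^o *:%R (coord_sum f) (coord_sum_is_linear f).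

(** Compatibility with [e_(k+n) = e_k + delta]: such an [f] gives the values on the [e_k] of a
    linear form whose value on [delta] is [d]. *)
Definition quasi_periodic (f : int -> R) (d : R) :=
  forall k q, f (k + q * n%:Z) = f k + q%:~R * d.

Lemma coord_sum_delta f j : coord_sum f (delta_mx 0 j) = f (j%:Z + 1).
Proof.
rewrite /coord_sum (bigD1 j) //= big1 ?addr0 => [|i /negPf ij].
  by rewrite mxE !eqxx mul1r.
by rewrite mxE ij andbF mul0r.
Qed.

Lemma coord_sum_dvec f d : quasi_periodic f d -> coord_sum f dvec = d.
Proof.
move=> qf; rewrite linearB /= !coord_sum_delta /= add0r.
by have := qf 1 1; rewrite !mul1r addrC => ->; rewrite addrC addKr.
Qed.

Lemma coord_sum_evec f d k : quasi_periodic f d -> coord_sum f (evec k) = f k.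
Proof.
move=> qf; have -> : k = ((residue (k - 1))%:Z + 1) + ((k - 1) %/ n)%Z * n%:Z.
  rewrite residueE; have := divz_eq (k - 1) n.
  by move: (_ %/ _)%Z (_ %% _)%Z => q r e; rewrite -[LHS](subrK 1) e; ring.
rewrite evecD // qf linearD linearZ /= (coord_sum_dvec qf).
congr (_ + _).
rewrite -[LHS]/(coord_sum f (evec ((widen_ord (leqnSn n) (residue (k - 1)))%:Z + 1))).
by rewrite evec_ord // coord_sum_delta.
Qed.

Definition functional (f : int -> R) : Vdual :=
  (linfun (coord_sum f) \o linfun vsval)%VF.

Lemma dvecE : dvec = evec n%:Z - evec 0.
Proof.
have := evecD R 0 1 n_gt0.
by rewrite mul1r add0r scale1r => ->; rewrite addrC addKr.
Qed.

Lemma functionalE f v : v \in Vsp R n -> functional f (inV v) = coord_sum f v.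
Proof. by move=> hv; rewrite comp_lfunE !lfunE /= vsprojK. Qed.

(** The quasi-periodic function representing [x], normalized to vanish at 0. Identities in the dual
    space become identities of functions on the integers. *)
Definition value x a : R := x (inV (evec a - evec 0)).

Lemma valueB x a b : x (inV (evec a - evec b)) = value x a - value x b.
Proof.
have -> : evec a - evec b = (evec a - evec 0) - (evec b - evec 0).
  by rewrite opprB addrA subrK.
by rewrite /inV linearB linearB.
Qed.

Lemma deltavalE x : deltaval x = value x n%:Z.
Proof. by rewrite /deltaval dvecE. Qed.

Lemma value_quasi_periodic x : quasi_periodic (value x) (deltaval x).
Proof.
move=> k q; rewrite /value evecD // addrAC -[inV _]/(vsproj _ _) linearD linearZ /=.
by rewrite linearD linearZ.
Qed.

Lemma valueD x y a : value (x + y) a = value x a + value y a.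
Proof. by rewrite /value add_lfunE. Qed.
Lemma valueN x a : value (- x) a = - value x a.
Proof. by rewrite /value opp_lfunE. Qed.
Lemma valueZ k x a : value (k *: x) a = k * value x a.
Proof. by rewrite /value scale_lfunE. Qed.
Lemma value_sum (I : Type) (r : seq I) (P : pred I) (F : I -> Vdual) a :
  value (\sum_(i <- r | P i) F i) a = \sum_(i <- r | P i) value (F i) a.
Proof. by rewrite /value sum_lfunE. Qed.

Lemma value_functional f d a : quasi_periodic f d ->
  value (functional f) a = f a - f 0.
Proof.
by move=> qf; rewrite /value functionalE ?evecB_V // linearB /= !(coord_sum_evec _ qf).
Qed.

Lemma Vdual_alphaP x y : (forall i, x (inV (alpha R i)) = y (inV (alpha R i))) -> x = y.
Proof.
move=> h; apply/lfunP => v; rewrite -[v]vsvalK.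
rewrite (coord_span (subvsP v)) linear_sum !linear_sum; apply: eq_bigr => i _.
by rewrite !linearZ -tnth_nth tnth_mktuple; congr (_ *: _); exact: h.
Qed.

Lemma VdualP x y : (forall a, value x a = value y a) -> x = y.
Proof. by move=> h; apply: Vdual_alphaP => i; rewrite /alpha !valueB !h. Qed.

(** The function behind [rho m]: it jumps by 1 between [m] and [m + 1] modulo [n] and is constant
    elsewhere. *)
Definition edge_step (m : int) (k : int) : R := ((k - m - 1) %/ n)%Z%:~R.

Lemma edge_step_quasi_periodic m : quasi_periodic (edge_step m) 1.
Proof.
move=> k q; rewrite /edge_step.
have -> : k + q * n - m - 1 = q * n + (k - m - 1) by ring.
by rewrite divzMDl ?rmorphD /= ?mulr1 1?addrC //; lia.
Qed.

Lemma divz_pred a : (a %/ n)%Z - ((a - 1) %/ n)%Z = (residue a == residue 0)%:Z.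
Proof.
have nz : n%:Z != 0 by lia.
have [/eqP/residueP[q ->]|ne] := eqVneq (residue a) (residue 0).
  have -> : 0 + q * n%:Z - 1 = (q - 1) * n%:Z + (n%:Z - 1) by ring.
  by rewrite add0r mulzK // divzMDl // divz_small; lia.
have := divz_eq a n; have := modz_ge0 a nz; have := ltz_pmod a (_ : 0 < n%:Z).
move: (a %% n)%Z (a %/ n)%Z => r q /(_ (ltac:(lia))) r1 r0 e.
have rn0 : r != 0.
  apply: contraNneq ne => r0'; apply/eqP/eqP/residueP; exists q; rewrite e r0'; ring.
have -> : a - 1 = q * n%:Z + (r - 1) by rewrite e; ring.
rewrite divzMDl // divz_small ?addr0 ?subrr //; lia.
Qed.

Lemma edge_stepDn m q k : edge_step (m + q * n%:Z) k = edge_step m k - q%:~R.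
Proof.
rewrite /edge_step.
have -> : k - (m + q * n%:Z) - 1 = (- q) * n%:Z + (k - m - 1) by ring.
by rewrite divzMDl ?rmorphD /= ?rmorphN 1?addrC //; lia.
Qed.

Lemma edge_step_alpha (m : int) (i : 'I_n) :
  edge_step m (i%:Z + 1) - edge_step m i%:Z = (residue i%:Z == residue m)%:R.
Proof.
rewrite /edge_step -rmorphB /=.
have -> : i%:Z + 1 - m - 1 = i%:Z - m by lia.
rewrite divz_pred; have -> : (residue (i%:Z - m) == residue 0) = (residue i%:Z == residue m).
  by apply/residueP/residueP => -[q h]; exists q; lia.
by case: (_ == _).
Qed.

Lemma alphas_free : free (alphas R n).
Proof.
apply/freeP => k e0 m.
have E i : coord_sum (edge_step m) (k i *: (alphas R n)`_i) = k i * (i == m)%:R.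
  rewrite linearZ -tnth_nth tnth_mktuple linearB /=.
  rewrite !(coord_sum_evec _ (edge_step_quasi_periodic m)).
  by rewrite edge_step_alpha !residue_ord.
have := congr1 (coord_sum (edge_step m)) e0.
rewrite linear0 linear_sum (eq_bigr _ (fun i _ => E i)) (bigD1 m) //= eqxx mulr1.
by rewrite big1 ?addr0 // => i /negPf->; rewrite mulr0.
Qed.

Lemma rhoE (m : 'I_n) : rho R m = functional (edge_step m).
Proof.
apply: Vdual_alphaP => i; rewrite /alpha [RHS]valueB.
rewrite !(value_functional _ (edge_step_quasi_periodic m)) opprB addrA subrK.
rewrite edge_step_alpha !residue_ord -/(alpha R i).
rewrite comp_lfunE !lfunE /= vsprojK ?evecB_V //.
have -> : alpha R i = (alphas R n)`_i by rewrite -tnth_nth tnth_mktuple.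
by rewrite coord_free ?alphas_free // eq_sym.
Qed.

Lemma deltaval_rho (m : 'I_n) : deltaval (rho R m) = 1.
Proof.
rewrite rhoE deltavalE (value_functional _ (edge_step_quasi_periodic m)).
have := edge_step_quasi_periodic m 0 1; rewrite add0r !mul1r => ->.
by rewrite addrC addKr.
Qed.

(** The jumps of [rho (m - 1)] and [rho m] enclose exactly the class of [m], so [sigma m] is minus
    its indicator function, normalized at 0. *)
Lemma value_sigma (m : 'I_n) a :
  value (sigma R m) a = (residue 0 == m)%:R - (residue a == m)%:R.
Proof.
have edgeB k : edge_step m k - edge_step (m%:Z - 1) k = - (residue k == m)%:R.
  rewrite -[X in - (_ == X)%:R](residue_ord n_gt1 m) -opprB; congr (- _).
  have -> : edge_step (m%:Z - 1) k = edge_step 0 (k - m%:Z + 1).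
    by rewrite /edge_step; congr (_ %/ _)%Z%:~R; ring.
  have -> : edge_step m k = edge_step 0 (k - m%:Z).
    by rewrite /edge_step; congr (_ %/ _)%Z%:~R; ring.
  rewrite /edge_step -rmorphB /=.
  have -> : k - m%:Z + 1 - 0 - 1 = k - m%:Z by ring.
  have -> : k - m%:Z - 0 - 1 = k - m%:Z - 1 by ring.
  rewrite divz_pred; have -> : (residue (k - m%:Z) == residue 0) = (residue k == residue m%:Z).
    by apply/residueP/residueP => -[q h]; exists q; lia.
  by case: (_ == _).
have -> : sigma R m = functional (edge_step m) - functional (edge_step (m%:Z - 1)).
  rewrite /sigma !rhoE; congr (_ - _); rewrite -[m in ord_pred m](residue_ord n_gt1).
  rewrite residue_pred; apply: VdualP => b.
  rewrite !(value_functional _ (edge_step_quasi_periodic _)).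
  set r := residue (m%:Z - 1).
  have [q ->] : exists q, m%:Z - 1 = r%:Z + q * n%:Z.
    by apply/residueP; rewrite residue_ord.
  rewrite !edge_stepDn; lra.
rewrite valueD valueN !(value_functional _ (edge_step_quasi_periodic _)).
have := edgeB a; have := edgeB 0; lra.
Qed.

End Functionals.

(** * Translations and the action of periodic permutations *)

Section Translations.
Local Open Scope ring_scope.
Variables (R : realType) (n : nat).
Hypothesis n_gt1 : (1 < n)%N.
Local Notation residue := (residue n_gt1).
Local Notation residue_perm := (residue_perm n_gt1).
Local Notation Vdual := (Vdual R n).
Local Notation dvec := (dvec R n).
Local Notation value := (@value R n).
Implicit Types (f g : 'I_n -> R) (x y : Vdual) (a b : int) (u v p : perZ n).

Definition sigma_comb f : Vdual := \sum_i f i *: sigma R i.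

Lemma value_sigma_comb f a :
  value (sigma_comb f) a = f (residue 0) - f (residue a).
Proof.
rewrite /sigma_comb value_sum.
under eq_bigr => i _ do rewrite valueZ (value_sigma R n_gt1) mulrBr.
rewrite sumrB; congr (_ - _).
  rewrite (bigD1 (residue 0)) //= eqxx mulr1 big1 ?addr0 // => i.
  by rewrite eq_sym => /negPf->; rewrite mulr0.
rewrite (bigD1 (residue a)) //= eqxx mulr1 big1 ?addr0 // => i.
by rewrite eq_sym => /negPf->; rewrite mulr0.
Qed.

(** The only linear relation among the sigma_i is that their sum vanishes, so coefficients count up
    to a common constant [C]. *)
Lemma sigma_combP f g : sigma_comb f = sigma_comb g <->
  exists C, forall i, f i = g i + C.
Proof.
split=> [e|[C h]]; last first.
  by apply: VdualP => a; rewrite !value_sigma_comb !h; ring.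
exists (f (residue 0) - g (residue 0)) => i.
have := congr1 (value^~ i%:Z) e; rewrite /= !value_sigma_comb residue_ord; lra.
Qed.

Lemma sigma_combD f g :
  sigma_comb (fun i => f i + g i) = sigma_comb f + sigma_comb g.
Proof. by rewrite -big_split; apply: eq_bigr => i _; rewrite scalerDl. Qed.

Lemma sigma_combZ k f : sigma_comb (fun i => k * f i) = k *: sigma_comb f.
Proof. by rewrite scaler_sumr; apply: eq_bigr => i _; rewrite scalerA. Qed.

Lemma deltavalD x y : deltaval (x + y) = deltaval x + deltaval y.
Proof. by rewrite /deltaval add_lfunE. Qed.

Lemma deltavalZ k x : deltaval (k *: x) = k * deltaval x.
Proof. by rewrite /deltaval scale_lfunE. Qed.

Lemma deltaval_sigma_comb f : deltaval (sigma_comb f) = 0.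
Proof.
rewrite (deltavalE n_gt1) value_sigma_comb.
have -> : n%:Z = 0 + 1 * n%:Z by rewrite mul1r add0r.
by rewrite residueDn subrr.
Qed.

Definition translate f x : Vdual := x + deltaval x *: sigma_comb f.

Lemma translateK f : cancel (translate f) (translate (fun i => - f i)).
Proof.
move=> x; rewrite /translate deltavalD deltavalZ deltaval_sigma_comb mulr0 addr0.
rewrite -addrA -scalerDr -sigma_combD (_ : sigma_comb _ = 0) ?scaler0 ?addr0 //.
by rewrite /sigma_comb big1 // => i _; rewrite subrr scale0r.
Qed.

Lemma translateNK f : cancel (translate (fun i => - f i)) (translate f).
Proof.
move=> x; rewrite /translate deltavalD deltavalZ deltaval_sigma_comb mulr0 addr0.
rewrite -addrA -scalerDr -sigma_combD (_ : sigma_comb _ = 0) ?scaler0 ?addr0 //.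
by rewrite /sigma_comb big1 // => i _; rewrite addNr scale0r.
Qed.

Definition translation f : selfbij Vdual := SelfBij (translateK f) (translateNK f).

Lemma translationD f g :
  translation (fun i => f i + g i) = (translation f * translation g)%g.
Proof.
apply: selfbijP => x /=; rewrite /translate sigma_combD.
by rewrite deltavalD deltavalZ deltaval_sigma_comb mulr0 addr0 scalerDr addrA addrAC.
Qed.

Lemma translation_eq f g : translation f = translation g <->
  exists C, forall i, f i = g i + C.
Proof.
rewrite -sigma_combP; split=> [e|e]; last first.
  by apply: selfbijP => x /=; rewrite /translate e.
have := congr1 (fun h : selfbij Vdual => h (rho R (residue 0))) e.
by rewrite /= /translate (deltaval_rho R n_gt1) !scale1r => /addrI.
Qed.

Lemma translation0 f : (forall i, f i = 0) -> translation f = 1%g.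
Proof.
move=> f0; apply: selfbijP => x /=; rewrite /translate /sigma_comb.
by rewrite big1 ?scaler0 ?addr0 // => i _; rewrite f0 scale0r.
Qed.

Lemma translationV f : (translation f)^-1%g = translation (fun i => - f i).
Proof.
apply: (mulgI (translation f)); rewrite mulgV -translationD translation0 // => i.
by rewrite subrr.
Qed.

Lemma geomM u v : geom R (u * v)%g = (geom R u * geom R v)%g.
Proof. by apply: selfbijP => x /=; rewrite actVdualM. Qed.

Lemma geom1 : geom R (1%g : perZ n) = 1%g.
Proof. by apply: selfbijP => x /=; rewrite actVdual1. Qed.

Lemma geomV u : geom R u^-1%g = (geom R u)^-1%g.
Proof. by apply: (mulgI (geom R u)); rewrite -geomM !mulgV geom1. Qed.

Lemma geom_prod (s : seq (perZ n)) :
  geom R (\prod_(t <- s) t)%g = (\prod_(t <- s) geom R t)%g.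
Proof.
by elim: s => [|t s IH]; rewrite ?big_nil ?geom1 // !big_cons geomM IH.
Qed.

Lemma value_geom u x a :
  value (geom R u x) a = value x (u^-1%g a) - value x (u^-1%g 0).
Proof.
rewrite -valueB {1}/value /= /actVdual comp_lfunE; congr (x _).
apply: val_inj; have n_gt0 := ltnW n_gt1.
rewrite -[LHS]/(vsval (actV R u^-1%g (inV _))) actVE /= !vsprojK ?evecB_V // mulmxBl.
by rewrite !act_mx_evec.
Qed.

Lemma deltaval_geom u x : deltaval (geom R u x) = deltaval x.
Proof.
rewrite (deltavalE n_gt1) value_geom.
have -> : n%:Z = 0 + 1 * n%:Z by rewrite mul1r add0r.
by rewrite perZDq (value_quasi_periodic n_gt1) mul1r addrC addKr.
Qed.

(** The action permutes the sigma_i through [residue_perm u], so conjugation permutes the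
    coefficients of a translation. *)
Lemma geom_translation u f :
  (geom R u * translation f =
   translation (fun i => f (residue_perm u^-1 i)%g) * geom R u)%g.
Proof.
apply: selfbijP => x; apply: VdualP => a /=.
rewrite -[actVdual u (translate f x)]/(geom R u _) -[actVdual u x]/(geom R u x).
rewrite value_geom /translate deltaval_geom !valueD !valueZ value_geom.
by rewrite !value_sigma_comb !residue_permE; ring.
Qed.

(** Here [u i = i + m_i * n], and [u] acts as the translation by the sum of the [m_i] times sigma_i;
    the loop at [i] acts by sigma_i. *)
Lemma geom_residue_perm1 u : residue_perm u = 1%g ->
  geom R u = translation (fun i => (u i%:Z - i%:Z)%:~R / n%:R).
Proof.
move=> u1; apply: selfbijP => x; apply: VdualP => a /=.
rewrite -[actVdual u x]/(geom R u x) value_geom valueD valueZ value_sigma_comb.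
rewrite !displacement_residue.
have nz : n%:R != 0 :> R by rewrite pnatr_eq0 -lt0n ltnW.
have ua b : value x (u^-1%g b) = value x b - (u b - b)%:~R / n%:R * deltaval x.
  have [q e] : exists q, u b = b + q * n%:Z.
    by apply/residueP; rewrite -residue_permE u1 perm1.
  have {1}-> : u^-1%g b = b + (- q) * n%:Z.
    apply: (can_inj (sbfunK u)); rewrite perZDq e -[LHS]/((u * u^-1)%g b) mulgV /=.
    by ring.
  rewrite (value_quasi_periodic n_gt1) e (_ : b + _ - b = q * n%:Z); last by ring.
  by rewrite rmorphN rmorphM /= -pmulrn mulfK // mulNr.
rewrite !ua; have -> : value x 0 = 0 by rewrite /value subrr /inV !linear0.
ring.
Qed.

(** The linear extension of a translation is trivial where [deltaval] is 0, and there the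
    permutation modulo [n] can be read off the action on the sigma_i. *)
Lemma geom_translation_residue_perm u v f :
  geom R u = (geom R v * translation f)%g -> residue_perm u = residue_perm v.
Proof.
move=> e; apply: invg_inj; rewrite -!residue_permV.
apply/permP => i; apply/eqP; apply: contraT => ne.
pose g j : R := (j == residue_perm u^-1%g i)%:R.
have E j : g (residue_perm u^-1%g j) - g (residue_perm v^-1%g j) =
    g (residue_perm u^-1%g (residue 0)) - g (residue_perm v^-1%g (residue 0)).
  have := congr1 (fun h : selfbij Vdual => value (h (sigma_comb g)) j%:Z) e.
  rewrite /= value_geom.
  rewrite -[actVdual v _]/(geom R v (translate f (sigma_comb g))).
  rewrite /translate deltaval_sigma_comb scale0r addr0 value_geom.
  by rewrite !value_sigma_comb -!residue_permE residue_ord; lra.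
(* The functions agree only up to a constant, so two indices are compared: their difference is 1 at
   [i], but at most 0 at [i + 1]. *)
have ij : residue (i%:Z + 1) != i.
  by rewrite eq_sym -[X in X != _](residue_ord n_gt1 i) residueS.
have := E (residue (i%:Z + 1)); rewrite -(E i) /g eqxx.
rewrite (inj_eq perm_inj) (negPf ij) [_ == residue_perm u^-1%g i]eq_sym.
rewrite [residue_perm v^-1%g i == _]eq_sym (negPf ne).
by case: (_ == _); rewrite /= ?mulr1n ?mulr0n; lra.
Qed.

Variable w : seq 'I_n.
Hypothesis w_coxeter : coxeter_word w.
Local Notation time := (time n_gt1 w).

Let sign i : R := if i \in outer w then 1 else -1.

Lemma KformB (x y z : 'rV[R]_n.+1) : Kform x (y - z) = Kform x y - Kform x z.
Proof.
rewrite /Kform -sumrB; apply: eq_bigr => a _; rewrite -sumrB.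
by apply: eq_bigr => b _; rewrite !mxE mulrBr.
Qed.

Lemma residue_periodic (k : int) :
  quasi_periodic n (fun l => (residue k == residue l)%:R : R) 0.
Proof. by move=> l q; rewrite residueDn mulr0 addr0. Qed.

Lemma Kform_evec (x : 'rV[R]_n.+1) (k : int) :
  Kform x (evec R n k) = coord_sum (fun l => (residue k == residue l)%:R) x.
Proof.
rewrite /Kform /coord_sum; apply: eq_bigr => a _; rewrite -mulr_sumr; congr (_ * _).
have qa : quasi_periodic n (fun l => (residue (a%:Z + 1) == residue l)%:R : R) 0.
  exact: residue_periodic.
rewrite eq_sym -(coord_sum_evec n_gt1 k qa) /coord_sum.
rewrite [LHS]big_mkcond; apply: eq_bigr => b _.
have -> : (residue (a%:Z + 1) == residue (b%:Z + 1)) = (a == b %[mod n]).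
  by rewrite residue_eq eqz_modDr !modz_nat eqz_nat.
by case: ifP => _; rewrite ?mulr1 ?mulr0.
Qed.

(** For [n = 2] the two neighbours of an index coincide, and the last two terms add up to -2. *)
Lemma cartanE (i j : 'I_n) : cartan R i j = (i == j)%:R *+ 2
  - (residue (i%:Z + 1) == j)%:R - (i == residue (j%:Z + 1))%:R.
Proof.
rewrite /cartan /alpha KformB !Kform_evec !linearB /=.
rewrite !(coord_sum_evec n_gt1 _ (residue_periodic _)) !residue_ord.
have -> : (residue (j%:Z + 1) == residue (i%:Z + 1)) = (i == j).
  by rewrite residue_eq eqz_modDr -(residue_eq n_gt1) !residue_ord eq_sym.
rewrite [j == i]eq_sym [j == residue _]eq_sym [residue (j%:Z + 1) == i]eq_sym; ring.
Qed.

(** As [delta] is the sum of the simple roots, this is [omega_c(delta, alpha_j)]. Only the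
    neighbours of [j] contribute, each with a sign given by its order relative to [s_j] in the word;
    these signs tell whether [j] and [j + 1] are outer. *)
Lemma omega_coef_sum (j : 'I_n) :
  \sum_i omega_coef R w i j = sign j - sign (residue (j%:Z + 1)).
Proof.
have jS : residue (j%:Z + 1) != j.
  by rewrite eq_sym -[X in X != _](residue_ord n_gt1 j) residueS.
have jP : residue (j%:Z - 1) != j.
  by have := residueS n_gt1 (j%:Z - 1); rewrite subrK residue_ord.
pose s i : R := if precedes w j i then 1 else -1.
have E i : omega_coef R w i j =
    - ((i == residue (j%:Z - 1))%:R * s i + (i == residue (j%:Z + 1))%:R * s i).
  rewrite /omega_coef cartanE.
  have -> : (residue (i%:Z + 1) == j) = (i == residue (j%:Z - 1)).
    rewrite -[X in _ == X](residue_ord n_gt1 j) -[X in X == residue (j%:Z - 1)](residue_ord n_gt1 i).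
    by apply/residueP/residueP => -[q h]; exists q; lia.
  have [->|ij] := eqVneq i j; last by rewrite /s mulr0n; case: ifP => _; ring.
  by rewrite ![j == residue _]eq_sym (negPf jS) (negPf jP) !mul0r addr0 oppr0.
under eq_bigr do rewrite E.
rewrite sumrN big_split /=.
have D k : \sum_(i < n) (i == residue k)%:R * s i = s (residue k).
  rewrite (bigD1 (residue k)) //= eqxx mul1r big1 ?addr0 // => i /negPf->.
  by rewrite mul0r.
rewrite !D.
have outj : (j \in outer w) = ~~ precedes w j (residue (j%:Z - 1)).
  have := time_neq n_gt1 w_coxeter j%:Z.
  rewrite -[X in X \in _](residue_ord n_gt1 j) outerE /time /precedes residue_ord.
  by rewrite -leqNgt [RHS]leq_eqVlt eq_sym => /negPf->.
have outS : (residue (j%:Z + 1) \in outer w) = precedes w j (residue (j%:Z + 1)).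
  by rewrite outerE /time addrK residue_ord.
rewrite /sign outj outS /s; case: (precedes _ _ _); case: (precedes _ _ _) => /=; ring.
Qed.

(** Summation by parts around the cycle turns the coefficients of the [rho j] into those of the
    [sigma j], without boundary terms. *)
Lemma omega_delta : omega w (inV dvec) = sigma_comb sign.
Proof.
rewrite /omega exchange_big /= /sigma_comb.
rewrite (eq_bigr (fun j => (sign j - sign (residue (j%:Z + 1))) *: rho R j)); last first.
  move=> j _; rewrite -omega_coef_sum scaler_suml; apply: eq_bigr => i _.
  by rewrite -[rho R i _]/(deltaval (rho R i)) (deltaval_rho R n_gt1) mul1r.
under [RHS]eq_bigr do rewrite /sigma scalerBr.
under eq_bigr do rewrite scalerBl.
rewrite !sumrB; congr (_ - _).
rewrite [RHS](reindex_inj (h := fun j : 'I_n => residue (j%:Z + 1))) /=.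
  apply: eq_bigr => j _; congr (_ *: rho R _).
  by rewrite residue_pred addrK residue_ord.
move=> i j /eqP/residueP[q h]; rewrite -(residue_ord n_gt1 i) -(residue_ord n_gt1 j).
by apply/eqP/residueP; exists q; lia.
Qed.
End Translations.

(** * From loops to translations *)

Section Weights.
Local Open Scope ring_scope.

Lemma exceptional_intro (R : realType) (a b : nat) (q : R) (s k : int) :
  b = 1%N -> s \in [:: 1; -1; 2; -2] -> s - 1 = a%:Z * k -> s%:~R * q = 1 ->
  exceptional a b q.
Proof.
by move=> b1 hs e hq; split=> //; exists s => //; split=> //; rewrite e dvdz_mulr.
Qed.

Lemma dvdn_factor (a : nat) (k z : int) : z = a%:Z * k -> (a %| absz z)%N.
Proof. by move->; rewrite abszM /= dvdn_mulr. Qed.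

(** In the application, [a] and [b] count the outer and inner points, and [x], [y] are the
    displacements of a word on them in units of [n]. When [x] or [y] is 0, divisibility leaves a
    single point on that circle, and the weight is exceptional. Otherwise both are 1 or -1. *)
Lemma weight_cases (R : realType) (a b : nat) (qout qinn : R) (x y k l : int) :
  ~ exceptional a b qout -> ~ exceptional b a qinn ->
  `|x| + `|y| <= 2 -> x - 1 = a%:Z * k -> y + 1 = b%:Z * l ->
  (x + y)%:~R * qinn = (x - 1)%:~R -> (x + y)%:~R * qout = (y + 1)%:~R ->
  [\/ x = 1 /\ y = -1, [/\ x = 1, y = 1, b = 2%N & qinn = 0] |
      [/\ x = -1, y = -1, a = 2%N & qout = 0]].
Proof.
move=> hout hinn xy ak bl ein eout.
have [y0|y0] := eqVneq y 0.
  have b1 : b = 1%N by have := dvdn_factor bl; rewrite y0 dvdn1 => /eqP.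
  case: hout; apply: (@exceptional_intro _ _ _ _ x k) => //.
    have : x != 0.
      apply/eqP => x0; move: eout; rewrite x0 y0 mul0r => /esym/eqP.
      by rewrite oner_eq0.
    by rewrite !inE; lia.
  by move: eout; rewrite y0 addr0 add0r.
have [x0|x0] := eqVneq x 0.
  have a1 : a = 1%N by have := dvdn_factor ak; rewrite x0 dvdn1 => /eqP.
  case: hinn; apply: (@exceptional_intro _ _ _ _ (- y) (- l)) => //.
  - by rewrite !inE; lia.
  - by rewrite mulrN -bl; ring.
  - move: ein; rewrite x0 !add0r => e.
    by rewrite [(- y)%:~R]rmorphN mulNr e rmorphN opprK.
have [[ex ey]|[[ex ey]|[[ex ey]|[ex ey]]]] :
  (x = 1 /\ y = -1) \/ (x = 1 /\ y = 1) \/ (x = -1 /\ y = -1) \/ (x = -1 /\ y = 1) by lia.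
- by constructor 1.
- have q0 : qinn = 0.
    by move/eqP: ein; rewrite ex ey subrr mulf_eq0 intr_eq0 /= => /eqP.
  have q1 : qout = 1.
    have nz : (1 + 1 : int)%:~R != 0 :> R by rewrite intr_eq0.
    by apply: (mulfI nz); move: eout; rewrite ex ey mulr1.
  constructor 2; split=> //; have [b1|b2] : b = 1%N \/ b = 2%N.
    by have := dvdn_factor bl; rewrite ey dvdn_divisors // !inE => /pred2P.
    case: hout; apply: (@exceptional_intro _ _ _ _ 1 0) => //; first by rewrite mulr0.
    by rewrite mul1r.
  done.
- have q0 : qout = 0.
    by move/eqP: eout; rewrite ex ey addNr mulf_eq0 intr_eq0 /= => /eqP.
  have q1 : qinn = 1.
    have nz : (-1 + -1 : int)%:~R != 0 :> R by rewrite intr_eq0.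
    by apply: (mulfI nz); move: ein; rewrite ex ey mulr1.
  constructor 3; split=> //; have [b1|b2] : a = 1%N \/ a = 2%N.
    by have := dvdn_factor ak; rewrite ex dvdn_divisors // !inE => /pred2P.
    case: hinn; apply: (@exceptional_intro _ _ _ _ 1 0) => //; first by rewrite mulr0.
    by rewrite mul1r.
  done.
- move/eqP: ein; rewrite ex ey addNr mul0r eq_sym intr_eq0 //.
Qed.
End Weights.

(** * The matching as a twisted action *)

Section TwistedGeom.
Local Open Scope ring_scope.
Variables (R : realType) (n : nat).
Hypothesis n_gt1 : (1 < n)%N.
Local Notation residue := (residue n_gt1).
Local Notation residue_perm := (residue_perm n_gt1).
Local Notation respects := (respects n_gt1).
Variable w : seq 'I_n.
Hypothesis w_coxeter : coxeter_word w.
Variables qout qinn : R.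
Hypothesis q_sum : qout + qinn = 1.
Local Notation c := (coxeter w).
Local Notation out := (outer w).
Local Notation inn := (inner w).
Implicit Types (u v t p : perZ n) (s : seq (perZ n)).

Let n_neq0 : n%:R != 0 :> R. Proof. by rewrite pnatr_eq0 -lt0n ltnW. Qed.
Let out_neq0 : #|out|%:R != 0 :> R.
Proof. by rewrite pnatr_eq0 -lt0n outer_gt0. Qed.
Let inn_neq0 : #|inn|%:R != 0 :> R.
Proof. by rewrite pnatr_eq0 -lt0n inner_gt0. Qed.

Definition point_weight (i : 'I_n) : R :=
  if i \in out then qinn / #|out|%:R else qout / #|inn|%:R.

(** The number of loops minus the number of inverse loops in any factorization of [u] into
    reflections and loops. *)
Definition winding u : R := (displacement [set: 'I_n]%SET u)%:~R / n%:R.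

(* Every loop is sent to a translation of E, but this is not a homomorphism:
   the factor by which it fails to be one cancels on words of total winding 0
   whose letters preserve the outer points. *)
Definition twisted_geom u : selfbij (Vdual R n) :=
  (geom R u * translation n_gt1 (fun i => - (winding u * point_weight i)))%g.

Lemma sum_weight_outer : \sum_(i in out) point_weight i = qinn.
Proof.
rewrite (eq_bigr (fun=> qinn / #|out|%:R)) => [|i iout]; last by rewrite /point_weight iout.
by rewrite sumr_const -[LHS]mulr_natr divfK.
Qed.

Lemma sum_weight_inner : \sum_(i in inn) point_weight i = qout.
Proof.
rewrite (eq_bigr (fun=> qout / #|inn|%:R)) => [|i]; last first.
  by rewrite inner_outer /point_weight => /negPf->.
by rewrite sumr_const -[LHS]mulr_natr divfK.
Qed.

Lemma sum_outer_inner (F : 'I_n -> R) :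
  \sum_i F i = \sum_(i in out) F i + \sum_(i in inn) F i.
Proof.
rewrite (bigID (mem out)) /=; congr (_ + _); apply: eq_bigl => i.
by rewrite inner_outer.
Qed.

Lemma windingM u v : winding (u * v)%g = winding u + winding v.
Proof.
by rewrite /winding (displacementM _ (respectsT n_gt1 v)) rmorphD /= mulrDl.
Qed.

Lemma windingV u : winding u^-1%g = - winding u.
Proof. by rewrite /winding (displacementV (respectsT n_gt1 u)) rmorphN mulNr. Qed.

Lemma winding_coxeter : winding c = 0.
Proof. by rewrite /winding displacement_coxeterT // mul0r. Qed.

Lemma winding_loop k : winding (loop n k) = 1.
Proof. by rewrite /winding (displacement_loop n_gt1) inE mul1r -pmulrn divff. Qed.

Lemma winding_reflection t : reflections t -> winding t = 0.
Proof.
move=> ht; rewrite /winding (displacement_reflection (n_gt1 := n_gt1) ht) ?mul0r //.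
exact: respectsT.
Qed.

Lemma twisted_geom_winding0 u : winding u = 0 -> twisted_geom u = geom R u.
Proof.
by move=> h; rewrite /twisted_geom translation0 ?mulg1 // => i; rewrite h mul0r oppr0.
Qed.

Lemma twisted_geom_loop k : twisted_geom (loop n k) =
  translation n_gt1 (fun i => (i == residue k)%:R - point_weight i).
Proof.
rewrite /twisted_geom winding_loop (geom_residue_perm1 _ (residue_perm_loop n_gt1 k)).
rewrite -translationD; apply/translation_eq; exists 0 => i.
rewrite loopE residue_ord [i%:Z + _]addrC addrK rmorphM /= -!pmulrn mulfK //.
by rewrite addr0 mul1r.
Qed.

Lemma twisted_geom_loopV k : twisted_geom (loop n k)^-1%g =
  translation n_gt1 (fun i => point_weight i - (i == residue k)%:R).
Proof.
rewrite /twisted_geom windingV winding_loop.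
rewrite (geom_residue_perm1 _ (residue_perm_loopV n_gt1 k)).
rewrite -translationD; apply/translation_eq; exists 0 => i.
rewrite loopVE residue_ord [i%:Z - _]addrC addrK rmorphN rmorphM /= -!pmulrn.
by rewrite mulNr mulfK //; ring.
Qed.

Lemma twisted_geomV k : (twisted_geom (loop n k))^-1%g = twisted_geom (loop n k)^-1%g.
Proof.
rewrite twisted_geom_loop twisted_geom_loopV translationV.
by apply/translation_eq; exists 0 => i; rewrite opprB addr0.
Qed.

Lemma translation_geom u (f : 'I_n -> R) :
  (translation n_gt1 f * geom R u =
   geom R u * translation n_gt1 (fun i => f (residue_perm u i)))%g.
Proof.
rewrite geom_translation; congr (_ * _)%g; apply/translation_eq; exists 0 => i.
by rewrite residue_permV permKV addr0.
Qed.

Lemma prod_twisted_geom_translation s : exists f,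
  (\prod_(g <- map twisted_geom s) g = geom R (\prod_(t <- s) t) * translation n_gt1 f)%g.
Proof.
elim: s => [|t s [f IH]] /=.
  by exists (fun=> 0); rewrite !big_nil geom1 translation0 // mulg1.
rewrite !big_cons IH /twisted_geom -mulgA [(translation _ _ * _)%g]mulgA.
rewrite translation_geom -!mulgA -translationD mulgA -geomM.
by eexists.
Qed.

Lemma prod_twisted_geom s : (forall t, t \in s -> respects out t) ->
  (\prod_(g <- map twisted_geom s) g = twisted_geom (\prod_(t <- s) t))%g.
Proof.
elim: s => [|t s IH] hs /=.
  rewrite !big_nil twisted_geom_winding0 ?geom1 //.
  by rewrite /winding displacement1 mul0r.
have hs' t' : t' \in s -> respects out t' by move=> t's; apply: hs; rewrite inE t's orbT.
rewrite !big_cons IH // /twisted_geom -mulgA [(translation _ _ * _)%g]mulgA.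
rewrite translation_geom -!mulgA -translationD mulgA -geomM; congr (_ * _)%g.
apply/translation_eq; exists 0 => i; rewrite windingM /point_weight (respects_prod hs').
by move: (if _ then _ else _) => W; rewrite addr0; ring.
Qed.

Lemma prod_twisted_geom_reflections s : (forall t, t \in s -> reflections t) ->
  (\prod_(g <- map twisted_geom s) g = twisted_geom (\prod_(t <- s) t))%g.
Proof.
move=> hs; rewrite twisted_geom_winding0; last first.
  elim: s hs => [|t s IH] hs; first by rewrite big_nil /winding displacement1 mul0r.
  rewrite big_cons windingM IH ?addr0 => [|t' t's].
    by rewrite winding_reflection //; apply/hs/mem_head.
  by apply: hs; rewrite inE t's orbT.
rewrite geom_prod big_map; apply: eq_big_seq => t /hs ht.
by rewrite twisted_geom_winding0 // winding_reflection.
Qed.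

(** Equal images mean that [v^-1 * u] acts as the translation by m times the difference of the
    windings. *)
Lemma twisted_geom_eq u v : twisted_geom u = twisted_geom v ->
  residue_perm u = residue_perm v /\ forall i : 'I_n,
  ((v^-1 * u)%g i%:Z - i%:Z)%:~R = n%:R * ((winding u - winding v) * point_weight i) :> R.
Proof.
move=> e; pose z := (v^-1 * u)%g.
have ez : geom R z = translation n_gt1 (fun i => (winding u - winding v) * point_weight i).
  rewrite geomM geomV.
  apply: (mulgI (geom R v)); rewrite mulVKg.
  apply: (mulIg (translation n_gt1 (fun i => - (winding u * point_weight i)))).
  rewrite -/(twisted_geom u) e -mulgA -translationD; congr (_ * _)%g.
  by apply/translation_eq; exists 0 => i; ring.
have z1 : residue_perm z = 1%g.
  rewrite -(residue_perm1 n_gt1).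
  apply: (@geom_translation_residue_perm R n n_gt1 z 1%g (fun i => (winding u - winding v) * point_weight i)).
  by rewrite geom1 mul1g.
split.
  have -> : u = (v * z)%g by rewrite mulVKg.
  by rewrite (residue_permM n_gt1) z1 mul1g.
move: ez; rewrite (geom_residue_perm1 R z1) => /translation_eq[C hC].
(* Summing over all points fixes the constant: the weights add up to [qout + qinn = 1], and
   [winding z] is the difference of the windings. *)
have sC : winding z = (winding u - winding v) + C * n%:R.
  rewrite {1}/winding /displacement rmorph_sum /= mulr_suml.
  rewrite (eq_bigl predT); last by move=> i; rewrite inE.
  rewrite (eq_bigr _ (fun i _ => hC i)) big_split /= -mulr_sumr.
  rewrite sum_outer_inner sum_weight_outer sum_weight_inner addrC [qinn + _]addrC q_sum.
  by rewrite mulr1 sumr_const card_ord -[C *+ n]mulr_natr addrC.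
have C0 : C = 0.
  move: sC; rewrite windingM windingV addrC => /eqP.
  by rewrite -subr_eq0 opprD addNKr oppr_eq0 mulf_eq0 (negPf n_neq0) orbF => /eqP.
by move=> i; rewrite -[LHS](divfK n_neq0) hC C0 addr0 mulrC.
Qed.

Lemma twisted_geom_inj_winding u v : twisted_geom u = twisted_geom v ->
  winding u = winding v -> u = v.
Proof.
move=> /twisted_geom_eq[_ h] e.
have : (v^-1 * u)%g = 1%g.
  apply: (perZ_ordP n_gt1) => i; apply/eqP; rewrite -subr_eq0 -(intr_eq0 R).
  by rewrite h e subrr mul0r mulr0.
by move/(congr1 (mulg v)); rewrite mulVKg mulg1.
Qed.
End TwistedGeom.

(** * Lifting words in reflections and translations *)

Section TwistedWords.
Local Open Scope ring_scope.
Variables (R : realType) (n : nat).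
Hypothesis n_gt1 : (1 < n)%N.
Local Notation residue := (residue n_gt1).
Local Notation residue_perm := (residue_perm n_gt1).
Local Notation respects := (respects n_gt1).
Variable w : seq 'I_n.
Hypothesis w_coxeter : coxeter_word w.
Variables qout qinn : R.
Hypothesis q_sum : qout + qinn = 1.
Hypothesis not_exceptional_out : ~ exceptional #|outer w| #|inner w| qout.
Hypothesis not_exceptional_inn : ~ exceptional #|inner w| #|outer w| qinn.
Local Notation c := (coxeter w).
Local Notation out := (outer w).
Local Notation inn := (inner w).
Local Notation e := (twisted_geom n_gt1 w qout qinn).
Local Notation weight := (point_weight w qout qinn).
Local Notation winding := (winding R).
Implicit Types (u v t p : perZ n) (s : seq (perZ n)).

Let n_neq0 : n%:R != 0 :> R. Proof. by rewrite pnatr_eq0 -lt0n ltnW. Qed.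

Lemma twisted_geom_displacement u v : e u = e v ->
  (displacement out (v^-1 * u)%g)%:~R = n%:R * ((winding u - winding v) * qinn) /\
  (displacement inn (v^-1 * u)%g)%:~R = n%:R * ((winding u - winding v) * qout).
Proof.
move=> /(twisted_geom_eq w_coxeter q_sum)[_ h].
rewrite /displacement !rmorph_sum /= !(eq_bigr _ (fun i _ => h i)) -!mulr_sumr.
by rewrite sum_weight_outer // sum_weight_inner.
Qed.

(** Since [v^-1 * u] is trivial modulo [n], it moves every single point by a multiple of [n]; one
    outer and one inner point give the two integers. *)
Lemma twisted_geom_integral u v : e u = e v -> exists k l : int,
  (winding u - winding v) * qinn = (#|out|%:Z * k)%:~R /\
  (winding u - winding v) * qout = (#|inn|%:Z * l)%:~R.
Proof.
move=> /(twisted_geom_eq w_coxeter q_sum)[z1 h].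
have int i : exists k : int, (winding u - winding v) * weight i = k%:~R.
  have /residueP[k hk] : residue ((v^-1 * u)%g i%:Z) == residue i%:Z.
    by rewrite -residue_permE residue_permM residue_permV z1 mulgV perm1.
  exists k; apply: (mulfI n_neq0); rewrite -h hk [i%:Z + _]addrC addrK rmorphM /=.
  by rewrite -pmulrn mulrC.
have /card_gt0P[i iout] := outer_gt0 n_gt1 w_coxeter.
have /card_gt0P[j jinn] := inner_gt0 n_gt1 w_coxeter.
have [k hk] := int i; have [l hl] := int j; exists k, l.
move: hk hl; rewrite /point_weight iout.
move: (jinn); rewrite inner_outer => /negPf->.
have an : #|out|%:R != 0 :> R by rewrite pnatr_eq0 -lt0n outer_gt0.
have bn : #|inn|%:R != 0 :> R by rewrite pnatr_eq0 -lt0n inner_gt0.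
by rewrite !mulrA !rmorphM /= -!pmulrn => <- <-; rewrite ![#|_|%:R * _]mulrC !divfK.
Qed.

(** Reflections differ from loops modulo [n], and letters of the same kind have equal winding, where
    the matching is injective. An outer loop and an inverse inner loop can share an image only if
    [2 * qout = 2 * qinn = 1]; integrality then gives one point on each circle, an exceptional
    weight with [s = 2]. *)
Lemma twisted_geom_label_inj t t' : noncrossing_label w t -> noncrossing_label w t' ->
  e t = e t' -> t = t'.
Proof.
have opposite i j : i \in out -> j \in inn ->
    e (loop n i%:Z) <> e (loop n j%:Z)^-1%g.
  move=> iout jinn E; have [d1 d2] := twisted_geom_displacement E.
  have [k [l]] := twisted_geom_integral E.
  move: d1 d2; rewrite (windingV R n_gt1) !(winding_loop R n_gt1) invgK opprK.
  have rl k' A : respects A (loop n k') by apply/respects1/residue_perm_loop.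
  rewrite !(displacementM _ (rl _ _)) !(displacement_loop n_gt1) !residue_ord.
  have jout : (j \in out) = false by apply/negbTE; rewrite -inner_outer.
  have iinn : (i \in inn) = false by rewrite inner_outer iout.
  rewrite iout jinn jout iinn !mul0r !mul1r addr0 add0r -pmulrn => d1 d2 [hk hl].
  have e1 : (1 + 1) * qinn = 1 by apply: (mulfI n_neq0); rewrite -d1 mulr1.
  have e2 : (1 + 1) * qout = 1 by apply: (mulfI n_neq0); rewrite -d2 mulr1.
  have ak : #|out|%:Z * k = 1 by apply/eqP; rewrite -(eqr_int R) -hk e1.
  have bl : #|inn|%:Z * l = 1 by apply/eqP; rewrite -(eqr_int R) -hl e2.
  apply: not_exceptional_out; apply: (@exceptional_intro _ _ _ _ 2 k) => //.
    by have := dvdn_factor (esym bl); rewrite dvdn1 => /eqP.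
have refl_loop t1 t2 : reflections t1 -> residue_perm t2 = 1%g -> e t1 <> e t2.
  move=> h1 h2 /(twisted_geom_eq w_coxeter q_sum)[]; rewrite h2 => h _.
  by move: (residue_perm_reflection n_gt1 h1); rewrite h eqxx.
have same := twisted_geom_inj_winding w_coxeter q_sum.
have pl := residue_perm_loop n_gt1; have plV := residue_perm_loopV n_gt1.
have wl := winding_loop R n_gt1.
case=> [h|[[i hi ->]|[i hi ->]]]; case=> [h'|[[j hj ->]|[j hj ->]]] E.
- by apply: same => //; rewrite !winding_reflection.
- by case: (refl_loop _ _ h (pl _) E).
- by case: (refl_loop _ _ h (plV _) E).
- by case: (refl_loop _ _ h' (pl _) (esym E)).
- by apply: same => //; rewrite !wl.
- by case: (opposite _ _ hi hj E).
- by case: (refl_loop _ _ h' (plV _) (esym E)).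
- by case: (opposite _ _ hj hi (esym E)).
- by apply: same => //; rewrite !(windingV R n_gt1) !wl.
Qed.

(* If A = {j, j'} carries weight 1/2 at both of its points, then the loop at j
   and the inverse of the loop at j' have the same image. *)
Lemma flip_letter (A : {set 'I_n}) t : #|A| = 2%N ->
  (forall i, weight i *+ 2 = (i \in A)%:R) -> TL t -> respects A t ->
  exists t', [/\ TL t', e t' = e t, residue_perm t' = residue_perm t &
    displacement [set: 'I_n]%SET t' = displacement (~: A)%SET t - displacement A t].
Proof.
move=> A2 hA ht rA.
have other k : k \in A -> exists2 k', k' \in A &
    forall i, (i == k)%:R + (i == k')%:R = weight i *+ 2 :> R.
  have [j [j' [jj' eA]]] : exists j j', j != j' /\ A = [set j; j']%SET.
    by apply/cards2P; rewrite A2.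
  rewrite eA; have W i : (i == j)%:R + (i == j')%:R = weight i *+ 2 :> R.
    rewrite hA eA !inE; have [->|_] := eqVneq i j; first by rewrite (negPf jj') addr0.
    by rewrite add0r.
  rewrite !inE => /pred2P[->|->]; [exists j'|exists j]; rewrite ?inE ?eqxx ?orbT // => i.
  by rewrite addrC.
have [t1|nt1] := eqVneq (residue_perm t) 1%g; last first.
  exists t; split=> //; have hr := TL_reflection ht nt1.
  rewrite !(displacement_reflection (n_gt1 := n_gt1) hr) ?subrr //.
  - exact: respectsC.
  - exact: respectsT.
have tl k : TL (loop n k) by right; exists k; left.
have tlV k : TL (loop n k)^-1%g by right; exists k; right.
have [k [et|et]] := TL_loop ht t1; rewrite et.
  have [kA|kA] := boolP (residue k \in A).
    have [k' k'A hk'] := other _ kA; exists (loop n k'%:Z)^-1%g; split=> //.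
    - rewrite twisted_geom_loop twisted_geom_loopV; apply/translation_eq; exists 0 => i.
      by rewrite residue_ord; have := hk' i; rewrite mulr2n; lra.
    - by rewrite residue_perm_loop residue_perm_loopV.
    - by rewrite (displacement_loopV n_gt1) !(displacement_loop n_gt1) !inE kA mul0r mul1r sub0r.
  exists (loop n k); split=> //.
  by rewrite !(displacement_loop n_gt1) !inE (negPf kA) mul0r subr0.
have [kA|kA] := boolP (residue k \in A).
  have [k' k'A hk'] := other _ kA; exists (loop n k'%:Z); split=> //.
  - rewrite twisted_geom_loop twisted_geom_loopV; apply/translation_eq; exists 0 => i.
    by rewrite residue_ord; have := hk' i; rewrite mulr2n; lra.
  - by rewrite residue_perm_loop residue_perm_loopV.
  - by rewrite !(displacement_loopV n_gt1) (displacement_loop n_gt1) !inE kA mul0r mul1r oppr0 sub0r opprK.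
exists (loop n k)^-1%g; split=> //.
by rewrite !(displacement_loopV n_gt1) !inE (negPf kA) mul0r oppr0 subr0.
Qed.

(** Flipping all loops at points of [A] keeps the images and reverses the displacement on [A]. A
    word with equal displacements on [A] and on its complement thus gets winding 0, the winding of
    [c]. *)
Lemma flip_word (A : {set 'I_n}) s : #|A| = 2%N ->
  (forall i, weight i *+ 2 = (i \in A)%:R) -> word_over (@TL n) s ->
  (forall t, t \in s -> respects A t) ->
  exists s', [/\ word_over (@TL n) s', map e s' = map e s,
    forall B, (forall t, t \in s -> respects B t) -> forall t, t \in s' -> respects B t &
    displacement [set: 'I_n]%SET (\prod_(t <- s') t)%g =
      displacement (~: A)%SET (\prod_(t <- s) t)%g - displacement A (\prod_(t <- s) t)%g].
Proof.
move=> A2 hA; elim: s => [|t s IH] hs rs.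
  by exists [::]; split=> //; rewrite !big_nil !displacement1 subrr.
have sub t' : t' \in s -> t' \in t :: s by move=> t's; rewrite inE t's orbT.
have [|t' /sub /rs //|s' [h1 h2 h3 h4]] := IH; first by move=> t' /sub /hs.
have [t' [g1 g2 g3 g4]] := flip_letter A2 hA (hs t (mem_head _ _)) (rs t (mem_head _ _)).
exists (t' :: s'); split=> [t2|/=|B hB t2|].
- by rewrite inE => /predU1P[->|/h1].
- by rewrite g2 h2.
- rewrite inE => /predU1P[-> i|t2s]; first by rewrite g3 hB ?mem_head.
  by apply: (h3 B) => // t3 /sub /hB.
rewrite !big_cons (displacementM _ (respectsT n_gt1 _)) h4 g4.
have rs' : respects A (\prod_(t0 <- s) t0)%g by apply: respects_prod => t0 /sub /rs.
by rewrite !(displacementM _ rs') (displacementM _ (respectsC rs')); ring.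
Qed.

(** The images determine the product modulo [n]. Words in reflections alone have winding 0 and the
    product [c]. Otherwise [weight_cases] gives the displacements, and in its two spurious cases
    letters are replaced by others with the same image. *)
Lemma twisted_word s : word_over (@TL n) s -> (size s <= n)%N ->
  (\prod_(g <- map e s) g)%g = geom R c ->
  exists s', [/\ word_over (@TL n) s', map e s' = map e s & (\prod_(t <- s') t)%g = c].
Proof.
move=> hs sn ec; have wc := winding_coxeter R n_gt1 w.
have ecE : e c = geom R c by rewrite twisted_geom_winding0.
have [f] := prod_twisted_geom_translation n_gt1 w qout qinn s; rewrite ec.
move=> /geom_translation_residue_perm /esym hperm.
have := TL_word_structure w_coxeter hs sn hperm.
set r := count _ s => /= -[rn|[rn rs]].
  have hr t : t \in s -> reflections t.
    move=> t's; apply: (TL_reflection (hs t t's) (n_gt1 := n_gt1)).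
    have /allP -> // : all (fun t => residue_perm t != 1%g) s.
    by rewrite all_count eqn_leq count_size /= -/r rn.
  exists s; split=> //; apply: (twisted_geom_inj_winding w_coxeter q_sum (u := _) (v := c)).
    by rewrite -prod_twisted_geom_reflections // ec ecE.
  rewrite wc /winding (displacement_prod (n_gt1 := n_gt1)); last by move=> t _; exact: respectsT.
  rewrite big_seq big1 ?mul0r // => t /hr ht.
  by apply: (displacement_reflection (n_gt1 := n_gt1) ht); exact: respectsT.
have rs' t : t \in s -> respects inn t by move=> /rs/respectsC.
pose u := (\prod_(t <- s) t)%g.
have Eu : e u = e c by rewrite -prod_twisted_geom // ec ecE.
have [x hx] := displacement_dvd (respects_prod rs).
have [y hy] := displacement_dvd (respects_prod rs').
rewrite -/u in hx hy.
have hT : displacement [set: 'I_n]%SET u = (x + y) * n%:Z.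
  by rewrite (displacementC out) hx [displacement (~: out)%SET u]hy mulrDl.
have wu : winding u = (x + y)%:~R.
  by rewrite /winding hT rmorphM /= -pmulrn mulfK.
have xy : `|x| + `|y| <= 2.
  have le := sum_displacement_le w_coxeter hs rs.
  have : `|displacement out u| + `|displacement inn u| <= n%:Z * (size s - r)%:Z.
    apply: le_trans le; rewrite big_split /= (displacement_prod rs) (displacement_prod rs').
    by apply: lerD; exact: ler_norm_sum.
  rewrite hx hy !normrM -mulrDl [`|n%:Z|]ger0_norm // => le2.
  have : (`|x| + `|y|) * n%:Z <= 2 * n%:Z by apply: le_trans le2 _; rewrite mulrC; nia.
  by rewrite ler_pM2r // ltz_nat ltnW.
have [d1 d2] := twisted_geom_displacement Eu.
have [k [l [hk hl]]] := twisted_geom_integral Eu.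
move: d1 d2 hk hl; rewrite wu wc subr0.
have ru := respects_prod rs; have ru' := respects_prod rs'; rewrite -/u in ru ru'.
have rc := coxeter_respects n_gt1 w_coxeter.
rewrite (displacementM _ ru) (displacementM _ ru') (displacementV rc).
rewrite (displacementV (respectsC rc)) hx hy displacement_outer_coxeter //.
rewrite displacement_inner_coxeter // => d1 d2 hk hl.
have e1 : (x + y)%:~R * qinn = (x - 1)%:~R.
  apply: (mulfI n_neq0); rewrite -d1 !rmorphD !rmorphN !rmorphM /= -!pmulrn; ring.
have e2 : (x + y)%:~R * qout = (y + 1)%:~R.
  apply: (mulfI n_neq0); rewrite -d2 !rmorphD !rmorphN !rmorphM /= -!pmulrn; ring.
have ak : x - 1 = #|out|%:Z * k by apply/eqP; rewrite -(eqr_int R) -e1 hk.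
have bl : y + 1 = #|inn|%:Z * l by apply/eqP; rewrite -(eqr_int R) -e2 hl.
have flipped (A : {set 'I_n}) : #|A| = 2%N -> (forall i, weight i *+ 2 = (i \in A)%:R) ->
    (forall t, t \in s -> respects A t) ->
    displacement (~: A)%SET u = displacement A u ->
    exists s', [/\ word_over (@TL n) s', map e s' = map e s & (\prod_(t <- s') t)%g = c].
  move=> A2 hA rA dA; have [s' [h1 h2 h3 h4]] := flip_word A2 hA hs rA.
  exists s'; split=> //; apply: (twisted_geom_inj_winding w_coxeter q_sum).
    by rewrite -prod_twisted_geom ?h2 ?ec //; apply: h3.
  by rewrite wc /winding h4 -/u dA subrr mul0r.
have [[ex ey]|[ex ey b2 q0]|[ex ey a2 q0]] :=
  weight_cases not_exceptional_out not_exceptional_inn xy ak bl e1 e2.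
- exists s; split=> //; apply: (twisted_geom_inj_winding w_coxeter q_sum (v := c)) => //.
  by rewrite wu wc ex ey.
- apply: (flipped inn) => // [i|].
    have q1 : qout = 1 by rewrite -q_sum q0 addr0.
    rewrite inner_outer /point_weight q0 q1 b2; case: ifP => _ /=; last by field.
    by rewrite mul0r mul0rn.
  by rewrite finset.setCK hx hy ex ey.
- apply: (flipped out) => // [i|].
    have q1 : qinn = 1 by rewrite -q_sum q0 add0r.
    rewrite /point_weight q0 q1 a2; case: ifP => _ /=; first by field.
    by rewrite mul0r mul0rn.
  by rewrite hx [displacement _ u]hy ex ey.
Qed.
End TwistedWords.

(** * Factorizations of a Coxeter element into reflections and loops *)

Section CoxeterFactorizations.
Local Open Scope ring_scope.
Variable n : nat.
Hypothesis n_gt1 : (1 < n)%N.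
Local Notation residue := (residue n_gt1).
Local Notation residue_perm := (residue_perm n_gt1).
Local Notation respects := (respects n_gt1).
Variable w : seq 'I_n.
Hypothesis w_coxeter : coxeter_word w.
Local Notation c := (coxeter w).
Local Notation out := (outer w).
Local Notation inn := (inner w).
Implicit Types (u v t p : perZ n) (s : seq (perZ n)) (i j : 'I_n).

Lemma loop_loopVE i j k : (loop n i%:Z * (loop n j%:Z)^-1)%g k =
  k + (residue k == i)%:Z * n%:Z - (residue k == j)%:Z * n%:Z.
Proof.
rewrite -[LHS]/(loop n i%:Z ((loop n j%:Z)^-1%g k)).
rewrite (loopE n_gt1) (loopVE n_gt1) !residue_ord -mulNr residueDn; ring.
Qed.

Lemma loop_loopV_comm i j :
  ((loop n j%:Z)^-1 * loop n i%:Z = loop n i%:Z * (loop n j%:Z)^-1)%g.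
Proof.
apply: perZP => k; rewrite loop_loopVE.
rewrite -[LHS]/((loop n j%:Z)^-1%g (loop n i%:Z k)).
by rewrite (loopVE n_gt1) (loopE n_gt1) !residue_ord residueDn.
Qed.

(** The right factor takes [i] to [j + n], which the left factor takes to [i + n]. *)
Lemma loop_loopV_reflections i j :
  (loop n i%:Z * (loop n j%:Z)^-1 = refl n i%:Z j%:Z * refl n i%:Z (j%:Z + n%:Z))%g \/ i = j.
Proof.
have [->|ij] := eqVneq i j; [by right|left].
have jn : residue (j%:Z + n%:Z) = j by rewrite -[n%:Z]mul1r residueDn residue_ord.
apply: (perZ_ordP n_gt1) => k; rewrite loop_loopVE residue_ord.
rewrite -[RHS]/(refl n i%:Z j%:Z (refl n i%:Z (j%:Z + n%:Z) k%:Z)).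
rewrite [refl n i%:Z (_ + _) _](reflE (n_gt1 := n_gt1)) ?jn ?residue_ord //.
have [->|ki] := eqVneq k i.
  have -> : i%:Z + (j%:Z + n%:Z - i%:Z) = j%:Z + n%:Z by ring.
  rewrite (reflE (n_gt1 := n_gt1)) ?jn ?residue_ord // ?[j == i]eq_sym ?(negPf ij) ?eqxx ?mul1r ?mul0r; ring.
have [->|kj] := eqVneq k j.
  have -> : j%:Z + (i%:Z - (j%:Z + n%:Z)) = i%:Z + (- 1) * n%:Z by ring.
  rewrite (reflE (n_gt1 := n_gt1)) ?residueDn ?residue_ord // ?eqxx ?mul1r ?mul0r; ring.
by rewrite (reflE (n_gt1 := n_gt1)) ?residue_ord // ?(negPf ki) ?(negPf kj) ?mul0r addr0 subr0.
Qed.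

(** Both reflections exchange the same two classes, and their product moves these by opposite
    amounts. An outer displacement [n] then forces one class to be outer and the other inner. *)
Lemma reflection_pair t1 t2 : reflections t1 -> reflections t2 ->
  residue_perm (t1 * t2)%g = 1%g -> displacement out (t1 * t2)%g = n%:Z ->
  exists i j, [/\ i \in out, j \in inn &
    (t1 * t2)%g = (loop n i%:Z * (loop n j%:Z)^-1)%g].
Proof.
move=> h1 h2 p1 dout; have [k [l [ne et2]]] := reflectionP n_gt1 h2.
move: p1 ne; set a := residue k; set b := residue l => p1 ne.
have r2 : residue_perm t2 = tperm a b by rewrite et2 residue_perm_refl.
have r1 : residue_perm t1 = tperm a b.
  move: p1; rewrite residue_permM => /(congr1 (mulg (residue_perm t2)^-1%g)).
  by rewrite mulKg mulg1 r2 tpermV.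
pose p := (t1 * t2)%g; pose D i := p i%:Z - i%:Z.
have D0 i : i != a -> i != b -> D i = 0.
  move=> ia ib; rewrite /D -[p _]/(t1 (t2 i%:Z)).
  have fixi : tperm a b i = i by rewrite tpermD // eq_sym.
  by rewrite !(reflection_fix (n_gt1 := n_gt1)) ?subrr ?r1 ?r2 ?residue_ord.
have dA A : displacement A p = (if a \in A then D a else 0) + (if b \in A then D b else 0).
  rewrite /displacement big_mkcond (bigD1 a) //= (bigD1 b) 1?eq_sym //= big1 ?addr0 //.
  by move=> i /andP[ia ib]; case: ifP => // _; exact: D0.
have dT : displacement [set: 'I_n]%SET p = 0.
  rewrite (displacementM _ (respectsT n_gt1 _)).
  by rewrite !(displacement_reflection (n_gt1 := n_gt1)) ?addr0 //; exact: respectsT.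
move: dT dout; rewrite -/p !dA !finset.in_setT.
have build i j : i \in out -> j \notin out -> i != j -> D i = n%:Z -> D j = - n%:Z ->
    (forall k, k != i -> k != j -> D k = 0) ->
    exists i j, [/\ i \in out, j \in inn & p = (loop n i%:Z * (loop n j%:Z)^-1)%g].
  move=> iout jout ij Di Dj Dk; exists i, j; split=> //; first by rewrite inner_outer.
  apply: (perZ_ordP n_gt1) => m; rewrite loop_loopVE residue_ord -[LHS](subrK m%:Z) -/(D m).
  have [->|mi] := eqVneq m i; first by rewrite Di (negPf ij) mul1r mul0r subr0 addrC.
  have [->|mj] := eqVneq m j; first by rewrite Dj mul1r mul0r addr0 addrC.
  by rewrite Dk // !mul0r addr0 add0r subr0.
have [aout|aout] := boolP (a \in out); have [bout|bout] := boolP (b \in out) => dT dout.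
- by lia.
- by apply: (build a b) => //; lia.
- apply: (build b a) => //; [by rewrite eq_sym|lia|lia|].
  by move=> m mb ma; exact: D0.
- by lia.
Qed.

Lemma simple_word_coxeter : exists s,
  [/\ word_over (@reflections n) s, size s = n & (\prod_(t <- s) t)%g = c].
Proof.
exists (map (@simple_refl n) w); split.
- by move=> _ /mapP[i _ ->]; apply: (reflection_refl (n_gt1 := n_gt1)); exact: residueS.
- by rewrite size_map coxeter_word_size.
- by rewrite -coxeterE_map.
Qed.

Lemma reflections_TL s : word_over (@reflections n) s -> word_over (@TL n) s.
Proof. by move=> h t /h; left. Qed.

Lemma reduced_TL_size s : reduced (@TL n) c s -> size s = n.
Proof.
move=> [hs ec m]; have [s' [h' sz' e']] := simple_word_coxeter.
have le : (size s <= n)%N by rewrite -[X in (_ <= X)%N]sz'; apply: m => //; exact: reflections_TL.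
by have [] := TL_word_coxeter n_gt1 w_coxeter hs le ec.
Qed.

Lemma reduced_TLI s : word_over (@TL n) s -> (\prod_(t <- s) t)%g = c ->
  (size s <= n)%N -> reduced (@TL n) c s.
Proof.
move=> hs ec sn; split=> // s' hs' ec'; apply: leq_trans sn _.
have [//|lt] := leqP n (size s').
have [e _] := TL_word_coxeter n_gt1 w_coxeter hs' (ltnW lt) ec'.
by rewrite e ltnn in lt.
Qed.

Lemma reduced_reflections s : word_over (@reflections n) s ->
  (\prod_(t <- s) t)%g = c -> size s = n -> reduced (@reflections n) c s.
Proof.
move=> hs ec sn; split=> // s' hs' ec'.
have [_ _ m] := reduced_TLI (reflections_TL hs) ec (eq_leq sn).
by apply: m => //; exact: reflections_TL.
Qed.

(** If a prefix [x] of a reduced word of [c] is trivial modulo [n], the rest [y] has the permutation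
    of [c], hence [n] or [n - 2] letters. In the second case [y] preserves the outer points with
    displacement 0, so at most two reflections in [x] account for the outer displacement [n]. *)
Lemma reflection_interval_translation p : interval (@reflections n) c p ->
  residue_perm p = 1%g -> p = 1%g \/ exists i j,
  [/\ i \in out, j \in inn & p = (loop n i%:Z * (loop n j%:Z)^-1)%g].
Proof.
move=> /interval_reduced[x [y [[h ec m] ex]]] p1.
have [hx hy] := (word_over_cat _ _ _).1 h.
have [s' [h' sz' e']] := simple_word_coxeter.
have := m s' h' e'; rewrite size_cat sz' => sxy.
have hperm : residue_perm (\prod_(t <- y) t)%g = residue_perm c.
  by rewrite -ec big_cat /= ex residue_permM p1 mulg1.
have yn : (size y <= n)%N by apply: leq_trans sxy; rewrite leq_addl.
have := TL_word_structure w_coxeter (reflections_TL hy) yn hperm.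
have -> : count (fun t => residue_perm t != 1%g) y = size y.
  apply/eqP; rewrite -all_count; apply/allP => t /hy; exact: residue_perm_reflection.
move=> /= [yn'|[yn' ry]].
  left; rewrite -ex; have /size0nil -> : size x = 0%N.
    apply/eqP; rewrite -leqn0 -(leq_add2r (size y)) add0n; apply: leq_trans sxy _.
    exact: (eq_leq (esym yn')).
  by rewrite big_nil.
have dy : displacement out (\prod_(t <- y) t)%g = 0.
  rewrite (displacement_prod ry) big_seq big1 // => t ty.
  by apply: (displacement_reflection (n_gt1 := n_gt1)); [exact: hy|exact: ry].
have dp : displacement out p = n%:Z.
  rewrite -(displacement_outer_coxeter n_gt1 w_coxeter) -ec big_cat /= ex.
  by rewrite (displacementM _ (respects_prod ry)) dy addr0.
have : (size x <= 2)%N.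
  rewrite -(leq_add2r (size y)); apply: leq_trans sxy _.
  exact: (eq_leq (esym yn')).
case: x ex hx {h ec m sxy} => [|t1 [|t2 [|? ?]]] // ex hx _.
- by left; rewrite -ex big_nil.
- move: ex; rewrite big_seq1 => ex; move: p1; rewrite -ex => /eqP.
  by rewrite (negPf (residue_perm_reflection n_gt1 (hx t1 (mem_head _ _)))).
- move: ex; rewrite !big_cons big_nil mulg1 => ex; right.
  rewrite -ex in p1 dp *; apply: reflection_pair => //; apply: hx; first exact: mem_head.
  by rewrite !inE eqxx orbT.
Qed.

(** Reflections are moved to the right of the loops by conjugation, which keeps them reflections. *)
Lemma loops_first s : word_over (@TL n) s -> exists s',
  [/\ word_over (@reflections n) s',
      size s' = count (fun t => residue_perm t != 1%g) s &
      (\prod_(t <- s) t = \prod_(t <- s | residue_perm t == 1) t * \prod_(t <- s') t)%g].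
Proof.
elim: s => [|t s IH] hs; first by exists [::]; rewrite !big_nil mulg1.
have [s' [h' sz' e']] := IH (fun t' t's => hs t' (mem_behead (s := t :: s) t's)).
rewrite !big_cons /=; have [t1|nt1] := eqVneq (residue_perm t) 1%g.
  by exists s'; rewrite e' mulgA.
have [k [l [ne et]]] := reflectionP n_gt1 (TL_reflection (hs t (mem_head _ _)) nt1).
set L := (\prod_(t <- s | residue_perm t == 1%g) t)%g in e' *.
exists (refl n (L^-1%g k) (L^-1%g l) :: s'); split.
- move=> t'; rewrite inE => /predU1P[->|/h' //].
  by apply: (reflection_refl (n_gt1 := n_gt1)); rewrite residue_perZ.
- by rewrite /= sz'.
- have -> : refl n (L^-1%g k) (L^-1%g l) = (L^-1 * t * L)%g.
    by rewrite et -(refl_conj n_gt1 L^-1%g) invgK.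
  rewrite big_cons; apply: (@etrans _ _ (L * (L^-1 * t * L * \prod_(t <- s') t))%g) => //.
  by rewrite e' !mulgA mulgV mul1g.
Qed.

(** A factored translation has to come from a translation in the interval over reflections. Moving
    the two loops of [s] to the front and replacing them by two reflections gives a reduced word of
    [c], so their product is such a translation. *)
Lemma loop_pair_interval s : word_over (@TL n) s -> size s = n ->
  (\prod_(t <- s) t)%g = c -> (forall t, t \in s -> respects out t) ->
  (count (fun t => residue_perm t != 1%g) s).+2 = n ->
  (forall t, t \in s -> noncrossing_label w t) ->
  forall t, t \in s -> residue_perm t = 1%g -> exists i j,
    [/\ i \in out, j \in inn,
        interval (@reflections n) c (loop n i%:Z * (loop n j%:Z)^-1)%g &
        t = loop n i%:Z \/ t = (loop n j%:Z)^-1%g].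
Proof.
move=> hs sn ec rs rn lab t ts t1.
have [s' [h' sz' e']] := loops_first hs.
pose P u := residue_perm u == 1%g.
have dsum : \sum_(u <- seq.filter P s) displacement out u = n%:Z.
  rewrite -(displacement_outer_coxeter n_gt1 w_coxeter) -ec (displacement_prod rs).
  rewrite big_filter [RHS](bigID P) /= [X in _ = _ + X]big_seq_cond [X in _ = _ + X]big1 ?addr0 //.
  move=> u /andP[us nu]; apply: (displacement_reflection (n_gt1 := n_gt1)); last exact: rs.
  exact: TL_reflection (hs u us) nu.
have tf : t \in seq.filter P s by rewrite mem_filter /P t1 eqxx.
have sf : size (seq.filter P s) = 2%N.
  rewrite size_filter; have := count_predC P s.
  by rewrite -[count (predC P) s]/(count (fun t => residue_perm t != 1%g) s); lia.
have labf u : u \in seq.filter P s -> (exists2 i, i \in out & u = loop n i%:Z) \/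
     exists2 j, j \in inn & u = (loop n j%:Z)^-1%g.
  rewrite mem_filter => /andP[/eqP u1 /lab[/(residue_perm_reflection n_gt1)|//]].
  by rewrite u1 eqxx.
have pint i j : i \in out -> j \in inn ->
    (\prod_(u <- s | P u) u)%g = (loop n i%:Z * (loop n j%:Z)^-1)%g ->
    interval (@reflections n) c (loop n i%:Z * (loop n j%:Z)^-1)%g.
  move=> iout jinn ep.
  have ij : i != j by apply: contraTneq jinn => <-; rewrite inner_outer iout.
  have [er|eij] := loop_loopV_reflections i j; last by rewrite eij eqxx in ij.
  apply/interval_reduced; exists [:: refl n i%:Z j%:Z; refl n i%:Z (j%:Z + n%:Z)], s'.
  split; last by rewrite !big_cons big_nil mulg1 er.
  apply: reduced_reflections.
  - move=> u; rewrite /= !inE => /or3P[/eqP->|/eqP->|/h' //].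
      by apply: (reflection_refl (n_gt1 := n_gt1)); rewrite !residue_ord.
    apply: (reflection_refl (n_gt1 := n_gt1)).
    by rewrite -[n%:Z]mul1r residueDn !residue_ord.
  - by rewrite big_cat /= !big_cons big_nil mulg1 -er -ep -e'.
  - by rewrite /= sz'.
have dl i (A : {set 'I_n}) : displacement A (loop n i%:Z) = (i \in A)%:Z * n%:Z.
  by rewrite (displacement_loop n_gt1) residue_ord.
have dlV i (A : {set 'I_n}) : displacement A (loop n i%:Z)^-1%g = - ((i \in A)%:Z * n%:Z).
  by rewrite (displacement_loopV n_gt1) residue_ord.
have outinn j : j \in inn -> (j \in out) = false by rewrite inner_outer => /negPf.
rewrite -big_filter in pint.
move: sf dsum tf labf pint; case: (seq.filter P s) => [|u1 [|u2 [|? ?]]] // _.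
rewrite !big_cons !big_nil addr0 mulg1 => dsum tf labf pint.
have := labf u1 (mem_head _ _); have := labf u2; rewrite !inE eqxx orbT => /(_ isT).
move: tf; rewrite !inE => tf.
(* The outer displacement [n] excludes two outer loops and two inverse inner loops; the order of a
   mixed pair is irrelevant because the loops commute. *)
case=> [[i2 h2 e2]|[i2 h2 e2]] [[i1 h1 e1]|[i1 h1 e1]]; subst u1 u2.
- by move: dsum; rewrite !dl h1 h2; lia.
- exists i2, i1; split=> //; first by apply: pint => //; exact: loop_loopV_comm.
  by case/orP: tf => /eqP; [right|left].
- exists i1, i2; split=> //; first exact: pint.
  by case/orP: tf => /eqP; [left|right].
- by move: dsum; rewrite !dlV !outinn //; lia.
Qed.
End CoxeterFactorizations.

(** * Factored translations as images of loops *)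

Section FactoredTranslations.
Local Open Scope ring_scope.
Variables (R : realType) (n : nat).
Hypothesis n_gt1 : (1 < n)%N.
Local Notation residue := (residue n_gt1).
Local Notation residue_perm := (residue_perm n_gt1).
Local Notation respects := (respects n_gt1).
Variable w : seq 'I_n.
Hypothesis w_coxeter : coxeter_word w.
Variables qout qinn : R.
Hypothesis q_sum : qout + qinn = 1.
Local Notation c := (coxeter w).
Local Notation out := (outer w).
Local Notation inn := (inner w).
Local Notation e := (twisted_geom n_gt1 w qout qinn).
Local Notation weight := (point_weight w qout qinn).
Implicit Types (p t : perZ n) (s : seq (perZ n)) (i j : 'I_n) (g : selfbij (Vdual R n)).

Let n_neq0 : n%:R != 0 :> R. Proof. by rewrite pnatr_eq0 -lt0n ltnW. Qed.
Let out_neq0 : #|out|%:R != 0 :> R.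
Proof. by rewrite pnatr_eq0 -lt0n outer_gt0. Qed.
Let inn_neq0 : #|inn|%:R != 0 :> R.
Proof. by rewrite pnatr_eq0 -lt0n inner_gt0. Qed.

(** Adding [1 - deltaval x] times a [rho] brings any [x] into E, so the linear action is determined
    by its values there. *)
Lemma affine_action p (mu : Vdual R n) :
  (forall x, deltaval x = 1 -> actVdual p x = x + mu) ->
  forall x, actVdual p x = x + deltaval x *: mu.
Proof.
move=> act x; pose x0 := rho R (residue 0); pose k := 1 - deltaval x.
have d0 : deltaval x0 = 1 by rewrite (deltaval_rho R n_gt1).
have h0 := act x0 d0.
have : deltaval (x + k *: x0) = 1 by rewrite deltavalD deltavalZ d0 mulr1 addrC subrK.
have actD y z : actVdual p (y + k *: z) = actVdual p y + k *: actVdual p z.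
  by rewrite /actVdual comp_lfunDl comp_lfunZl.
move=> /act; rewrite actD h0 => h.
apply: (addIr (k *: (x0 + mu))); rewrite h scalerDr addrACA; congr (_ + _).
by rewrite -scalerDl /k addrC subrK scale1r.
Qed.

Lemma sum_sigma (A : {set 'I_n}) (a : 'I_n -> R) :
  \sum_(i in A) a i *: sigma R i = sigma_comb (fun i => if i \in A then a i else 0).
Proof.
rewrite big_mkcond; apply: eq_bigr => i _.
by case: ifP => _; rewrite ?scale0r.
Qed.

Definition splitting (k : R) (a d : 'I_n -> R) (i : 'I_n) : R :=
  if i \in out then k + a i else - k + d i.

Lemma splittingE (k : R) (a d : 'I_n -> R) :
  k *: omega w (inV (dvec R n)) + \sum_(i in out) a i *: sigma R i +
    \sum_(i in inn) d i *: sigma R i = sigma_comb (splitting k a d).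
Proof.
rewrite (omega_delta R n_gt1 w_coxeter) !sum_sigma -sigma_combZ -!sigma_combD.
apply/(sigma_combP n_gt1 _ _); exists 0 => i /=; rewrite /splitting inner_outer.
by case: ifP => _ /=; ring.
Qed.

Lemma outer_factorE (k q : R) (a : 'I_n -> R) :
  \sum_(i in out) a i *: sigma R i + q *: (k *: omega w (inV (dvec R n))) =
  sigma_comb (fun i => if i \in out then a i + q * k else - (q * k)).
Proof.
rewrite (omega_delta R n_gt1 w_coxeter) sum_sigma -!sigma_combZ -sigma_combD.
by apply/(sigma_combP n_gt1 _ _); exists 0 => i /=; case: ifP => _; ring.
Qed.

Lemma inner_factorE (k q : R) (d : 'I_n -> R) :
  \sum_(i in inn) d i *: sigma R i + q *: (k *: omega w (inV (dvec R n))) =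
  sigma_comb (fun i => if i \in out then q * k else d i - q * k).
Proof.
rewrite (omega_delta R n_gt1 w_coxeter) sum_sigma -!sigma_combZ -sigma_combD.
by apply/(sigma_combP n_gt1 _ _); exists 0 => i /=; rewrite inner_outer; case: (i \in out) => /=; ring.
Qed.

Lemma is_translationE g (h : 'I_n -> R) :
  is_translation g (sigma_comb h) -> g = translation n_gt1 h.
Proof. by move=> hg; apply: selfbijP => x; rewrite hg. Qed.

(* The projections of the translation of a loop at i times an inverse loop at j,
   written with [A = 1 / #|out|] and [B = 1 / #|inn|]: the U_0-part has
   coefficient [k = (A + B) / 2], and the shift [C = (A - B) / 2] comes from
   [\sum_i sigma_i = 0]. *)
Lemma outer_factor_loop (k C : R) (a : 'I_n -> R) i :
  #|out|%:R^-1 = k + C -> #|inn|%:R^-1 = k - C ->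
  (forall m, m \in out -> a m = (m == i)%:R - k - C) -> i \in out ->
  translation n_gt1 (fun m => if m \in out then a m + qout * k else - (qout * k)) =
  e (loop n i%:Z).
Proof.
move=> hA hB ha iout; rewrite twisted_geom_loop residue_ord.
apply/translation_eq; exists (- (qout * C)) => m; rewrite /point_weight hA hB.
have -> : qinn = 1 - qout by rewrite -q_sum [qout + _]addrC addrK.
case: ifP => mout; first by rewrite ha //; ring.
have -> : (m == i) = false by apply: contraFF mout => /eqP->.
by rewrite mulr0n; ring.
Qed.

Lemma inner_factor_loop (k C : R) (d : 'I_n -> R) j :
  #|out|%:R^-1 = k + C -> #|inn|%:R^-1 = k - C ->
  (forall m, m \in inn -> d m = - (m == j)%:R + k - C) -> j \in inn ->
  translation n_gt1 (fun m => if m \in out then qinn * k else d m - qinn * k) =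
  e (loop n j%:Z)^-1%g.
Proof.
move=> hA hB hd jinn; rewrite twisted_geom_loopV residue_ord.
apply/translation_eq; exists (- (qinn * C)) => m; rewrite /point_weight hA hB.
have -> : qout = 1 - qinn by rewrite -q_sum addrK.
case: ifP => mout; last by rewrite hd ?inner_outer ?mout //; ring.
have -> : (m == j) = false.
  by apply: contraTF mout => /eqP->; rewrite -inner_outer.
by rewrite mulr0n; ring.
Qed.

(** The coefficients of the U_out-part and of the U_inn-part sum to 0, so summing over outer and
    over inner points determines [k] and the constant [C], hence the whole decomposition. *)
Lemma factored_translations_loop g : factored_translations w qout qinn g ->
  g = 1%g \/ exists2 t, @loops n t & g = e t.
Proof.
move=> [p [l0 [lout [linn [ip [[k ->] [[a a0 ->] [d d0 ->]]] act ft]]]]].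
rewrite outer_factorE inner_factorE splittingE in act ft.
have gp : geom R p = translation n_gt1 (splitting k a d).
  by apply: selfbijP => x /=; rewrite (affine_action act).
have p1 : residue_perm p = 1%g.
  rewrite -(residue_perm1 n_gt1).
  apply: (@geom_translation_residue_perm R n n_gt1 p 1%g (splitting k a d)).
  by rewrite geom1 mul1g.
move: gp; rewrite (geom_residue_perm1 R p1) => /translation_eq[C hC].
pose D i : R := (p i%:Z - i%:Z)%:~R / n%:R.
have so : \sum_(i in out) D i = (k + C) * #|out|%:R.
  rewrite (eq_bigr (fun i => a i + (k + C))) => [|i iout]; last first.
    by rewrite /D hC /splitting iout; ring.
  by rewrite big_split /= a0 add0r sumr_const -[LHS]mulr_natr.
have si : \sum_(i in inn) D i = (- k + C) * #|inn|%:R.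
  rewrite (eq_bigr (fun i => d i + (- k + C))) => [|i]; last first.
    by rewrite inner_outer => /negPf iout; rewrite /D hC /splitting iout; ring.
  by rewrite big_split /= d0 add0r sumr_const -[LHS]mulr_natr.
have [pid|[i [j [iout jinn ep]]]] := reflection_interval_translation w_coxeter ip p1.
  have D0 i : D i = 0 by rewrite /D pid subrr mul0r.
  have kC : k + C = 0.
    by apply: (mulIf out_neq0); rewrite -so big1 // mul0r.
  have kC' : - k + C = 0.
    by apply: (mulIf inn_neq0); rewrite -si big1 // mul0r.
  have k0 : k = 0 by lra.
  have C0 : C = 0 by lra.
  have FE m : splitting k a d m = 0 by have := hC m; rewrite -/(D m) D0 C0 addr0.
  left; case: ft => /is_translationE ->; apply: translation0 => m; have := FE m;
    rewrite /splitting k0 !mulr0; case: ifP => _; lra.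
have DE m : D m = (m == i)%:R - (m == j)%:R.
  rewrite /D ep (loop_loopVE n_gt1) residue_ord (_ : _ - m%:Z = ((m == i)%:Z - (m == j)%:Z) * n%:Z); last by ring.
  by rewrite rmorphM rmorphB /= -!pmulrn mulfK.
have hA : #|out|%:R^-1 = k + C.
  apply: (mulIf out_neq0); rewrite -so mulVf // (bigD1 i) //= big1 => [|m /andP[mo mi]].
    rewrite addr0 DE eqxx (_ : (i == j) = false) ?subr0 //.
    by apply: contraTF iout => /eqP->; rewrite -inner_outer.
  rewrite DE (negPf mi) (_ : (m == j) = false) ?subrr //.
  by apply: contraTF mo => /eqP->; rewrite -inner_outer.
have hB : #|inn|%:R^-1 = k - C.
  apply: (mulIf inn_neq0); rewrite mulVf // -[k - C]opprB [C - k]addrC mulNr -si.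
  rewrite (bigD1 j) //= big1 => [|m /andP[mo mj]].
    rewrite addr0 DE eqxx (_ : (j == i) = false) ?sub0r ?opprK //.
    by apply: contraTF jinn => /eqP->; rewrite inner_outer iout.
  rewrite DE (negPf mj) (_ : (m == i) = false) ?subrr //.
  by apply: contraTF mo => /eqP->; rewrite inner_outer iout.
right; case: ft => /is_translationE ->.
  exists (loop n i%:Z); first by exists i%:Z; left.
  apply: (outer_factor_loop hA hB) => // m mout.
  have := hC m; rewrite -/(D m) DE /splitting mout.
  rewrite (_ : (m == j) = false) ?mulr0n; first by lra.
  by apply: contraTF mout => /eqP->; rewrite -inner_outer.
exists (loop n j%:Z)^-1%g; first by exists j%:Z; right.
apply: (inner_factor_loop hA hB) => // m minn.
have := hC m; rewrite -/(D m) DE /splitting.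
rewrite (_ : (m == i) = false) ?mulr0n; last first.
  by apply: contraTF minn => /eqP->; rewrite inner_outer iout.
by move: minn; rewrite inner_outer => /negPf->; lra.
Qed.

Lemma loop_factored_translations i j : i \in out -> j \in inn ->
  interval (@reflections n) c (loop n i%:Z * (loop n j%:Z)^-1)%g ->
  factored_translations w qout qinn (e (loop n i%:Z)) /\
  factored_translations w qout qinn (e (loop n j%:Z)^-1%g).
Proof.
move=> iout jinn ip; set p := (_ * _)%g in ip.
pose A : R := #|out|%:R^-1; pose B : R := #|inn|%:R^-1.
(* These solve [A = k + C] and [B = k - C], so that [a] and [d] sum to 0 over the outer and inner
   points. *)
pose k := (A + B) / 2; pose C := (A - B) / 2.
pose a (m : 'I_n) : R := (m == i)%:R - k - C.
pose d (m : 'I_n) : R := - (m == j)%:R + k - C.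
have hA : #|out|%:R^-1 = k + C by rewrite -/A /k /C; field.
have hB : #|inn|%:R^-1 = k - C by rewrite -/B /k /C; field.
have a0 : \sum_(m in out) a m = 0.
  rewrite (eq_bigr (fun m => (m == i)%:R + - A)) => [|m _]; last first.
    by rewrite /a -addrA -opprD -hA.
  rewrite big_split /= sumr_const -[_ *+ #|_|]mulr_natr mulNr mulVf //.
  rewrite (bigD1 i) //= eqxx big1 ?addr0 ?subrr // => m /andP[_ /negPf->] //.
have d0 : \sum_(m in inn) d m = 0.
  rewrite (eq_bigr (fun m => - (m == j)%:R + B)) => [|m _]; last first.
    by rewrite /d -addrA -hB.
  rewrite big_split /= sumr_const -[_ *+ #|_|]mulr_natr mulVf //.
  rewrite (bigD1 j) //= eqxx big1 ?addr0 ?addNr // => m /andP[_ /negPf->].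
  by rewrite oppr0.
have p1 : residue_perm p = 1%g.
  by rewrite residue_permM residue_perm_loop residue_perm_loopV mulg1.
have gp : geom R p = translation n_gt1 (splitting k a d).
  rewrite (geom_residue_perm1 R p1); apply/translation_eq; exists C => m.
  rewrite (loop_loopVE n_gt1) residue_ord (_ : _ - m%:Z = ((m == i)%:Z - (m == j)%:Z) * n%:Z); last by ring.
  rewrite rmorphM rmorphB /= -!pmulrn mulfK // /splitting /a /d.
  case: ifP => mout.
    rewrite (_ : (m == j) = false) ?mulr0n; first by ring.
    by apply: contraTF mout => /eqP->; rewrite -inner_outer.
  rewrite (_ : (m == i) = false) ?mulr0n; first by ring.
  by apply: contraFF mout => /eqP->.
have act x : deltaval x = 1 -> actVdual p x = x + (k *: omega w (inV (dvec R n)) +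
    \sum_(m in out) a m *: sigma R m + \sum_(m in inn) d m *: sigma R m).
  move=> x1; rewrite -[LHS]/(geom R p x) gp /= /translate x1 scale1r.
  by rewrite splittingE.
have ha m (_ : m \in out) : a m = (m == i)%:R - k - C by [].
have hd m (_ : m \in inn) : d m = - (m == j)%:R + k - C by [].
split; exists p, (k *: omega w (inV (dvec R n))), (\sum_(m in out) a m *: sigma R m),
    (\sum_(m in inn) d m *: sigma R m); split=> //.
- by split; [exists k|split; [exists a|exists d]].
- by left; rewrite outer_factorE -(outer_factor_loop hA hB ha iout) => x.
- by split; [exists k|split; [exists a|exists d]].
- by right; rewrite inner_factorE -(inner_factor_loop hA hB hd jinn) => x.
Qed.
End FactoredTranslations.

(** * Comparison of the two intervals *)

Section IntervalComparison.
Local Open Scope ring_scope.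
Variables (R : realType) (n : nat).
Hypothesis n_gt1 : (1 < n)%N.
Local Notation residue_perm := (residue_perm n_gt1).
Variable w : seq 'I_n.
Hypothesis w_coxeter : coxeter_word w.
Variables qout qinn : R.
Hypothesis q_sum : qout + qinn = 1.
Hypothesis not_exceptional_out : ~ exceptional #|outer w| #|inner w| qout.
Hypothesis not_exceptional_inn : ~ exceptional #|inner w| #|outer w| qinn.
Local Notation c := (coxeter w).
Local Notation e := (twisted_geom n_gt1 w qout qinn).
Local Notation TF := (TF w qout qinn).
Implicit Types (t : perZ n) (s : seq (perZ n)) (g : selfbij (Vdual R n)).

Lemma twisted_geom_reflection t : reflections t -> e t = geom R t.
Proof.
by move=> h; rewrite twisted_geom_winding0 // (winding_reflection R n_gt1).
Qed.

Lemma twisted_geom_coxeter : e c = geom R c.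
Proof. by rewrite twisted_geom_winding0 // winding_coxeter. Qed.

Lemma TF_twisted g : TF g -> g = 1%g \/ exists2 t, @TL n t & g = e t.
Proof.
case=> [[[t ht <-]|]|].
- by right; exists t; [left|rewrite twisted_geom_reflection].
- by move=> /(factored_translations_loop n_gt1 w_coxeter q_sum)[->|[t ht ->]];
    [left|right; exists t => //; right].
move=> /(factored_translations_loop n_gt1 w_coxeter q_sum)[gV|[t [k ht] gV]].
  by left; rewrite -[g]invgK gV invg1.
right; rewrite -[g]invgK gV; case: ht => ->.
  by rewrite twisted_geomV; exists (loop n k)^-1%g => //; right; exists k; right.
by rewrite -twisted_geomV invgK; exists (loop n k) => //; right; exists k; left.
Qed.

Lemma TF_word (s1 : seq (selfbij (Vdual R n))) : word_over TF s1 -> exists s,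
  word_over (@TL n) s /\ [seq g <- s1 | g != 1%g] = map e s.
Proof.
elim: s1 => [|g s1 IH] h; first by exists [::].
have [s [hs es]] := IH (fun g' g's => h g' (mem_behead (s := g :: s1) g's)).
rewrite /=; case: eqP => [_|/eqP g1]; first by exists s.
have [gE|[t ht ge]] := TF_twisted (h g (mem_head _ _)).
  by rewrite gE eqxx in g1.
exists (t :: s); split; last by rewrite /= ge es.
by move=> t'; rewrite inE => /predU1P[->|/hs].
Qed.

Lemma prod_filter_neq1 (s1 : seq (selfbij (Vdual R n))) :
  (\prod_(g <- [seq g <- s1 | g != 1] ) g = \prod_(g <- s1) g)%g.
Proof.
elim: s1 => [|g s1 IH]; first by rewrite !big_nil.
by rewrite /=; case: eqP => [->|_]; rewrite !big_cons IH ?mul1g.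
Qed.

Lemma TF_word_coxeter (s1 : seq (selfbij (Vdual R n))) : word_over TF s1 -> (\prod_(g <- s1) g)%g = geom R c ->
  (size s1 <= n)%N -> exists s,
  [/\ s1 = map e s, word_over (@TL n) s, (\prod_(t <- s) t)%g = c & size s = n].
Proof.
move=> h ec s1n; have [s [hs es]] := TF_word h.
have sz : size s = count (fun g => g != 1%g) s1 by rewrite -size_filter es size_map.
have sn : (size s <= n)%N by rewrite sz; apply: leq_trans s1n; exact: count_size.
have pe : (\prod_(g <- map e s) g)%g = geom R c by rewrite -es prod_filter_neq1.
have [s' [hs' es' ec']] := twisted_word w_coxeter q_sum not_exceptional_out
  not_exceptional_inn hs sn pe.
have ss' : size s' = size s by rewrite -(size_map e s') es' size_map.
have s'n : (size s' <= n)%N by rewrite ss'.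
have [s'E _] := TL_word_coxeter n_gt1 w_coxeter hs' s'n ec'.
(* The lift has [n] letters and [s1] has at most [n], so no identity letter was deleted. *)
exists s'; split=> //; rewrite es' -es; apply/esym/all_filterP.
rewrite all_count eqn_leq count_size /= -sz -ss' s'E.
exact: s1n.
Qed.

(** The image of a loop lies in F because the other loop of the same reduced word completes it to a
    translation in the interval over reflections. *)
Lemma twisted_letters s : reduced (@TL n) c s ->
  (\prod_(g <- map e s) g)%g = geom R c /\
  (forall t, t \in s -> noncrossing_label w t /\ TF (e t)).
Proof.
move=> hr; have sn := reduced_TL_size n_gt1 w_coxeter hr; have [hs ec _] := hr.
have TFr t : reflections t -> TF (e t).
  by move=> ht; left; left; exists t => //; rewrite twisted_geom_reflection.
have [_ [hrefl|[rs rn lab]]] := TL_word_coxeter n_gt1 w_coxeter hs (eq_leq sn) ec.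
  split; first by rewrite prod_twisted_geom_reflections // ec twisted_geom_coxeter.
  by move=> t /hrefl ht; split; [left|exact: TFr].
split; first by rewrite prod_twisted_geom // ec twisted_geom_coxeter.
move=> t ts; split; first exact: lab.
have [t1|nt1] := eqVneq (residue_perm t) 1%g; last first.
  by apply: TFr; exact: TL_reflection (hs t ts) nt1.
have [i [j [iout jinn ip et]]] :=
  loop_pair_interval w_coxeter hs sn ec rs rn lab ts t1.
have [f1 f2] := loop_factored_translations n_gt1 w_coxeter q_sum iout jinn ip.
by left; right; case: et => ->.
Qed.

Lemma reduced_TL_TF s : reduced (@TL n) c s -> reduced TF (geom R c) (map e s).
Proof.
move=> hr; have [pe hl] := twisted_letters hr; split=> //.
  by move=> _ /mapP[t /hl[_ ht] ->].
move=> s1 h1 ec1; rewrite size_map (reduced_TL_size n_gt1 w_coxeter hr).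
have [//|lt] := leqP n (size s1).
have [s2 [es _ _ sz]] := TF_word_coxeter h1 ec1 (ltnW lt).
by move: lt; rewrite es size_map sz ltnn.
Qed.

Lemma reduced_TF_TL (s1 : seq (selfbij (Vdual R n))) : reduced TF (geom R c) s1 ->
  exists2 s, reduced (@TL n) c s & s1 = map e s.
Proof.
(* The word of simple reflections has a reduced image of length [n], which bounds the length of
   [s1]. *)
move=> [h ec m]; have [s0 [h0 sz0 ec0]] := simple_word_coxeter n_gt1 w_coxeter.
have r0 := reduced_TLI n_gt1 w_coxeter (reflections_TL h0) ec0 (eq_leq sz0).
have [h1 ec1 _] := reduced_TL_TF r0.
have le : (size s1 <= n)%N.
  by apply: leq_trans (m _ h1 ec1) _; rewrite size_map; exact: eq_leq.
have [s [es hs ecs sz]] := TF_word_coxeter h ec le.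
by exists s => //; apply: (reduced_TLI n_gt1 w_coxeter) => //; exact: eq_leq.
Qed.

Lemma twisted_labels_inj : {in labels (@TL n) c &, injective e}.
Proof.
have lab t : t \in labels (@TL n) c -> noncrossing_label w t.
  move=> /set_mem/labelsP[x [z /twisted_letters[_ h]]].
  by have [] := h t; rewrite ?mem_cat ?mem_head ?orbT.
move=> t t' /lab ht /lab ht'.
exact: (twisted_geom_label_inj w_coxeter q_sum not_exceptional_out ht ht').
Qed.

Lemma TF_TL_poset_iso : labeled_poset_iso TF (geom R c) (@TL n) c.
Proof. exact: reduced_words_iso reduced_TL_TF reduced_TF_TL twisted_labels_inj. Qed.
End IntervalComparison.

Theorem theorem5p10 (R : realType) (n : nat) (hn : (2 <= n)%N)
    (w : seq 'I_n) (hw : coxeter_word w)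
    (qout qinn : R) (hq : (qout + qinn = 1)%R)
    (hout : ~ exceptional #|outer w| #|inner w| qout)
    (hinn : ~ exceptional #|inner w| #|outer w| qinn) :
  labeled_poset_iso (TF w qout qinn) (geom R (coxeter w))
                    (@TL n) (coxeter w) /\
  group_iso (interval_group (TF w qout qinn) (geom R (coxeter w)))
            (interval_group (@TL n) (coxeter w)).
Proof.
have iso := TF_TL_poset_iso hn hw hq hout hinn.
by split=> //; exact: labeled_poset_iso_group_iso.
Qed.
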